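(* Let $n\in\mathbb N$ and $d\in\mathbb Z_+$. Consider the equations $$\frac{dv}{dt}=\sum_{j=1}^n f_j'\,v^{j+1}$$ on a compact interval $[a,b]$, where $f_1,\dots,f_n$ are real nonconstant Lipschitz functions on $[a,b]$ such that $F=(f_1,\dots,f_n):[a,b]\to\mathbb R^n$ satisfies $F(a)=F(b)=0$, has Lipschitz triangulable image, and belongs to the class $P_n^*(d)$ defined in the context. Then the set of universal centers of this class of equations is defined by vanishing of the moments $$\int_a^b f_1(t)^{d_1}\cdots f_n(t)^{d_n}\,f_i'(t)\,dt\quad\text{with}\quad d_j\in\mathbb Z_+,\ \max_{1\le j\le n}d_j\le d,\quad 1\le i\le n;$$ that is, for such $F$, the equation determines a universal center if and only if all these moments are equal to zero.
   Context: $\mathbb Z_+$ denotes the nonnegative integers. Universal center: the equation determines a universal center if all iterated integrals $\int\cdots\int_{a\le t_1\le\cdots\le t_k\le b}f'_{i_k}(t_k)\cdots f'_{i_1}(t_1)\,dt_k\cdots dt_1$, $k\ge1$, $i_1,\dots,i_k\in\{1,\dots,n\}$, vanish. (For Lipschitz $F$ with Lipschitz triangulable image $\Gamma_F$ this is known to be equivalent to: $F$ is a closed path contractible in $\Gamma_F$; and to: there are a finite tree $T$ and continuous maps $\tilde F:T\to\Gamma_F$, $\tilde f:[a,b]\to T$ with $\tilde f(a)=\tilde f(b)$ and $F=\tilde F\circ\tilde f$.) A compact set $\Gamma\subset\mathbb R^n$ is a Lipschitz triangulable curve if it is the union of finitely many arcs $\gamma_i$ such that for $i\ne j$ the intersection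 $\gamma_i\cap\gamma_j$ is either empty or consists of at most one of their endpoints, and each $\gamma_i$ is parameterized by a Lipschitz map $h_i:[0,1]\to\gamma_i\subset\mathbb R^n$ whose inverse is locally Lipschitz apart from the endpoints. Such a family $\{h_i\}$ is said to form a triangulation of $\Gamma$. Curves $\Gamma$ below are assumed connected. Traversable curves: an Eulerian trail in an undirected connected graph is a path that uses each edge exactly once; the graph is traversable if such a path exists, and unicursal if in addition the path is closed. A connected one-dimensional CW-complex $X$ is traversable (unicursal) if it is homeomorphic to a traversable (unicursal) graph. An Eulerian trail in such $X$ is then regarded as a continuous surjective map $\gamma:I\to X$, injective outside a finite set of points and traversing each edge exactly once, where $I$ is a closed arc of the unit circle $\mathbb S$, and $I=\mathbb S$ if and only if $X$ is unicursal. A path $\tilde\gamma:[a,b]\to X$ covers $\gamma$ if there is a path $\gamma':[a,b]\to I$ with $\tilde\gamma=\gamma\circ\gamma'$. For a compact Lipschitz triangulable curve $\Gamma\subset\mathbb R^n$, $P_n(\Gamma)$ is the set of closed Lipschitz paths $[a,b]\to\Gamma$ that cover Eulerian trails of traversable subcurves of $\Gamma$. Cubes and condition ( * ). All cubes in $\mathbb R^n$ have sides parallel to the coordinate axes; the radius of a cube is half of its sidelength. Suppose $\pi_1(\Gamma)$ is free with $m\ge1$ generators. Let $C_1,\dots,C_m\subset\Gamma$ be images of simple closed Lipschitz curves generating $H_1(\Gamma)$, $C:=\bigcup_jC_j$, and let $h_1,\dots,h_k:[0,1]\to C$ be Lipschitz curves forming a triangulation $\mathcal T$ of $C$, $\gamma_i:=h_i([0,1])$.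 Condition ( * ): there exist pairwise disjoint open cubes $K_i\subset\mathbb R^n$ with centers $c_i\in\gamma_i$ and natural numbers $s_i\in[1,n]$, $1\le i\le k$, such that for each $i$: (a) $K_i\cap\gamma_i$ is connected and $K_i\cap\gamma_j=\emptyset$ for all $j\ne i$; (b) the restriction to $K_i\cap\gamma_i$ of the projection $\pi_{s_i}(x_1,\dots,x_n):=(0,\dots,0,x_{s_i},0,\dots,0)$ is injective. The number $\bar N_{\mathcal T}$. Given $\mathcal T$, $K_i$, $s_i$ as in ( * ), let $r_i$ be the radius of $K_i$ and $l_i$ the linear measure of $\pi_{s_i}\bigl(\frac12K_i\cap\gamma_i\bigr)$, where $\frac12K_i:=\frac12(K_i-c_i)+c_i$; put $r_{\mathcal T}:=\min_ir_i$, $l_{\mathcal T}:=\min_il_i$, $L_{\mathcal T}:=\max_i\int_0^1\|h_i'(t)\|_{\ell_1^n}\,dt$ with $\|x\|_{\ell_1^n}:=\sum_{j=1}^n|x_j|$, and let $d_\Gamma$ be the radius of the minimal closed cube containing $C$. Then $$\bar N_{\mathcal T}:=\left\lfloor\frac{2\pi n\,L_{\mathcal T}\,d_\Gamma}{r_{\mathcal T}\,l_{\mathcal T}}\right\rfloor+1 .$$ $C_n^*$ is the class of compact Lipschitz triangulable curves $\Gamma\subset\mathbb R^n$ satisfying condition ( * ) (curves with $\pi_1(\Gamma)=\{1\}$ are included). For $\Gamma\in C_n^*$ with $\pi_1(\Gamma)\ne\{1\}$ let $\bar N_\Gamma:=\min_{\mathcal T}\bar N_{\mathcal T}$, the minimum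 over all triangulations satisfying condition ( * ) (together with admissible cubes $K_i$ and indices $s_i$); if $\pi_1(\Gamma)=\{1\}$, put $\bar N_\Gamma:=0$. Finally $C_n^*(d):=\{\Gamma\in C_n^*:\bar N_\Gamma\le d\}$ and $P_n^*(d):=\bigcup_{\Gamma\in C_n^*(d)}P_n(\Gamma)$. *)

(* Defs.v *)
From HB Require Import structures.
From mathcomp Require Import all_boot all_order all_algebra.
From mathcomp Require Import all_classical all_reals all_analysis.
Set Implicit Arguments.
Unset Strict Implicit.
Unset Printing Implicit Defensive.
Import Order.TTheory GRing.Theory Num.Theory.
Import numFieldNormedType.Exports.
Local Open Scope classical_set_scope.
Local Open Scope ring_scope.

(* Paths are total functions on R of which only the restriction to [a, b] (or  *)
(* [0, 1]) matters. A Lipschitz function is derivable almost everywhere, so    *)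
(* the values of the total function derive1 f elsewhere do not affect integrals. *)

Section lipschitz_curves.
Context {R : realType} {n : nat}.
Local Notation V := 'rV[R]_n.
Implicit Types (X G : set V) (h : R -> V).

(* The function g is the inverse of h. *)
Definition lipschitz_arc h :=
  [lipschitz h t | t in `[0, 1]] /\
  exists g : V -> R,
    (forall t, t \in `[0, 1] -> g (h t) = t) /\
    forall t, t \in `]0, 1[ -> exists2 U, nbhs (h t) U &
      [lipschitz g x | x in U `&` (h @` `[0, 1])].

Definition arc_end h : set V := [set h 0; h 1].

(* Two distinct arcs may only meet in one point, an endpoint of both. *)
Definition triangulation k (h : 'I_k.+1 -> R -> V) X :=
  [/\ forall i, lipschitz_arc (h i),
      \bigcup_i (h i @` `[0, 1]) = X &
      forall i j, i != j ->
        (h i @` `[0, 1]) `&` (h j @` `[0, 1]) = set0 \/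
        exists2 p, (arc_end (h i) `&` arc_end (h j)) p &
          (h i @` `[0, 1]) `&` (h j @` `[0, 1]) = [set p]].

Definition triangulable_curve G :=
  [/\ compact G, connected G &
      exists (k : nat) (h : 'I_k.+1 -> R -> V), triangulation h G].

End lipschitz_curves.

Section eulerian_trails.
Context {R : realType} {n : nat}.
Local Notation V := 'rV[R]_n.
Implicit Types (X G : set V).

(* A homeomorphism of X with a finite undirected multigraph (loops allowed),   *)
(* given as a one-dimensional CW structure: W is the set of vertices and the   *)
(* e i are the characteristic maps of the edges.                               *)
Definition graph_structure X (W : set V) k (e : 'I_k.+1 -> R -> V) :=
  [/\ finite_set W,
      forall i, [/\ {within `[0, 1], continuous (e i)}, W (e i 0), W (e i 1),
        set_inj `]0, 1[ (e i) & (e i @` `]0, 1[) `&` W = set0],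
      forall i j, i != j -> (e i @` `]0, 1[) `&` (e j @` `]0, 1[) = set0 &
      X = W `|` \bigcup_i (e i @` `[0, 1])].

(* An edge together with a direction; the direction true is from e i 1 to e i 0. *)
Definition origin k (e : 'I_k.+1 -> R -> V) (x : 'I_k.+1 * bool) : V :=
  e x.1 (x.2%:R).
Definition target k (e : 'I_k.+1 -> R -> V) (x : 'I_k.+1 * bool) : V :=
  e x.1 ((~~ x.2)%:R).

Definition once_each k (w : seq ('I_k.+1 * bool)) :=
  perm_eq (unzip1 w) (enum 'I_k.+1).

Definition traversable_graph k (e : 'I_k.+1 -> R -> V) :=
  exists2 w, once_each w & sorted (fun x y => target e x == origin e y) w.

Definition unicursal_graph k (e : 'I_k.+1 -> R -> V) :=
  exists2 w, once_each w & cycle (fun x y => target e x == origin e y) w.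

Definition unicursal X :=
  connected X /\ exists (W : set V) (k : nat) (e : 'I_k.+1 -> R -> V),
    graph_structure X W e /\ unicursal_graph e.

Definition unit_circle : set (R * R) := [set z | z.1 ^+ 2 + z.2 ^+ 2 = 1].

Definition circle_arc (al be : R) : set (R * R) :=
  [set (cos th, sin th) | th in `[al, be]].

Definition is_circle_arc (I : set (R * R)) :=
  exists al be, al < be <= al + 2 * pi /\ I = circle_arc al be.

(* The edge e i is traversed exactly once when the parameters sent into the    *)
(* open edge form a connected set on which gam is injective.                   *)
Definition eulerian_trail X (I : set (R * R)) (gam : R * R -> V) :=
  connected X /\
  exists (W : set V) (k : nat) (e : 'I_k.+1 -> R -> V),
  [/\ graph_structure X W e, traversable_graph e &
  [/\ is_circle_arc I, {within I, continuous gam}, gam @` I = X,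
      exists2 E, finite_set E & set_inj (I `\` E) gam &
      (forall i, let J := I `&` gam @^-1` (e i @` `]0, 1[) in
         connected J /\ set_inj J gam) /\
      (I = unit_circle <-> unicursal X)]].

Definition covers (a b : R) (F : R -> V) (I : set (R * R)) (gam : R * R -> V) :=
  exists2 q : R -> R * R, {within `[a, b], continuous q} &
    forall t, t \in `[a, b] -> I (q t) /\ F t = gam (q t).

(* The class P_n(G). *)
Definition class_P (a b : R) G (F : R -> V) :=
  [/\ [lipschitz F t | t in `[a, b]], F @` `[a, b] `<=` G, F a = F b &
      exists (X : set V) (I : set (R * R)) (gam : R * R -> V),
        [/\ X `<=` G, triangulable_curve X, eulerian_trail X I gam &
            covers a b F I gam]].

End eulerian_trails.

Section fundamental_group.
Context {R : realType} {n : nat}.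
Local Notation V := 'rV[R]_n.
Implicit Types (X : set V) (p q : R -> V).

Definition loop_at X (x0 : V) p :=
  [/\ {within `[0, 1], continuous p}, p @` `[0, 1] `<=` X, p 0 = x0 & p 1 = x0].

Definition loop_homotopic X (x0 : V) p q :=
  exists H : R * R -> V,
  let Q := `[0, 1]%classic `*` `[0, 1]%classic in
  [/\ {within Q, continuous H}, H @` Q `<=` X &
      forall t, t \in `[0, 1] ->
        [/\ H (0, t) = p t, H (1, t) = q t, H (t, 0) = x0 & H (t, 1) = x0]].

Definition loop_mul p q : R -> V :=
  fun t => if t <= 2^-1 then p (2 * t) else q (2 * t - 1).
Definition loop_inv p : R -> V := fun t => p (1 - t).

(* The letter (i, true) stands for the inverse of the i-th generator. *)
Fixpoint word_loop (x0 : V) m (g : 'I_m -> R -> V) (w : seq ('I_m * bool)) :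
  R -> V :=
  if w is (i, b) :: w' then
    loop_mul (if b then loop_inv (g i) else g i) (word_loop x0 g w')
  else cst x0.

Definition reduced_word m (w : seq ('I_m * bool)) :=
  sorted (fun x y => ~~ ((x.1 == y.1) && (x.2 != y.2))) w.

(* X is path connected in all uses, so the base point is immaterial. *)
Definition pi1_free X (m : nat) :=
  forall x0, X x0 -> exists g : 'I_m -> R -> V,
    (forall i, loop_at X x0 (g i)) /\
    forall p, loop_at X x0 p -> exists! w : seq ('I_m * bool),
      reduced_word w /\ loop_homotopic X x0 p (word_loop x0 g w).

Definition pi1_trivial X :=
  forall x0 p, X x0 -> loop_at X x0 p -> loop_homotopic X x0 p (cst x0).

End fundamental_group.

(* Singular homology in degree 1. Singular chains are finitely supported       *)
(* integer-valued functions on singular simplices.                             *)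
Section first_homology.
Context {R : realType} {n : nat}.
Local Notation V := 'rV[R]_n.
Implicit Types (X : set V).

Definition simplex1 X (sg : R -> V) :=
  {within `[0, 1], continuous sg} /\ sg @` `[0, 1] `<=` X.

Definition triangle : set (R * R) :=
  [set z | [/\ 0 <= z.1, 0 <= z.2 & z.1 + z.2 <= 1]].

Definition simplex2 X (T : R * R -> V) :=
  {within triangle, continuous T} /\ T @` triangle `<=` X.

Definition chain0 (x : V) : V -> int := fun y => (y == x)%:R.

(* The generator depends only on the restriction of sg to [0, 1]. *)
Definition chain1 (sg : R -> V) : (R -> V) -> int :=
  fun tau => `[< forall t, t \in `[0, 1] -> tau t = sg t >]%:R.

Definition boundary1 (sg : R -> V) : V -> int := chain0 (sg 1) - chain0 (sg 0).

Definition boundary2 (T : R * R -> V) : (R -> V) -> int :=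
  chain1 (fun t => T (1 - t, t)) - chain1 (fun t => T (0, t))
    + chain1 (fun t => T (t, 0)).

Definition generate_H1 X m (c : 'I_m -> R -> V) :=
  forall (N : nat) (z : 'I_N -> int) (sg : 'I_N -> R -> V),
    (forall i, simplex1 X (sg i)) -> \sum_i boundary1 (sg i) *~ z i = 0 ->
  exists (y : 'I_m -> int) (M : nat) (u : 'I_M -> int) (T : 'I_M -> R * R -> V),
    (forall l, simplex2 X (T l)) /\
    \sum_i chain1 (sg i) *~ z i - \sum_j chain1 (c j) *~ y j
      = \sum_l boundary2 (T l) *~ u l.

End first_homology.

Section condition_star.
Context {R : realType} {n : nat}.
Local Notation V := 'rV[R]_n.
Implicit Types (X G : set V).

Definition open_cube (c : V) (r : R) : set V :=
  [set x | forall j, `|x 0 j - c 0 j| < r].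
Definition closed_cube (c : V) (r : R) : set V :=
  [set x | forall j, `|x 0 j - c 0 j| <= r].

Definition axis_proj (s : 'I_n) (x : V) : V :=
  \row_j (if j == s then x 0 j else 0).

(* The linear measure of a subset A of the s-th coordinate axis. *)
Definition axis_measure (s : 'I_n) (A : set V) : R :=
  fine (lebesgue_measure [set x 0 s | x in A]).

Definition simple_closed_lipschitz (c : R -> V) :=
  [/\ [lipschitz c t | t in `[0, 1]], c 0 = c 1 & set_inj `[0, 1[ c].

Record star_datum G := StarDatum {
  sd_m : nat;
  sd_m_gt0 : (0 < sd_m)%N;
  sd_free : pi1_free G sd_m;
  sd_gen : 'I_sd_m -> R -> V;
  sd_gen_simple : forall j, simple_closed_lipschitz (sd_gen j);
  sd_gen_sub : forall j, sd_gen j @` `[0, 1] `<=` G;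
  sd_gen_H1 : generate_H1 G sd_gen;
  sd_C : set V := \bigcup_j (sd_gen j @` `[0, 1]);
  sd_k : nat;
  sd_h : 'I_sd_k.+1 -> R -> V;
  sd_triang : triangulation sd_h sd_C;
  sd_arc : 'I_sd_k.+1 -> set V := fun i => sd_h i @` `[0, 1];
  sd_center : 'I_sd_k.+1 -> V;
  sd_center_in : forall i, sd_arc i (sd_center i);
  sd_radius : 'I_sd_k.+1 -> R;
  sd_radius_gt0 : forall i, 0 < sd_radius i;
  sd_cube : 'I_sd_k.+1 -> set V :=
    fun i => open_cube (sd_center i) (sd_radius i);
  sd_disjoint : forall i j, i != j -> sd_cube i `&` sd_cube j = set0;
  sd_dir : 'I_sd_k.+1 -> 'I_n;
  sd_connected : forall i, connected (sd_cube i `&` sd_arc i);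
  sd_avoid : forall i j, j != i -> sd_cube i `&` sd_arc j = set0;
  sd_inj : forall i, set_inj (sd_cube i `&` sd_arc i) (axis_proj (sd_dir i))
}.

Arguments sd_h {G} s _ _.
Arguments sd_arc {G} s _ _.
Arguments sd_center {G} s _.
Arguments sd_radius {G} s _.
Arguments sd_dir {G} s _.

Definition l1_length (h : R -> V) : R :=
  \int[lebesgue_measure]_(t in `[0, 1]) \sum_j `|derive1 (fun s => h s 0 j) t|.

Definition min_cube_radius X : R :=
  inf [set r | 0 <= r /\ exists c, X `<=` closed_cube c r].

Definition half_trace G (T : star_datum G) (i : 'I_(sd_k T).+1) : R :=
  axis_measure (sd_dir T i)
    (axis_proj (sd_dir T i) @`
      (open_cube (sd_center T i) (sd_radius T i / 2) `&` sd_arc T i)).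

Definition NbarT G (T : star_datum G) : int :=
  let rT := \big[Num.min/sd_radius T ord0]_i sd_radius T i in
  let lT := \big[Num.min/half_trace (T := T) ord0]_i half_trace (T := T) i in
  let LT := \big[Num.max/l1_length (sd_h T ord0)]_i l1_length (sd_h T i) in
  Num.floor (2 * pi * n%:R * LT * min_cube_radius (sd_C T) / (rT * lT)) + 1.

(* The class C_n^*. *)
Definition class_Cstar G :=
  triangulable_curve G /\ (pi1_trivial G \/ inhabited (star_datum G)).

(* N is the number attached to G: the least NbarT T, or 0 if pi_1(G) = {1}. *)
Definition is_Nbar G (N : int) :=
  (pi1_trivial G /\ N = 0) \/
  [/\ ~ pi1_trivial G, exists T : star_datum G, NbarT T = N &
      forall T : star_datum G, N <= NbarT T].

Definition class_Cstar_le (d : nat) G :=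
  class_Cstar G /\ exists2 N, is_Nbar G N & N <= d%:Z.

(* The class P_n^*(d), for paths parameterized by [a, b]. *)
Definition class_Pstar (a b : R) (d : nat) (F : R -> V) :=
  exists2 G, class_Cstar_le d G & class_P a b G F.

End condition_star.

Section centers.
Context {R : realType} {n : nat}.
Variables (a b : R) (f : 'I_n -> R -> R).

Definition path_of : R -> 'rV[R]_n := fun t => \row_j f j t.

(* iterated_integral s [:: i_1; ...; i_k] is the integral of                   *)
(* f'_{i_k}(t_k) ... f'_{i_1}(t_1) over s <= t_1 <= ... <= t_k <= b, with      *)
(* t_k as the innermost variable.                                              *)
Fixpoint iterated_integral (s : R) (w : seq 'I_n) : R :=
  if w is i :: w' then
    \int[lebesgue_measure]_(t in `[s, b]) (derive1 (f i) t * iterated_integral t w')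
  else 1.

(* The equation v' = \sum_j f_j' v^(j+1) on [a, b] has a universal center. *)
Definition universal_center :=
  forall w : seq 'I_n, w != [::] -> iterated_integral a w = 0.

Definition moment (e : 'I_n -> nat) (i : 'I_n) : R :=
  \int[lebesgue_measure]_(t in `[a, b])
    ((\prod_j f j t ^+ e j) * derive1 (f i) t).

End centers.

(* Main.v *)
(** If all moments vanish, then the integrals of [P dx_s] along [F] vanish for
    all polynomials [P] of degree at most [d] in each variable. On the other
    hand, by homology invariance, the integral of any continuous form along [F]
    is a linear combination, with coefficients [M i] independent of the form, of
    its integrals along the arcs of the triangulation of [C]. Test this with the
    forms [psi_s dx_s], where [psi_s] is the signed sum of tent functions
    supported in the cubes with direction [s]: it is Lipschitz with constant
    [2 / r], hence by a Jackson estimate at distance at most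
    [n (2 / r) rho pi / (d + 2)] from such polynomials on a cube of radius
    [rho], whereas its integral along the i-th arc is at least [l] in absolute
    value. The bound on the number attached to the triangulation then forces
    [M = 0], so every continuous form integrates to zero along [F].

    A path which covers an Eulerian trail is [gam] composed with a path on the
    circle; lifting the latter to [th], forms supported in a small piece of an
    edge show [th a = th b]. Hence [F] is tree-like and all iterated integrals
    vanish. Conversely, the moments are linear combinations of iterated
    integrals (shuffle product). *)

Require Import Defs.
From HB Require Import structures.
From mathcomp Require Import all_boot all_order all_algebra.
From mathcomp Require Import all_classical all_reals all_analysis.
From mathcomp Require Import measurable_realfun ring lra zify.
Set Implicit Arguments.
Unset Strict Implicit.
Unset Printing Implicit Defensive.
Import Order.TTheory GRing.Theory Num.Theory.
Import numFieldNormedType.Exports.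
Local Open Scope classical_set_scope.
Local Open Scope ring_scope.

(** * Densities of Lipschitz functions *)

Section lipschitz_density.
Context {R : realType}.
Implicit Types (f g : R -> R) (a b K : R).
Local Notation mu := (@lebesgue_measure R).

(** The bound is a product of explicit constants: tents of slope 2 / r, a one-variable Jackson error
    pi / (d + 2) with no further factor, [n] from adding the coordinate errors, and the l1 length by
    which a uniform error is multiplied along an arc. As the radius of the curve is an infimum, a
    slightly larger cube is used; the gap between d and d + 2 pays for it.

    Two obstacles shape the analysis. The functions are only Lipschitz and [derive1] is arbitrary on
    a null set, so it is traded for a bounded density. The angular lifts are merely continuous, so
    no chain rule passes through them. Integrals are therefore compared locally: an approximate
    primitive whose error is relative to the increment of the Lipschitz function survives
    composition with a continuous map.

    Homology enters only through maps to the circle. Collapsing all but one arc to a point turns the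
    coefficient of that arc into a number of turns, which vanishes on boundaries of 2-simplices
    because maps from a square to the circle lift to the line. In the last step the tree is an
    interval, the range of the lift. *)

Definition clamp a b x : R := Num.max a (Num.min b x).

Lemma clamp_itv a b x : a <= b -> clamp a b x \in `[a, b].
Proof.
move=> ab; rewrite in_itv/= /clamp le_max lexx/= ge_max ab/= ge_min lexx//.
Qed.

Lemma clamp_id a b x : x \in `[a, b] -> clamp a b x = x.
Proof.
by rewrite in_itv/= => /andP[ax xb]; rewrite /clamp (min_idPr xb) (max_idPr ax).
Qed.

Lemma clamp_homo a b : {homo clamp a b : x y / x <= y}.
Proof.
move=> x y xy; rewrite /clamp !maxElt !minElt.
by case: (ltP b x) => ?; case: (ltP b y) => ?; do 2?case: ltP => ?; lra.
Qed.

Lemma clamp_lip a b x y : a <= b -> `|clamp a b x - clamp a b y| <= `|x - y|.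
Proof.
move=> ab; wlog xy : x y / x <= y => [h|].
  by have [/h//|/ltW/h] := leP x y; rewrite distrC (distrC y).
rewrite distrC (distrC x) ger0_norm ?subr_ge0 ?clamp_homo// ger0_norm ?subr_ge0//.
rewrite /clamp !maxElt !minElt.
by case: (ltP b x) => ?; case: (ltP b y) => ?; do 2?case: ltP => ?; lra.
Qed.

Lemma klip_continuous f K : 0 < K -> (forall x y, `|f x - f y| <= K * `|x - y|) ->
  continuous f.
Proof.
move=> K0 fK x; apply/cvgrPdist_lt => e e0; near=> y.
rewrite (le_lt_trans (fK _ _))// mulrC -ltr_pdivlMr//; near: y.
by apply: cvgr_dist_lt => //; exact: divr_gt0.
Unshelve. all: by end_near. Qed.

(** A Lebesgue null set is covered by half-open intervals of total length below e / K, and the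
    Stieltjes measure of each is at most [K] times its length. *)
Lemma null_dominates_klip (G : cumulative R R) (K : R) : 0 < K ->
  (forall x y, x <= y -> G y - G x <= K * (y - x)) ->
  lebesgue_stieltjes_measure G `<< mu.
Proof.
move=> K0 GK; apply/null_content_dominatesP => A mA A0.
apply/eqP; rewrite eq_le measure_ge0 andbT.
apply/lee_addgt0Pr => e e0; rewrite add0e.
have {}A0 : mu_ext (wlength (@idfun R)) A = 0%E by exact: A0.
have : (mu_ext (wlength (@idfun R)) A < (e / K)%:E)%E by rewrite A0 lte_fin divr_gt0.
move=> /ereal_inf_lt[_ [F [mF AF] <-]] FeK.
rewrite /lebesgue_stieltjes_measure/= /measure_extension/=.
apply: (@le_trans _ _ (\sum_(0 <= k <oo) wlength G (F k))%E).
  by apply: ereal_inf_lbound; exists F.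
apply: (@le_trans _ _ (\sum_(0 <= k <oo) (K%:E * wlength (@idfun R) (F k))%E)%E).
  apply: lee_nneseries => k _ //.
  have [[x y] _ <-] := mF k => /=.
  rewrite !wlength_itv/= !lte_fin; case: ifPn => // xy; last by rewrite mule0.
  by rewrite -EFinB -EFinM lee_fin GK// ltW.
rewrite nneseriesZl//.
rewrite -[e](divfK (lt0r_neq0 K0)) mulrC EFinM lee_pmul2l ?lte_fin//.
exact: ltW.
Qed.

Lemma derive1_klip_le f x K (A : set R) : nbhs x A ->
  (forall y, A y -> `|f y - f x| <= K * `|y - x|) ->
  derivable f x 1 -> `|derive1 f x| <= K.
Proof.
move=> /nbhs_ballP[e /= e0 eA] fK dfx.
have cf : h^-1 *: (f (h + x) - f x) @[h --> 0^'] --> derive1 f x.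
  have dq : (fun h => h^-1 *: (f (h + x) - f x)) =
      (fun h => h^-1 *: ((f \o shift x) (h *: 1) - f x)).
    by apply/funext => h; rewrite /= [h *: 1]mulr1.
  by rewrite /derive1 dq; exact: dfx.
apply: (cvgr_to_le (cvg_norm cf)); near=> h => /=.
have h0 : h != 0 by near: h; exact: nbhs_dnbhs_neq.
rewrite normrM normfV ler_pdivrMl ?normr_gt0// mulrC.
rewrite -[X in _ * `|X|](addrK x) fK//; apply: eA.
rewrite /ball/= opprD addrCA subrr addr0 normrN; near: h.
exact: dnbhs0_lt.
Unshelve. all: by end_near. Qed.

Lemma bounded_itv_lty (bl br : bool) x y :
  (mu [set` Interval (BSide bl x) (BSide br y)] < +oo)%E.
Proof. by rewrite lebesgue_measure_itv/= lte_fin; case: ifP => _; rewrite ltry. Qed.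

Lemma fine_itv_measure (bl br : bool) x y : x <= y ->
  fine (mu [set` Interval (BSide bl x) (BSide br y)]) = y - x.
Proof.
rewrite lebesgue_measure_itv/= lte_fin le_eqVlt => /predU1P[->|->].
  by rewrite ltxx subrr.
by rewrite -EFinB.
Qed.

(** Adding [K * x] makes [f] nondecreasing with increments at most 2K(y - x), so its Stieltjes
    measure is absolutely continuous and has a Radon-Nikodym density. Subtracting [K] leaves a
    density of [f], and Lebesgue differentiation identifies it with the derivative almost
    everywhere. *)
Lemma lipschitz_density f a b K : a < b -> 0 < K ->
  {in `[a, b] &, forall x y, `|f x - f y| <= K * `|x - y|} ->
  exists g : R -> R, [/\ measurable_fun setT g,
    forall t, `|g t| <= K,
    {ae mu, forall t, a < t < b -> derive1 f t = g t} &
    forall x y, a <= x -> x <= y -> y <= b ->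
      \int[mu]_(t in `[x, y]) g t = f y - f x].
Proof.
move=> ab K0 fK.
(* Clamping makes this function constant outside [a, b], hence a distribution function on the whole
   line. *)
pose G0 := fun x => f (clamp a b x) + K * clamp a b x.
have G0E x y : x <= y -> 0 <= G0 y - G0 x <= (2 * K) * (y - x).
  move=> xy; have abW := ltW ab.
  have h1 := clamp_homo a b xy; have := clamp_lip y x abW.
  have := fK _ _ (clamp_itv y abW) (clamp_itv x abW).
  rewrite ler_norml (ger0_norm (_ : 0 <= clamp a b y - _)) ?subr_ge0//.
  rewrite (ger0_norm (_ : 0 <= y - x)) ?subr_ge0// /G0 => /andP[h3 h4] h2.
  have : K * (clamp a b y - clamp a b x) <= K * (y - x) by rewrite ler_pM2l.
  lra.
have G0nd : {homo G0 : x y / x <= y}.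
  by move=> x y /G0E /andP[]; rewrite subr_ge0.
have G0c : continuous G0.
  apply: (@klip_continuous _ (2 * K)); first by rewrite mulr_gt0.
  move=> x y; wlog xy : x y / x <= y => [h|].
    by have [/h//|/ltW/h] := leP x y; rewrite distrC (distrC y).
  rewrite distrC (distrC x) [X in _ * X]ger0_norm ?subr_ge0//.
  by have /andP[h1 h2] := G0E _ _ xy; rewrite ger0_norm.
pose iG := isCumulative.Build R _ R G0 G0nd (right_continuousW G0c).
pose G : cumulative R R := HB.pack G0 iG.
have K2 : 0 < 2 * K by rewrite mulr_gt0.
pose nu : {measure set (measurableTypeR R) -> \bar R} := lebesgue_stieltjes_measure G.
have nuE x y : x <= y -> nu `]x, y]%classic = (G0 y - G0 x)%:E.
  move=> xy; transitivity (wlength G `]x, y]%classic).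
    exact: (measurable_mu_extE (wlength G) (is_ocitv x y)).
  rewrite wlength_itv/= lte_fin; case: ifPn => //; rewrite -leNgt => yx.
  have -> : x = y by apply/eqP; rewrite eq_le xy yx.
  by rewrite subrr.
have nuab : (nu `]a, b]%classic < +oo)%E by rewrite nuE ?ltW// ltry.
pose nu' : {finite_measure set (measurableTypeR R) -> \bar R} :=
  @mfrestr _ (measurableTypeR R) R `]a, b]%classic nu (measurable_itv `]a, b]) nuab.
have nunu' : nu' `<< mu.
  apply/null_content_dominatesP => A mA A0.
  rewrite /nu'/= /mfrestr /mrestr.
  have GK x y : x <= y -> G y - G x <= 2 * K * (y - x) by move=> /G0E /andP[].
  have /null_content_dominatesP := null_dominates_klip K2 GK.
  apply; first exact: measurableI.
  by apply/eqP; rewrite -measure_le0 -A0 le_measure// inE//; exact: measurableI.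
have [h [h0 hfin hint hE]] := radon_nikodym_sigma_finite nunu'.
pose g0 : R -> R := fun t => fine (h t).
have hg : h = EFin \o g0 by apply/funext => t; rewrite /= fineK.
have g0int : mu.-integrable [set: R] (EFin \o g0) by rewrite -hg; exact: hint.
have mg0 : measurable_fun setT g0.
  by apply/measurable_EFinP; exact: measurable_int g0int.
have g0E x y : a <= x -> x <= y -> y <= b ->
    \int[mu]_(t in `]x, y]) g0 t = f y - f x + K * (y - x).
  move=> ax xy yb; rewrite /Rintegral.
  have -> : (\int[mu]_(t in `]x, y]) (g0 t)%:E)%E = nu' `]x, y]%classic.
    by rewrite hE// hg.
  rewrite /nu'/= /mfrestr /mrestr setIidl; last first.
    by move=> t /=; rewrite !in_itv/= => /andP[h1 h2]; apply/andP; split; lra.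
  rewrite nuE//= /G0 !clamp_id ?in_itv/=; [lra|apply/andP; split; lra..].
(* Truncation gives the bound by [K] at every point; inside ]a, b[ it changes the density only on a
   null set. *)
pose g t := Num.max (- K) (Num.min K (g0 t - K)).
have mg : measurable_fun setT g.
  apply: measurable_maxr => //; apply: measurable_minr => //.
  exact: measurable_funB.
have gK t : `|g t| <= K.
  rewrite ler_norml /g; apply/andP; split; first by rewrite le_max lexx.
  by rewrite ge_max ge_min lexx/= andbT; lra.
have aeg : {ae mu, forall t, a < t < b -> derive1 f t = g0 t - K /\ g0 t - K = g t}.
  have loc : locally_integrable setT g0 by apply: (open_integrable_locally (@openT R)).
  have g0y y : mu.-integrable `]-oo, y] (EFin \o g0) by exact: integrableS g0int.
  have := FTC1Ny g0y loc.
  apply: filterS; first exact: (ae_filter_ringOfSetsType mu).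
  move=> t /= Ht /andP[at' tb]; have [dF F't] := Ht.
  set F := fun _ => _ in dF F't.
  (* Since the measure is restricted to ]a, b], the antiderivative from -oo agrees with [f] on ]a,
     b[ up to an affine function. *)
  have FE x : x \in `]a, b[ -> F x - K * x + (f a + K * a) = f x.
    rewrite in_itv/= => /andP[ax xb]; rewrite /F /Rintegral.
    have -> : (\int[mu]_(t in `]-oo, x]) (g0 t)%:E)%E = nu' `]-oo, x]%classic.
      by rewrite hE// hg.
    rewrite /nu'/= /mfrestr /mrestr.
    have -> : `]-oo, x] `&` `]a, b] = `]a, x]%classic.
      rewrite eqEsubset; split=> y /=; rewrite !in_itv/=; last first.
        by move=> /andP[ay yx]; rewrite yx ay (le_trans yx)// ltW.
      by move=> [yx /andP[-> _]].
    rewrite nuE//= ?ltW// /G0 !clamp_id ?in_itv/= ?lexx ?(ltW ax) ?(ltW xb) ?(ltW ab)//.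
    ring.
  have df : is_derive t 1 f (g0 t - K).
    have dF' : is_derive t 1 F (g0 t) by apply: (DeriveDef dF); rewrite -derive1E; exact: F't.
    have dFK : is_derive t 1 (fun x => F x - K * x + (f a + K * a)) (g0 t - K).
      apply: is_derive_eq; rewrite /GRing.scale/=; ring.
    have near_f : \near t, F t - K * t + (f a + K * a) = f t.
      have : nbhs t `]a, b[%classic.
        by apply: open_nbhs_nbhs; split => //=; rewrite in_itv/= at' tb.
      by apply: filterS => x; exact: FE.
    apply: DeriveDef.
      by apply: (near_eq_derivable near_f); exact: (@ex_derive _ _ _ _ _ _ _ dFK).
    by rewrite -(near_eq_derive _ near_f); exact: (@derive_val _ _ _ _ _ _ _ dFK).
  have f't : derive1 f t = g0 t - K by rewrite derive1E (@derive_val _ _ _ _ _ _ _ df).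
  split => //.
  have : `|derive1 f t| <= K.
    apply: (@derive1_klip_le _ _ _ `]a, b[%classic _ _ (@ex_derive _ _ _ _ _ _ _ df)).
      by apply: open_nbhs_nbhs; split => //=; rewrite in_itv/= at' tb.
    move=> y /=; rewrite in_itv/= => /andP[ay yb]; apply: fK; rewrite in_itv/= ?ltW//.
  rewrite f't ler_norml => /andP[h1 h2].
  by rewrite /g (min_idPr h2) (max_idPr h1).
exists g; split => //.
  apply: filterS aeg; first exact: (ae_filter_ringOfSetsType mu).
  by move=> t /= + h1 => /(_ h1)[-> ->].
move=> x y ax xy yb.
have gint : mu.-integrable `]x, y] (EFin \o g).
  apply: measurable_bounded_integrable => //.
  - exact: bounded_itv_lty.
  - exact: measurable_funS mg.
  - by exists K; split; [exact: num_real|move=> M KM t _ /=; apply: le_trans (gK t) _; exact: ltW].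
rewrite -Rintegral_itv_obnd_cbnd// -Rintegral_itv_bndo_bndc; last first.
  by apply: integrableS gint => // t /=; rewrite !in_itv/= => /andP[-> /ltW].
transitivity (\int[mu]_(t in `]x, y[) (g0 t - K)).
  congr fine; apply: ae_eq_integral => //.
  - by apply/measurable_EFinP; exact: measurable_funS mg.
  - by apply/measurable_EFinP; apply: measurable_funB => //; exact: measurable_funS mg0.
  apply: filterS aeg; first exact: (ae_filter_ringOfSetsType mu).
  move=> t /= h1; rewrite in_itv/= => /andP[h2 h3].
  have /h1[_ ->] // : a < t < b by apply/andP; split; lra.
have g0i : mu.-integrable `]x, y] (EFin \o g0) by exact: integrableS g0int.
have Ki : mu.-integrable `]x, y] (EFin \o cst K).
  apply: measurable_bounded_integrable => //.
  - exact: bounded_itv_lty.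
  - by exists `|K|; split; [exact: num_real|move=> M KM t _ /=; exact: ltW].
have Bi : mu.-integrable `]x, y] (EFin \o (fun t => g0 t - K)).
  exact: (integrableB _ g0i Ki).
rewrite Rintegral_itv_bndo_bndc; last first.
  by apply: integrableS Bi => // t /=; rewrite !in_itv/= => /andP[-> /ltW].
rewrite RintegralB// g0E// Rintegral_cst//.
have -> := fine_itv_measure false false xy.
ring.
Qed.

End lipschitz_density.

(** * Integrals of continuous functions against Lipschitz functions *)

Section ae_eq.
Local Open Scope ereal_scope.
Context d (T : measurableType d) (R : realType) (mu : {measure set T -> \bar R}).
Import HBNNSimple.

(** The integral of a nonnegative function is a supremum over the simple functions below it,
    measurable or not. Such a simple function, set to zero on the null set where the two functions
    differ, lies below the other one and keeps its integral. This allows [derive1 f] to be replaced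
    by a density without discussing its measurability. *)
Lemma ge0_ae_le_integral_nonmeasurable (f g : T -> \bar R) :
  (forall x, 0 <= f x) -> (forall x, 0 <= g x) ->
  (\forall x \ae mu, f x = g x) -> \int[mu]_x f x <= \int[mu]_x g x.
Proof.
move=> f0 g0 [N [mN N0 fgN]]; rewrite !ge0_integralTE//.
apply: ge_ereal_sup => _ [h /= hf <-].
have mNC : measurable (~` N) by exact: measurableC.
apply: le_ereal_sup_tmp; exists (sintegral mu (proj_nnsfun h mNC)).
  exists (proj_nnsfun h mNC) => // x /=.
  rewrite mindicE; case: (boolP (x \in ~` N)) => xN; last by rewrite mulr0.
  rewrite mulr1; have <- : f x = g x; last exact: hf.
  apply: contrapT => fgx; move: xN; rewrite inE; apply; exact: fgN.
have -> : sintegral mu h = \int[mu]_x (h x)%:E by rewrite integral_nnsfun// patch_setT.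
rewrite (ge0_negligible_integral mN)//; last 2 first.
- exact/measurable_EFinP.
- by move=> x _; rewrite lee_fin.
by rewrite setTD (integral_nnsfun _ mNC) mrestrict.
Qed.

Lemma ae_eq_integral_nonmeasurable (D : set T) (f g : T -> \bar R) :
  ae_eq mu D f g -> \int[mu]_(x in D) f x = \int[mu]_(x in D) g x.
Proof.
move=> fg; rewrite [LHS]integralE [RHS]integralE.
have key u v : (forall x, 0 <= u x) -> (forall x, 0 <= v x) -> ae_eq mu D u v ->
    \int[mu]_(x in D) u x = \int[mu]_(x in D) v x.
  move=> u0 v0 uv; rewrite integral_mkcond [RHS]integral_mkcond.
  have uv' : \forall x \ae mu, (u \_ D) x = (v \_ D) x.
    apply: filterS uv => x h; rewrite /patch; case: ifPn => // xD.
    by apply: h; exact: set_mem.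
  have vu' : \forall x \ae mu, (v \_ D) x = (u \_ D) x by apply: filterS uv'.
  by apply/eqP; rewrite eq_le; apply/andP; split;
    apply: ge0_ae_le_integral_nonmeasurable => // x; rewrite erestrict_ge0.
by have /ae_eq_funeposneg[fgp fgn] := fg; congr (_ - _); apply: key.
Qed.

End ae_eq.

(** * Continuity on a set in epsilon-delta form *)

Section epsilon_delta.
Context {R : realType}.

Definition econt {U V : normedModType R} (A : set U) (g : U -> V) :=
  forall x, A x -> forall e, 0 < e ->
    exists2 d, 0 < d & forall y, A y -> `|y - x| < d -> `|g y - g x| < e.

Lemma econtP {U V : normedModType R} (A : set U) (g : U -> V) :
  {within A, continuous g} <-> econt A g.
Proof.
rewrite subspace_continuousP; split=> [cg x Ax e e0|cg x Ax].
  have /cvgrPdist_lt/(_ _ e0) := cg x Ax.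
  rewrite near_withinE => /nbhs_ballP[d /= d0 xd]; exists d => // y Ay yx.
  by rewrite distrC; apply: xd => //; rewrite -ball_normE/= distrC.
apply/cvgrPdist_lt => e e0; have [d d0 xd] := cg x Ax e e0.
rewrite near_withinE; apply/nbhs_ballP; exists d => //= y.
by rewrite -ball_normE/= distrC => yx Ay; rewrite distrC; exact: xd.
Qed.

Lemma econtS {U V : normedModType R} (A B : set U) (g : U -> V) :
  A `<=` B -> econt B g -> econt A g.
Proof.
move=> AB cg x Ax e e0; have [d d0 h] := cg x (AB _ Ax) e e0.
by exists d => // y Ay; apply: h; exact: AB.
Qed.

Lemma econt_comp {U V W : normedModType R} (A : set U) (B : set V) (f : U -> V)
  (g : V -> W) : (forall x, A x -> B (f x)) -> econt A f -> econt B g -> econt A (g \o f).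
Proof.
move=> AB cf cg x Ax e e0; have [d d0 h] := cg _ (AB _ Ax) e e0.
have [c c0 k] := cf x Ax d d0; exists c => // y Ay yx.
by apply: h; [exact: AB|exact: k].
Qed.

(** Heine-Cantor: half of the local modulus is kept for the position of the first point and half of
    the tolerance for its value; compactness makes the choice uniform. *)
Lemma econt_unif {U V : normedModType R} (A : set U) (g : U -> V) :
  compact A -> econt A g -> forall e, 0 < e -> exists2 d, 0 < d &
    forall x y, A x -> A y -> `|y - x| < d -> `|g y - g x| < e.
Proof.
move=> /compact_near_coveringP cA cg e e0.
have /cA : forall x, A x -> \forall x' \near x & d \near (0:R)^'+,
    A x' -> forall y, A y -> `|y - x'| < d -> `|g y - g x'| < e.
  move=> x Ax; have [d d0 h] := cg x Ax (e / 2) ltac:(lra).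
  exists (ball x (d / 2), [set t | t < d / 2]).
    split => /=; first (apply: nbhsx_ballx; lra).
    apply: nbhs_right_lt; lra.
  move=> [x' t] /= [xx' td] Ax' y Ay yx'.
  rewrite -ball_normE/= distrC in xx'.
  have h1 : `|g x' - g x| < e / 2 by apply: h => //; lra.
  have h2 : `|g y - g x| < e / 2.
    by apply: h => //; have := ler_distD x' y x; lra.
  by have := ler_distD (g x) (g y) (g x'); rewrite (distrC (g x) (g x')); lra.
move=> H.
have [d [dP d0]] := @filter_ex _ _ (at_right_proper_filter 0) _
  (filterI H (nbhs_right_gt (0:R))).
by exists d => // x y Ax Ay; apply: dP.
Qed.

End epsilon_delta.

Section stieltjes.
Context {R : realType}.
Implicit Types (f g h : R -> R) (a b s t : R).
Local Notation mu := (@lebesgue_measure R).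

Definition klip {V : normedModType R} (K : R) (f : R -> V) a b :=
  {in `[a, b] &, forall x y, `|f x - f y| <= K * `|x - y|}.

Lemma lipschitz_klip {V : normedModType R} (f : R -> V) a b :
  lipschitz_on f (globally (`[a, b] `*` `[a, b])) -> exists2 K, 0 < K & klip K f a b.
Proof.
rewrite {1}/lipschitz_on => lf'.
have [K [h1 h2]] := @filter_ex _ _ (proper_pinfty_nbhs) _
  (filterI lf' (nbhs_pinfty_gt (num_real (0:R)))).
exists K => // x y xab yab.
by apply: (h1 (x, y)).
Qed.

Lemma klip_econt {V : normedModType R} (f : R -> V) a b K :
  0 < K -> klip K f a b -> econt `[a, b] f.
Proof.
move=> K0 fK x xab e e0; exists (e / K); first exact: divr_gt0.
move=> y yab yx; apply: le_lt_trans (fK _ _ yab xab) _.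
by rewrite mulrC -ltr_pdivlMr.
Qed.

Lemma klipS {V : normedModType R} (f : R -> V) a b s t K :
  a <= s -> t <= b -> klip K f a b -> klip K f s t.
Proof.
by move=> as_ tb fK x y; rewrite !in_itv/= => /andP[h1 h2] /andP[h3 h4];
  apply: fK; rewrite in_itv/=; apply/andP; split; lra.
Qed.

(** The Stieltjes integral of [g] with respect to [f]; for Lipschitz [f] it is computed with the
    density of [dint_dens]. *)
Definition dint f g s t : R := \int[mu]_(x in `[s, t]) (derive1 f x * g x).

Lemma econt_integrable g a b s t : a <= s -> t <= b -> econt `[a, b] g ->
  mu.-integrable `[s, t] (EFin \o g).
Proof.
move=> as_ tb cg; apply: continuous_compact_integrable; first exact: segment_compact.
apply/econtP; apply: econtS cg => x /=; rewrite !in_itv/= => /andP[h1 h2].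
by apply/andP; split; lra.
Qed.

Lemma klip_density K f a b : a < b -> 0 < K -> klip K f a b ->
  exists g0, [/\ measurable_fun setT g0, forall x, `|g0 x| <= K,
    ae_eq mu `[a, b]%classic (derive1 f) g0 &
    forall x y, a <= x -> x <= y -> y <= b ->
      \int[mu]_(t in `[x, y]) g0 t = f y - f x].
Proof.
move=> ab K0 fK; have [g0 [mg gK aeg gE]] := lipschitz_density ab K0 fK.
exists g0; split => //.
have h1 : \forall x \ae mu, x != a.
  by exists [set a]; split => //=; [exact: lebesgue_measure_set1|move=> x /= /negP/negPn/eqP].
have h2 : \forall x \ae mu, x != b.
  by exists [set b]; split => //=; [exact: lebesgue_measure_set1|move=> x /= /negP/negPn/eqP].
have F := ae_filter_ringOfSetsType mu.
apply: filterS3 aeg h1 h2 => x h xa xb /=; rewrite in_itv/= => /andP[h1 h2].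
by apply: h; rewrite !lt_neqAle eq_sym xa xb h1 h2.
Qed.

Lemma dens_integrable g0 g a b s t K : measurable_fun setT g0 ->
  (forall x, `|g0 x| <= K) -> a <= s -> t <= b -> econt `[a, b] g ->
  mu.-integrable `[s, t] (EFin \o (fun x => g0 x * g x)).
Proof.
move=> mg0 g0K as_ tb cg.
have gi := econt_integrable as_ tb cg.
have K0 : 0 <= K by exact: le_trans (g0K 0).
apply: (@le_integrable _ _ _ mu _ _ _ (EFin \o (fun x => K * g x))) => //.
- apply/measurable_EFinP; apply: measurable_funM; first exact: measurable_funS mg0.
  by apply/measurable_EFinP; exact: measurable_int gi.
- by move=> x _ /=; rewrite lee_fin !normrM (ger0_norm K0) ler_wpM2r.
exact: (integrableZl _ K gi).
Qed.

Lemma econt_scale_add {U : normedModType R} (A : set U) (f g : U -> R) (c : R) :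
  econt A f -> econt A g -> econt A (fun x => c * f x + g x).
Proof.
move=> /econtP cf /econtP cg; apply/econtP => x.
by apply: cvgD; [apply: cvgM; [exact: cvg_cst|exact: cf]|exact: cg].
Qed.

Section dint_theory.
Variables (f : R -> R) (a b K : R).
Hypotheses (ab : a < b) (K0 : 0 < K) (fK : klip K f a b).

Lemma dint_dens : exists g0, [/\ measurable_fun setT g0, forall x, `|g0 x| <= K,
    forall g s t, a <= s -> t <= b ->
      dint f g s t = \int[mu]_(x in `[s, t]) (g0 x * g x),
    forall x y, a <= x -> x <= y -> y <= b ->
      \int[mu]_(t in `[x, y]) g0 t = f y - f x &
    ae_eq mu `[a, b]%classic (derive1 f) g0].
Proof.
have [g0 [mg gK aeg gE]] := klip_density ab K0 fK; exists g0; split => //.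
move=> g s t as_ tb; rewrite /dint /Rintegral; congr fine.
apply: ae_eq_integral_nonmeasurable.
have F := ae_filter_ringOfSetsType mu.
apply: filterS aeg => x h /=; rewrite in_itv/= => /andP[h1 h2].
by rewrite h//= in_itv/=; apply/andP; split; lra.
Qed.

Lemma dintD g s t u : econt `[a, b] g -> a <= s -> s <= t -> t <= u -> u <= b ->
  dint f g s u = dint f g s t + dint f g t u.
Proof.
move=> cg as_ st tu ub; have [g0 [mg gK gE _ _]] := dint_dens.
have su := le_trans st tu; have at_ := le_trans as_ st; have tb := le_trans tu ub.
have I x y : a <= x -> y <= b -> mu.-integrable `[x, y] (EFin \o (fun x => g0 x * g x)).
  by move=> ? ?; apply: (dens_integrable mg gK) cg.
rewrite !gE// -(Rintegral_itv_obnd_cbnd (r := t)); last first.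
  by apply: integrableS (I t u at_ ub) => // x /=; rewrite !in_itv/= => /andP[/ltW-> ->].
rewrite -(@Rintegral_itvB _ (fun x => g0 x * g x) (BLeft s) (BRight u) t) ?I ?bnd_simp//.
by rewrite addrC subrK.
Qed.

Lemma dint_linear g h c s t : econt `[a, b] g -> econt `[a, b] h -> a <= s -> t <= b ->
  dint f (fun x => c * g x + h x) s t = c * dint f g s t + dint f h s t.
Proof.
move=> cg ch as_ tb; have [g0 [mg gK gE _ _]] := dint_dens.
have Ig := dens_integrable mg gK as_ tb cg.
have Ih := dens_integrable mg gK as_ tb ch.
rewrite !gE// -RintegralZl// -RintegralD//.
  by apply: eq_Rintegral => x _; ring.
exact: (integrableZl _ c Ig).
Qed.

Lemma dint_ext g h s t : {in `[s, t], g =1 h} -> dint f g s t = dint f h s t.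
Proof. by move=> gh; apply: eq_Rintegral => x; rewrite inE/= => xst; rewrite gh. Qed.

Lemma dint_cst_le g c eta s t : econt `[a, b] g -> a <= s -> s <= t -> t <= b ->
  (forall x, x \in `[s, t] -> `|g x - c| <= eta) ->
  `|dint f g s t - c * (f t - f s)| <= K * eta * (t - s).
Proof.
move=> cg as_ st tb gc; have [g0 [mg gK gE g0E _]] := dint_dens.
have Ig := dens_integrable mg gK as_ tb cg.
have c1 : econt `[a, b] (fun=> 1 : R) by move=> x _ e e0; exists 1 => // y _ _; rewrite subrr normr0.
have I1 : mu.-integrable `[s, t] (EFin \o g0).
  have := dens_integrable mg gK as_ tb c1.
  by congr (is_true (_.-integrable _ _)); apply/funext => x /=; rewrite mulr1.
have Ic : mu.-integrable `[s, t] (EFin \o (fun x => c * g0 x)).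
  exact: (integrableZl _ c I1).
rewrite gE// -g0E// -RintegralZl// -RintegralB//.
have Id : mu.-integrable `[s, t] (EFin \o (fun x => g0 x * g x - c * g0 x)).
  exact: (integrableB _ Ig Ic).
apply: le_trans (le_normr_Rintegral _ Id) _ => //.
have <- : \int[mu]_(x in `[s, t]) (K * eta) = K * eta * (t - s).
  by rewrite Rintegral_cst//; have -> := fine_itv_measure true false st.
apply: le_Rintegral => //.
- by apply: integrable_norm.
- apply: (@econt_integrable _ a b) => // x _ e e0.
  by exists 1 => // y _ _; rewrite subrr normr0.
move=> x /= xst; rewrite (mulrC c) -mulrBr normrM ler_pM//; exact: gc.
Qed.

(** The estimate keeps the total variation of [f] instead of its Lipschitz constant: this is how the
    lengths of the arcs enter the final bound. *)
Lemma dint_le_l1 g E s t : econt `[a, b] g -> a <= s -> t <= b ->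
  (forall x, x \in `[s, t] -> `|g x| <= E) ->
  `|dint f g s t| <= E * \int[mu]_(x in `[s, t]) `|derive1 f x|.
Proof.
move=> cg as_ tb gle; have [g0 [mg gK gE g0E aeg]] := dint_dens.
have Ig := dens_integrable mg gK as_ tb cg.
have c1 : econt `[a, b] (fun=> 1 : R) by move=> x _ e e0; exists 1 => // y _ _; rewrite subrr normr0.
have I1 : mu.-integrable `[s, t] (EFin \o (fun x => `|g0 x|)).
  have := integrable_norm (dens_integrable mg gK as_ tb c1).
  by congr (is_true (_.-integrable _ _)); apply/funext => x /=; rewrite mulr1.
have -> : \int[mu]_(x in `[s, t]) `|derive1 f x| = \int[mu]_(x in `[s, t]) `|g0 x|.
  congr fine; apply: ae_eq_integral_nonmeasurable.
  have F := ae_filter_ringOfSetsType mu.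
  apply: filterS aeg => x h /=; rewrite in_itv/= => /andP[h1 h2].
  by rewrite h//= in_itv/=; apply/andP; split; lra.
rewrite gE// -RintegralZl//.
apply: le_trans (le_normr_Rintegral _ Ig) _ => //.
apply: le_Rintegral => //.
- exact: (integrable_norm Ig).
- exact: (integrableZl _ E I1).
by move=> x /= xst; rewrite normrM mulrC ler_wpM2r// gle.
Qed.

End dint_theory.

(** The derivatives are first replaced by their densities, since additivity of the integral asks for
    integrable terms. *)
Lemma Rintegral_sum_abs_derive1 n (h : 'I_n -> R -> R) a b (K : 'I_n -> R) : a < b ->
  (forall j, 0 < K j) -> (forall j, klip (K j) (h j) a b) ->
  \int[mu]_(t in `[a, b]) (\sum_j `|derive1 (h j) t|)
    = \sum_j \int[mu]_(t in `[a, b]) `|derive1 (h j) t|.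
Proof.
move=> ab K0 hK.
have [g gP] := choice (fun j => klip_density ab (K0 j) (hK j)).
have F := ae_filter_ringOfSetsType mu.
have I j : mu.-integrable `[a, b] (EFin \o (fun x => `|g j x|)).
  have [mg gK _ _] := gP j.
  have c1 : econt `[a, b] (fun=> 1 : R) by move=> x _ e e0; exists 1 => // y _ _; rewrite subrr normr0.
  have := integrable_norm (dens_integrable mg gK (lexx a) (lexx b) c1).
  by congr (is_true (_.-integrable _ _)); apply/funext => x /=; rewrite mulr1.
have -> : \sum_j \int[mu]_(t in `[a, b]) `|derive1 (h j) t| =
    \sum_j \int[mu]_(t in `[a, b]) `|g j t|.
  apply: eq_bigr => j _; congr fine; apply: ae_eq_integral_nonmeasurable.
  by have [_ _ aeg _] := gP j; apply: filterS aeg => x + xab => ->.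
have -> : \int[mu]_(t in `[a, b]) (\sum_j `|derive1 (h j) t|) =
    \int[mu]_(t in `[a, b]) (\sum_j `|g j t|).
  congr fine; apply: ae_eq_integral_nonmeasurable.
  have : \forall x \ae mu, forall j, `[a, b]%classic x -> derive1 (h j) x = g j x.
    by apply: filter_forall => j; have [_ _ aeg _] := gP j.
  by apply: filterS => x hx xab /=; congr (_%:E); apply: eq_bigr => j _; rewrite hx.
rewrite /Rintegral.
have -> : (\int[mu]_(t in `[a, b]) (\sum_j `|g j t|)%:E =
    \int[mu]_(t in `[a, b]) (\sum_j (EFin \o (fun x => `|g j x|)%R) t))%E.
  by apply: eq_integral => x _; rewrite /= sumEFin.
rewrite integral_sum// -sum_fine// => j _.
exact: integrable_fin_num (I j).
Qed.

End stieltjes.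

(** * From local estimates to global increments *)

Section local_to_global.
Context {R : realType}.
Implicit Types (f g A B : R -> R) (a b s t : R).

(** The set of points where the bound from [a] holds contains its supremum, and the local estimate
    there would carry the bound further unless the supremum is [b]. The radius [d] may vary with
    [t]. *)
Lemma local_lipschitz_increment (D : R -> R) a b kap : a <= b ->
  (forall t, t \in `[a, b] -> exists2 d, 0 < d & forall t', t' \in `[a, b] ->
    `|t' - t| < d -> `|D t' - D t| <= kap * `|t' - t|) ->
  `|D b - D a| <= kap * (b - a).
Proof.
move=> ab Dloc.
pose S := [set t | a <= t <= b /\ `|D t - D a| <= kap * (t - a)].
have Sa : S a by rewrite /S/= lexx ab !subrr normr0 mulr0.
have Sub : has_ubound S by exists b => t [/andP[]].
pose c := sup S.
have ac : a <= c by exact: ub_le_sup.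
have cb : c <= b by apply: ge_sup; [exists a|move=> t [/andP[]]].
have cab : c \in `[a, b] by rewrite in_itv/= ac cb.
have [d d0 Dc] := Dloc c cab.
have Sc : S c.
  have [s [sab Ds] cs] : exists2 s, S s & c - d < s.
    by apply: sup_adherent => //; split => //; exists a.
  have sc : s <= c by apply: ub_le_sup.
  split; first by rewrite ac cb.
  have := Dc s _ _; rewrite in_itv/= sab ler0_norm ?subr_le0//.
  have dd : - (s - c) < d by lra.
  move=> /(_ isT dd) h; have := ler_distD (D s) (D c) (D a).
  by rewrite (distrC (D c) (D s)); lra.
have [<-//|cltb] := eqVneq c b; first by case: Sc.
have {}cltb : c < b by rewrite lt_neqAle cltb cb.
pose t := Num.min b (c + d / 2).
have ct : c < t by rewrite lt_min cltb ltrDl divr_gt0.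
have td : t <= c + d / 2 by rewrite ge_min lexx orbT.
have tb : t <= b by rewrite ge_min lexx.
have /(ub_le_sup Sub) : S t; last by rewrite leNgt ct.
split; first by rewrite tb andbT; lra.
have := Dc t _ _; rewrite in_itv/= tb andbT gtr0_norm ?subr_gt0//.
have at_ : a <= t by lra. have dd : t - c < d by lra.
move=> /(_ at_ dd) h; have [_ h2] := Sc; have := ler_distD (D c) (D t) (D a).
lra.
Qed.

Lemma local_increment A B a b kap : a <= b ->
  (forall t, t \in `[a, b] -> exists2 d, 0 < d & forall t', t' \in `[a, b] ->
    `|t' - t| < d -> `|A t' - A t - (B t' - B t)| <= kap * `|t' - t|) ->
  `|A b - A a - (B b - B a)| <= kap * (b - a).
Proof.
move=> ab h.
have := @local_lipschitz_increment (fun t => A t - B t) _ _ kap ab.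
rewrite (_ : A b - B b - (A a - B a) = A b - A a - (B b - B a)); last by ring.
apply=> t /h[d d0 k]; exists d => // t' t'ab t'd.
by rewrite (_ : A t' - B t' - (A t - B t) = A t' - A t - (B t' - B t)); [exact: k|ring].
Qed.

Lemma itvP1 a b (x : R) : (x \in `[a, b]) = (a <= x <= b). Proof. by rewrite in_itv. Qed.

Section dint_local.
Variables (f : R -> R) (a b K : R).
Hypotheses (ab : a < b) (K0 : 0 < K) (fK : klip K f a b).

(** Fundamental theorem in Stieltjes form: near [t] the integrand is within e / K of [g t], and the
    density of [f] is bounded by [K]. *)
Lemma dint_local g : econt `[a, b] g -> forall t, t \in `[a, b] ->
  forall e, 0 < e -> exists2 d, 0 < d & forall t', t' \in `[a, b] -> `|t' - t| < d ->
   `|dint f g a t' - dint f g a t - g t * (f t' - f t)| <= e * `|t' - t|.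
Proof.
move=> cg t tab e e0; have [d d0 gd] := cg t tab (e / K) (divr_gt0 e0 K0).
exists d => // t' t'ab t'd; move: (tab) (t'ab); rewrite !itvP1 => /andP[h1 h2] /andP[h3 h4].
have key : forall x, `|x - t| <= `|t' - t| -> x \in `[a, b] -> `|g x - g t| <= e / K.
  by move=> x xt xab; apply/ltW/gd => //; exact: le_lt_trans t'd.
have Kn0 : K != 0 by exact: lt0r_neq0.
have [tt'|t't] := leP t t'.
  have -> : dint f g a t' - dint f g a t - g t * (f t' - f t) =
      dint f g t t' - g t * (f t' - f t).
    by rewrite (dintD ab K0 fK cg (lexx a) h1 tt' h4); ring.
  have -> : e * `|t' - t| = K * (e / K) * (t' - t).
    by rewrite ger0_norm ?subr_ge0//; field.
  apply: (dint_cst_le ab K0 fK) => // x.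
  rewrite itvP1 => /andP[tx xt']; apply: key; last by rewrite itvP1; apply/andP; split; lra.
  by rewrite !ger0_norm ?subr_ge0// lerB.
rewrite -normrN.
have -> : - (dint f g a t' - dint f g a t - g t * (f t' - f t)) =
    dint f g t' t - g t * (f t - f t').
  by rewrite (dintD ab K0 fK cg (lexx a) h3 (ltW t't) h2); ring.
have -> : e * `|t' - t| = K * (e / K) * (t - t').
  by rewrite ltr0_norm ?subr_lt0//; field.
apply: (dint_cst_le ab K0 fK) => //; first exact: ltW.
move=> x; rewrite itvP1 => /andP[tx xt']; apply: key; last by rewrite itvP1; apply/andP; split; lra.
by rewrite !ler0_norm ?subr_le0 ?opprB ?lerB// ltW.
Qed.

End dint_local.

(** [P] is a primitive of g dx up to an error measured by the increments of [x], not of the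
    parameter. Such an estimate survives composition with a continuous map, and it asks for no
    regularity of [x]. *)
Definition step_primitive (P x g : R -> R) eta a b :=
  forall y, y \in `[a, b] -> exists2 d, 0 < d & forall y', y' \in `[a, b] ->
    `|y' - y| < d -> `|P y' - P y - g y * (x y' - x y)| <= eta * `|x y' - x y|.

(** On a grid whose cells see [g] vary by less than [eta], [g] is replaced by its value at the left
    end of the cell; the resulting step function is integrated exactly against dx, cell by cell. *)
Lemma step_primitive_ex (x : R -> R) g eta a b : a <= b -> 0 < eta -> econt `[a, b] g ->
  exists P, step_primitive P x g eta a b.
Proof.
move=> ab eta0 cg.
have [d d0 gd] := econt_unif (@segment_compact _ a b) cg eta0.
(* The mesh d / 2 is strictly below the modulus [d], and the minimum makes the grid stop at [b]. *)
pose z k : R := Num.min b (a + k%:R * (d / 2)).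
have az k : a <= z k.
  by rewrite le_min ab lerDl mulr_ge0// divr_ge0// ltW.
have zb k : z k <= b by rewrite ge_min lexx.
suff [k zk] : exists k, z k = b.
  rewrite -zk; elim: k {zk} => [|k [P hP]].
    exists (fun=> 0) => y; rewrite itvP1 => /andP[h1 h2].
    have z0 : z 0%N = a by apply/eqP; rewrite eq_le az andbT ge_min mul0r addr0 lexx orbT.
    exists 1 => // y'; rewrite itvP1 z0 in h2 * => /andP[h3 h4] _.
    have -> : y' = y by apply/eqP; rewrite eq_le; apply/andP; split; lra.
    by rewrite !subrr mulr0 subrr normr0 mulr0.
  have zS : z k <= z k.+1.
    rewrite /z le_min ge_min lexx/= ge_min; apply/orP; right.
    rewrite lerD2l; apply: ler_wpM2r; first by lra.
    by rewrite ler_nat.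
  have zSd : z k.+1 < z k + d.
    rewrite {2}/z; have : z k.+1 <= a + k.+1%:R * (d / 2) by rewrite ge_min lexx orbT.
    have := zb k.+1; rewrite -natr1 /Num.min; case: ifP => _; lra.
  exists (fun y => if y <= z k then P y else P (z k) + g (z k) * (x y - x (z k))).
  move=> y; rewrite itvP1 => /andP[ay yz].
  have gz y' : z k <= y' -> y' <= z k.+1 -> `|g (z k) - g y'| <= eta.
    move=> h1 h2; apply/ltW/gd => /=; rewrite ?itvP1.
    - by rewrite (le_trans (az k) h1) (le_trans h2).
    - by rewrite az zb.
    - by rewrite ler0_norm ?subr_le0//; lra.
  case: (ltgtP y (z k)) => yzk.
  - have yin : y \in `[a, z k] by rewrite itvP1 ay ltW.
    have [c c0 Pc] := hP y yin.
    exists (Num.min c (z k - y)); first by rewrite lt_min c0 subr_gt0.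
    move=> y'; rewrite itvP1 => /andP[ay' y'z]; rewrite lt_min => /andP[h1 h2].
    have y'zk : y' <= z k by have := ler_norm (y' - y); lra.
    by rewrite y'zk; apply: Pc => //; rewrite itvP1 ay'.
  - exists (y - z k); first by rewrite subr_gt0.
    move=> y'; rewrite itvP1 => /andP[ay' y'z] yy'.
    have : z k < y' by have := ler_norm (y - y'); rewrite distrC; lra.
    move=> zy'; rewrite (leNgt y') zy'/=.
    rewrite (_ : _ - _ - _ = (g (z k) - g y) * (x y' - x y)); last by ring.
    by rewrite normrM ler_wpM2r// gz// ltW.
  have yin : y \in `[a, z k] by rewrite itvP1 ay yzk lexx.
  have [c c0 Pc] := hP y yin.
  exists c => // y'; rewrite itvP1 => /andP[ay' y'z] yy'.
  rewrite yzk; case: ifPn => [y'zk|_].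
    by rewrite -yzk; apply: Pc => //; rewrite itvP1 ay' y'zk.
  by rewrite [_ + _ - P (z k)]addrC addKr subrr normr0 mulr_ge0// ltW.
have h0 : 0 <= (b - a) / (d / 2) by apply: divr_ge0; lra.
exists (Num.bound ((b - a) / (d / 2))); apply/eqP; rewrite eq_le zb/= le_min lexx/=.
rewrite -lerBlDl -ler_pdivrMr ?divr_gt0//; apply/ltW.
by have := archi_boundP h0.
Qed.

End local_to_global.

(** * Tree-like paths *)

Section quotient.
Context {R : realType}.

(** At the points of [A] over [y], continuity of [f] controls [phi]; every other point of [A] has a
    neighbourhood whose image under [th] stays away from [y]. Compactness of [A] gives one radius
    for all of them. *)
Lemma econt_quotient {U V W : normedModType R} (A : set U) (th : U -> V) (f : U -> W)
    (phi : V -> W) : compact A -> econt A th -> econt A f ->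
  (forall t, A t -> f t = phi (th t)) -> econt (th @` A) phi.
Proof.
move=> /compact_near_coveringP cA cth cf fE _ [t0 At0 <-] e e0.
set y := th t0.
have /cA : forall t, A t -> \forall t' \near t & d \near (0:R)^'+,
    A t' -> `|th t' - y| < d -> `|phi (th t') - phi y| < e.
  move=> t At; have [ty|tny] := eqVneq (th t) y.
    have [d d0 h] := cf t At e e0.
    exists (ball t d, setT); first by split; [exact: nbhsx_ballx|exact: filterT].
    move=> [t' s] /= [tt' _] At' _; rewrite -ball_normE/= distrC in tt'.
    by rewrite -ty -!fE//; exact: h.
  have n0 : 0 < `|th t - y| / 2 by rewrite divr_gt0 ?normr_gt0 ?subr_eq0.
  have [d d0 h] := cth t At _ n0.
  exists (ball t d, [set s | s < `|th t - y| / 2]).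
    by split => /=; [exact: nbhsx_ballx|exact: nbhs_right_lt].
  move=> [t' s] /= [tt' sd] At' ts; rewrite -ball_normE/= distrC in tt'.
  have := h _ At' tt'; have := ler_distD (th t') (th t) y.
  by rewrite (distrC (th t) (th t')) => h1 h2; exfalso; move: h1 h2 sd ts; lra.
move=> H.
have [d [dP d0]] := @filter_ex _ _ (at_right_proper_filter 0) _
  (filterI H (nbhs_right_gt (0:R))).
by exists d => // _ [t' At' <-] h; apply: dP h.
Qed.

End quotient.

Section tree_like.
Context {R : realType}.
Implicit Types (f g A B : R -> R) (a b s t : R).

Lemma econt_cst {U : normedModType R} (A : set U) (c : R) : econt A (fun=> c).
Proof. by move=> x _ e e0; exists 1 => // y _ _; rewrite subrr normr0. Qed.

Lemma le_eps_mul (x c : R) : (forall e, 0 < e -> x <= e * c) -> x <= 0.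
Proof.
move=> h; have [c0|c0] := leP c 0.
  by apply: le_trans (h 1 ltr01) _; rewrite mul1r.
apply/ler_addgt0Pr => e e0; rewrite add0r.
by have := h (e / c) (divr_gt0 e0 c0); rewrite divfK ?gt_eqF.
Qed.

Lemma eq0_le_eps_mul (x c : R) : (forall e, 0 < e -> `|x| <= e * c) -> x = 0.
Proof. by move=> /le_eps_mul; rewrite normr_le0 => /eqP. Qed.

Lemma ivt_between (th : R -> R) a b s t y : econt `[a, b] th -> s \in `[a, b] -> t \in `[a, b] ->
  th s <= y <= th t ->
  exists c, [/\ c \in `[a, b], th c = y & Num.min s t <= c <= Num.max s t].
Proof.
rewrite !itvP1 => cth /andP[s1 s2] /andP[t1 t2] /andP[sy yt].
have sub u v : a <= u -> v <= b -> {within `[u, v], continuous th}.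
  move=> au vb; apply/econtP; apply: econtS cth => x /=; rewrite !in_itv/= => /andP[h1 h2].
  by apply/andP; split; lra.
have [st|ts] := leP s t.
  have [|c] := @IVT _ th s t y st (sub _ _ s1 t2).
    by rewrite ge_min sy le_max yt orbT.
  rewrite itvP1 => /andP[h1 h2] <-; exists c; rewrite itvP1; split => //.
    by apply/andP; split; lra.
  by rewrite h1 h2.
have [|c] := @IVT _ th t s y (ltW ts) (sub _ _ t1 s2).
  by rewrite ge_min sy orbT le_max yt.
rewrite itvP1 => /andP[h1 h2] <-; exists c; rewrite itvP1; split => //.
  by apply/andP; split; lra.
by rewrite h1 h2.
Qed.

Section dint_approx.
Variables (f : R -> R) (a b K : R).
Hypotheses (ab : a < b) (K0 : 0 < K) (fK : klip K f a b).

Lemma dint_id g s : econt `[a, b] g -> a <= s -> s <= b -> dint f g s s = 0.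
Proof. by rewrite /dint set_itv1 Rintegral_set1. Qed.

(** The integral up to [t] has differential g df, and so does [B] up to [kap]; [local_increment]
    compares the two. *)
Lemma dint_approx g B kap : econt `[a, b] g ->
  (forall t, t \in `[a, b] -> exists2 d, 0 < d & forall t', t' \in `[a, b] -> `|t' - t| < d ->
    `|B t' - B t - g t * (f t' - f t)| <= kap * `|t' - t|) ->
  `|dint f g a b - (B b - B a)| <= kap * (b - a).
Proof.
move=> cg Bloc; apply/ler_addgt0Pr => e e0.
have e1 : 0 < e / (b - a) by rewrite divr_gt0// subr_gt0.
have := @local_increment _ (fun t => dint f g a t) B a b (kap + e / (b - a)) (ltW ab).
rewrite dint_id ?(ltW ab)// subr0 mulrDl divfK ?subr_eq0 ?gt_eqF//; apply => t tab.
have [d1 d10 h1] := dint_local ab K0 fK cg tab e1.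
have [d2 d20 h2] := Bloc t tab.
exists (Num.min d1 d2); first by rewrite lt_min d10.
move=> t' t'ab; rewrite lt_min => /andP[/(h1 _ t'ab) k1 /(h2 _ t'ab) k2].
rewrite mulrDl [X in _ <= X]addrC; apply: le_trans (ler_distD (g t * (f t' - f t)) _ _) _.
by apply: lerD => //; rewrite distrC.
Qed.

End dint_approx.

Section tree_like_dint.
Variables (f : R -> R) (a b K : R).
Hypotheses (ab : a < b) (K0 : 0 < K) (fK : klip K f a b).

Lemma dint_econt g : econt `[a, b] g -> econt `[a, b] (fun t => dint f g a t).
Proof.
move=> cg t tab e e0; have [d d0 h] := dint_local ab K0 fK cg tab ltr01.
have c0 : 0 < 1 + `|g t| * K by rewrite ltr_pwDl// mulr_ge0// ltW.
exists (Num.min d (e / (1 + `|g t| * K))); first by rewrite lt_min d0 divr_gt0.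
move=> t' t'ab; rewrite lt_min ltr_pdivlMr// => /andP[/(h _ t'ab) k1 k2].
apply: le_lt_trans k2; rewrite mulrDr mulr1.
rewrite -[dint f g a t' - _](subrK (g t * (f t' - f t))).
apply: le_trans (ler_normD _ _) _; apply: lerD; first by rewrite mul1r in k1.
by rewrite normrM mulrCA ler_wpM2l// mulrC fK.
Qed.

Lemma dint_suffixE g t : econt `[a, b] g -> t \in `[a, b] ->
  dint f g t b = dint f g a b - dint f g a t.
Proof.
by move=> cg; rewrite itvP1 => /andP[h1 h2];
  rewrite (dintD ab K0 fK cg (lexx a) h1 h2 (lexx b)) addrAC subrr add0r.
Qed.

(** Here [f] and [g] factor through [th] as phi o th and G o th, with [G] continuous on the range of
    [th]. If [P] is an approximate primitive of G dphi, then P o th is one of g df and has equal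
    values at [s] and [t], so the integral between them vanishes. No regularity of phi enters. *)
Lemma tree_like_dint g (th : R -> R) : econt `[a, b] g -> econt `[a, b] th ->
  {in `[a, b] &, forall s t, th s = th t -> f s = f t} ->
  {in `[a, b] &, forall s t, th s = th t -> g s = g t} ->
  {in `[a, b] &, forall s t, th s = th t -> dint f g a s = dint f g a t}.
Proof.
move=> cg cth hf hg.
have abW := ltW ab.
have cthc : {within `[a, b], continuous th} by exact/econtP.
have [lo loab hlo] := EVT_min abW cthc.
have [hi hiab hhi] := EVT_max abW cthc.
(* A section of [th]; the default [a] is taken only outside the range of [th]. *)
pose sec y := xget a [set t | t \in `[a, b] /\ th t = y].
have secP t : t \in `[a, b] -> sec (th t) \in `[a, b] /\ th (sec (th t)) = th t.
  by move=> tab; rewrite /sec; case: xgetP => // /(_ t); case.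
pose phi y := f (sec y). pose G y := g (sec y).
have fE t : t \in `[a, b] -> phi (th t) = f t.
  by move=> tab; have [h1 h2] := secP t tab; apply: hf.
have gE t : t \in `[a, b] -> G (th t) = g t.
  by move=> tab; have [h1 h2] := secP t tab; apply: hg.
have lohi : th lo <= th hi by apply: hhi.
have cG : econt `[th lo, th hi] G.
  have c1 : econt (th @` `[a, b]) G.
    apply: econt_quotient (@segment_compact _ _ _) cth cg _ => t tab.
    by rewrite gE.
  apply: econtS c1 => y /= yin.
  have [c [cab <- _]] := ivt_between cth loab hiab yin.
  by exists c.
move=> s t sab tab; wlog st : s t sab tab / s <= t => [hw|].
  by have [/hw|/ltW/hw] := leP s t => + e => ->.
move=> est; apply/eqP; rewrite eq_sym -subr_eq0; apply/eqP.
move: (sab) (tab); rewrite !itvP1 => /andP[as_ _] /andP[_ tb].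
have [->|] := eqVneq s t; first by rewrite subrr.
move=> snt; have {st}lst : s < t by rewrite lt_neqAle snt st.
have -> : dint f g a t - dint f g a s = dint f g s t.
  by rewrite (dintD ab K0 fK cg (lexx a) as_ (ltW lst) tb) addrAC subrr add0r.
apply: (@eq0_le_eps_mul _ (K * (t - s))) => e e0.
have [P hP] := step_primitive_ex phi lohi e0 cG.
have sub x : x \in `[s, t] -> x \in `[a, b].
  by rewrite !itvP1 => /andP[h1 h2]; apply/andP; split; lra.
have := @dint_approx f s t K lst K0 (klipS as_ tb fK) g (P \o th) (e * K) (econtS sub cg).
rewrite /= est subrr subr0 -mulrA; apply => x /sub xab.
have thx y : y \in `[a, b] -> th y \in `[th lo, th hi].
  by move=> yab; rewrite itvP1 hlo// hhi.
have [d d0 hd] := hP _ (thx x xab).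
have [c c0 hc] := cth x xab d d0.
exists c => // x' /sub x'ab xx'.
rewrite -!fE// -gE// -mulrA; apply: le_trans (hd _ (thx _ x'ab) (hc _ x'ab xx')) _.
by rewrite ler_wpM2l ?(ltW e0)// !fE// fK.
Qed.

End tree_like_dint.

End tree_like.

(** * Iterated integrals, tree-like paths and moments *)

Section centers.
Context {R : realType} {n : nat}.
Variables (a b : R) (f : 'I_n -> R -> R) (K : R).
Hypotheses (ab : a < b) (K0 : 0 < K) (fK : forall j, klip K (f j) a b).
Local Notation I w t := (iterated_integral b f t w).

Lemma iterated_integral_cons i w t : I (i :: w) t = dint (f i) (fun u => I w u) t b.
Proof. by []. Qed.

Lemma iterated_econt w : econt `[a, b] (fun t => I w t).
Proof.
elim: w => [|i w cw] /=; first exact: econt_cst.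
move=> t tab e e0; have [d d0 h] := dint_econt ab K0 (fK i) cw tab e0.
exists d => // t' t'ab tt'; rewrite -!/(dint (f i) _ _ _).
rewrite (dint_suffixE ab K0 (fK i) cw t'ab) (dint_suffixE ab K0 (fK i) cw tab).
by rewrite opprB addrC addrA subrK distrC; exact: h.
Qed.

(** By induction on the word, each iterated integral also factors through [th] as a function of its
    lower limit. Its value at [a] is thus its value at [b], an integral over a point. *)
Lemma tree_like_center (th : R -> R) : econt `[a, b] th -> th a = th b ->
  (forall j, {in `[a, b] &, forall s t, th s = th t -> f j s = f j t}) ->
  universal_center a b f.
Proof.
move=> cth thab hf.
have aab : a \in `[a, b] by rewrite itvP1 lexx ltW.
have bab : b \in `[a, b] by rewrite itvP1 lexx ltW.
have fac w : {in `[a, b] &, forall s t, th s = th t -> I w s = I w t}.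
  elim: w => [//|i w IH] s t sab tab st.
  have cw := @iterated_econt w.
  rewrite !iterated_integral_cons (dint_suffixE ab K0 (fK i) cw sab).
  rewrite (dint_suffixE ab K0 (fK i) cw tab).
  by rewrite (tree_like_dint ab K0 (fK i) cw cth (hf i) IH sab tab st).
case=> // i w _; rewrite (fac (i :: w) a b aab bab thab) iterated_integral_cons.
by rewrite (dint_id (f i) (@iterated_econt w))// ltW.
Qed.

Lemma dint_sum i (T : Type) (s : seq T) (c : T -> R) (G : T -> R -> R) u v :
  a <= u -> v <= b -> (forall p, econt `[a, b] (G p)) ->
  econt `[a, b] (fun t => \sum_(p <- s) c p * G p t) /\
  dint (f i) (fun t => \sum_(p <- s) c p * G p t) u v = \sum_(p <- s) c p * dint (f i) (G p) u v.
Proof.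
move=> au vb cG; elim: s => [|p s [cs IH]].
  have z : (fun t : R => \sum_(p <- [::]) c p * G p t) = fun=> 0 by apply/funext => t; rewrite big_nil.
  rewrite z big_nil; split; first exact: econt_cst.
  rewrite /dint; under eq_Rintegral do rewrite mulr0.
  by rewrite Rintegral_cst ?mul0r.
have E : (fun t : R => \sum_(q <- p :: s) c q * G q t) =
    fun t => c p * G p t + \sum_(q <- s) c q * G q t.
  by apply/funext => t; rewrite big_cons.
rewrite E big_cons; split; first exact: econt_scale_add.
by rewrite (dint_linear ab K0 (fK i))// IH.
Qed.

Hypothesis fb : forall j, f j b = 0.

Lemma econtM {U : normedModType R} (A : set U) (g h : U -> R) :
  econt A g -> econt A h -> econt A (fun x => g x * h x).
Proof. by move=> /econtP cg /econtP ch; apply/econtP => x; apply: cvgM; [exact: cg|exact: ch]. Qed.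

Lemma iterated_at_b i w : I (i :: w) b = 0.
Proof. by rewrite iterated_integral_cons (dint_id (f i) (@iterated_econt w))// ltW. Qed.

Lemma const_of_local (A : R -> R) t : t \in `[a, b] ->
  (forall t, t \in `[a, b] -> forall e, 0 < e -> exists2 d, 0 < d & forall t', t' \in `[a, b] ->
    `|t' - t| < d -> `|A t' - A t| <= e * `|t' - t|) -> A t = A b.
Proof.
rewrite itvP1 => /andP[at_ tb] h; apply/esym/eqP; rewrite -subr_eq0; apply/eqP.
apply: (@eq0_le_eps_mul _ _ (b - t)) => e e0; apply: local_lipschitz_increment => // u.
rewrite itvP1 => /andP[tu ub]; have uab : u \in `[a, b] by rewrite itvP1 ub (le_trans at_).
have [d d0 hd] := h u uab e e0; exists d => // u'; rewrite itvP1 => /andP[tu' u'b].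
by apply: hd; rewrite itvP1 u'b (le_trans at_).
Qed.

Lemma dint_suffix_local i g t : econt `[a, b] g -> t \in `[a, b] ->
  forall e, 0 < e -> exists2 d, 0 < d & forall t', t' \in `[a, b] -> `|t' - t| < d ->
   `|dint (f i) g t' b - dint (f i) g t b + g t * (f i t' - f i t)| <= e * `|t' - t|.
Proof.
move=> cg tab e e0; have [d d0 h] := dint_local ab K0 (fK i) cg tab e0.
exists d => // t' t'ab tt'; rewrite -normrN.
rewrite (dint_suffixE ab K0 (fK i) cg t'ab) (dint_suffixE ab K0 (fK i) cg tab).
by apply: le_trans (h _ t'ab tt'); rewrite le_eqVlt; apply/orP; left; apply/eqP; congr (`|_|); ring.
Qed.

(* Shuffling the letter j into w: both sides vanish at b and have equal differentials. *)
Lemma mul_iterated j w : exists s : seq (seq 'I_n), {in `[a, b], forall t,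
  f j t * I w t = \sum_(u <- s) (-1) * I u t}.
Proof.
elim: w => [|i w [s IH]].
  (* As [f j b = 0], the value [f j t] is minus the integral of df_j from [t] to [b]. *)
  exists [:: [:: j]] => t; rewrite itvP1 => /andP[at_ tb]; rewrite big_seq1 mulr1 mulN1r.
  have := @dint_cst_le _ (f j) a b K ab K0 (fK j) (fun=> 1) 1 0 t b (@econt_cst _ _ _ _) at_ tb (lexx b).
  rewrite mulr0 mul0r !normr_le0 fb sub0r mul1r opprK => H.
  by apply/eqP; rewrite -addr_eq0 addrC H// => x _; rewrite subrr.
(* The product rule splits the differential of f_j I_(iw) into I_(iw) df_j, whose primitive is minus
   the integral of the word [j :: i :: w], and f_j dI_(iw) = - f_j I_w df_i, to which the induction
   hypothesis applies under the outer letter [i]. *)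
exists ((j :: i :: w) :: [seq i :: u | u <- s]) => t tab.
rewrite big_cons big_map.
have cw := @iterated_econt w; have ciw := @iterated_econt (i :: w).
have cf j' : econt `[a, b] (f j') := klip_econt K0 (fK j').
have cfw : econt `[a, b] (fun t => f j t * I w t) by exact: econtM.
have SE u : u \in `[a, b] -> \sum_(v <- s) -1 * I (i :: v) u = dint (f i) (fun t => f j t * I w t) u b.
  move=> uab; move: (uab); rewrite itvP1 => /andP[au ub].
  have [_ <-] := @dint_sum i _ s (fun=> -1) (fun v t => I v t) u b au (lexx b) (fun v => @iterated_econt v).
  apply: dint_ext => x; rewrite itvP1 => /andP[ux xb]; rewrite IH// itvP1 xb; lra.
rewrite SE//.
set L := fun t => I (i :: w) t; set J := fun t => I (j :: i :: w) t.
set S := fun t => dint (f i) (fun t => f j t * I w t) t b.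
suff E : f j t * L t + J t - S t = 0.
  by apply/eqP; rewrite -subr_eq0 -[X in _ == X]E /L /J /S; apply/eqP; ring.
have -> : 0 = f j b * L b + J b - S b.
  rewrite /L /J /S !iterated_at_b fb (dint_id (f i) cfw) ?(ltW ab)//; ring.
apply: (@const_of_local (fun t => f j t * L t + J t - S t)) => // {tab}t tab e e0.
have c0 : 0 < `|f j t| + K + 2 by rewrite addr_gt0// ltr_wpDl.
(* The sum of the coefficients |f j t|, 1, 1 and K with which the four errors of relative size e / c
   are added. *)
pose c := `|f j t| + K + 2.
have e1 : 0 < e / c by rewrite divr_gt0.
have [d1 d10 h1] := dint_suffix_local i cw tab e1.
have [d2 d20 h2] := dint_suffix_local j ciw tab e1.
have [d3 d30 h3] := dint_suffix_local i cfw tab e1.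
have [d4 d40 h4] := ciw t tab _ e1.
exists (Num.min (Num.min d1 d2) (Num.min d3 d4)); first by rewrite !lt_min d10 d20 d30 d40.
move=> t' t'ab; rewrite !lt_min => /andP[/andP[/(h1 _ t'ab) {}h1 /(h2 _ t'ab) {}h2]].
move=> /andP[/(h3 _ t'ab) {}h3 /(h4 _ t'ab) {}h4].
set q := `|t' - t| in h1 h2 h3 *.
have q0 : 0 <= q by exact: normr_ge0.
have h5 : `|(f j t' - f j t) * (L t' - L t)| <= e / c * K * q.
  by rewrite normrM mulrC -mulrA; apply: ler_pM => //; [exact: ltW|exact: fK].
have h6 : `|f j t * (L t' - L t + I w t * (f i t' - f i t))| <= `|f j t| * (e / c * q).
  by rewrite normrM ler_wpM2l.
have -> : e * q = `|f j t| * (e / c * q) + e / c * q + e / c * q + e / c * K * q.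
  by rewrite /c; field; exact: lt0r_neq0.
have -> : f j t' * L t' + J t' - S t' - (f j t * L t + J t - S t) =
  f j t * (L t' - L t + I w t * (f i t' - f i t)) + (J t' - J t + L t * (f j t' - f j t))
  - (S t' - S t + f j t * I w t * (f i t' - f i t)) + (f j t' - f j t) * (L t' - L t).
  by ring.
apply: le_trans (ler_normD _ _) _; apply: lerD => //.
apply: le_trans (ler_normB _ _) _; apply: lerD => //.
by apply: le_trans (ler_normD _ _) _; apply: lerD.
Qed.

(** The empty word is allowed and supplies the constants. *)
Definition in_span (g : R -> R) := exists s : seq (R * seq 'I_n),
  {in `[a, b], forall t, g t = \sum_(p <- s) p.1 * I p.2 t}.

Lemma in_spanM j g : in_span g -> in_span (fun t => f j t * g t).
Proof.
have [S SP] := choice (mul_iterated j).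
move=> [s gE]; exists (flatten [seq [seq (- p.1, u) | u <- S p.2] | p <- s]) => t tab.
rewrite gE// mulr_sumr big_flatten big_map; apply: eq_bigr => p _.
rewrite mulrCA SP// big_map mulr_sumr; apply: eq_bigr => u _ /=; ring.
Qed.

Lemma in_span_monomial e : in_span (fun t => \prod_j f j t ^+ e j).
Proof.
have pow j k g : in_span g -> in_span (fun t => f j t ^+ k * g t).
  move=> gs; elim: k => [|k IH].
    by have [s hs] := gs; exists s => t tab; rewrite expr0 mul1r hs.
  by have [s hs] := in_spanM j IH; exists s => t tab; rewrite exprS -mulrA hs.
elim: (index_enum 'I_n) => [|j r IH].
  by exists [:: (1, [::])] => t _; rewrite big_nil big_seq1 mulr1.
by have [s hs] := pow j (e j) _ IH; exists s => t tab; rewrite big_cons hs.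
Qed.

(** The monomial is a combination of iterated integrals of variable lower limit; integrating against
    df_i puts [i] in front of every word, so that only nonempty words remain. *)
Lemma universal_center_moment e i : universal_center a b f -> moment a b f e i = 0.
Proof.
move=> uc; have [s hs] := in_span_monomial e.
have -> : moment a b f e i = dint (f i) (fun t => \sum_(p <- s) p.1 * I p.2 t) a b.
  rewrite /moment /dint; apply: eq_Rintegral => x; rewrite inE/= => xab.
  by rewrite mulrC hs.
have [_ ->] := @dint_sum i _ s (fun p => p.1) (fun p t => I p.2 t) a b (lexx a) (lexx b)
  (fun p => @iterated_econt p.2).
by rewrite big1// => p _; rewrite -iterated_integral_cons uc ?mulr0.
Qed.

End centers.

(** * Maps to the circle *)

Section circle.
Context {R : realType}.
Implicit Types (p q : R * R).

Definition ei (x : R) : R * R := (cos x, sin x).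

Lemma norm_pair p : `|p| = Num.max `|p.1| `|p.2|. Proof. by []. Qed.

Lemma fst_econt {U : normedModType R} (A : set U) (z : U -> R * R) :
  econt A z -> econt A (fun x => (z x).1).
Proof.
move=> cz x Ax e e0; have [d d0 h] := cz x Ax e e0; exists d => // y Ay yx.
by have := h y Ay yx; rewrite norm_pair gt_max => /andP[].
Qed.

Lemma snd_econt {U : normedModType R} (A : set U) (z : U -> R * R) :
  econt A z -> econt A (fun x => (z x).2).
Proof.
move=> cz x Ax e e0; have [d d0 h] := cz x Ax e e0; exists d => // y Ay yx.
by have := h y Ay yx; rewrite norm_pair gt_max => /andP[].
Qed.

Lemma pair_econt {U : normedModType R} (A : set U) (z1 z2 : U -> R) :
  econt A z1 -> econt A z2 -> econt A (fun x => (z1 x, z2 x)).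
Proof.
move=> c1 c2 x Ax e e0; have [d1 d10 h1] := c1 x Ax e e0; have [d2 d20 h2] := c2 x Ax e e0.
exists (Num.min d1 d2); first by rewrite lt_min d10.
move=> y Ay; rewrite lt_min => /andP[/(h1 y Ay) k1 /(h2 y Ay) k2].
by rewrite norm_pair gt_max k1.
Qed.

Lemma continuous_econt {U V : normedModType R} (A : set U) (g : U -> V) :
  continuous g -> econt A g.
Proof. by move=> cg; apply/econtP; exact: continuous_subspaceT. Qed.

Lemma ei_econt {U : normedModType R} (A : set U) (v : U -> R) :
  econt A v -> econt A (fun x => ei (v x)).
Proof.
move=> cv; apply: pair_econt.
  apply: (econt_comp (B := setT) (f := v) (g := cos)) => //.
  by apply: continuous_econt; exact: continuous_cos.
apply: (econt_comp (B := setT) (f := v) (g := sin)) => //.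
by apply: continuous_econt; exact: continuous_sin.
Qed.

Lemma ei_norm (x : R) : (ei x).1 ^+ 2 + (ei x).2 ^+ 2 = 1. Proof. exact: cos2Dsin2. Qed.

Lemma cos_lt1_pi (x : R) : 0 < x -> x <= pi -> cos x < 1.
Proof.
move=> x0 xpi; rewrite -cos0 ltr_cos// in_itv/= ?lexx ?pi_ge0//.
by rewrite (ltW x0) xpi.
Qed.

Lemma ei_eq_cos (x y : R) : ei x = ei y -> cos (x - y) = 1.
Proof. by move=> [cxy sxy]; rewrite cosB cxy sxy -!expr2 cos2Dsin2. Qed.

Lemma ei_eq_small (x y : R) : ei x = ei y -> `|x - y| < pi -> x = y.
Proof.
move=> /ei_eq_cos; rewrite -cos_norm => c1 xpi; apply/eqP; rewrite -subr_eq0 -normr_eq0.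
apply: contraT; rewrite neq_lt normr_lt0/= => h.
by have := cos_lt1_pi h (ltW xpi); rewrite c1 ltxx.
Qed.

Lemma ei_shift_nat (x : R) (k : nat) : ei (x + k%:R * (2 * pi)) = ei x.
Proof.
have -> : x + k%:R * (2 * pi) = x + (pi *+ 2) *+ k by rewrite -[(pi *+ 2) *+ k]mulr_natl -[pi *+ 2]mulr_natl.
by rewrite /ei (periodicn (@cosD2pi R)) (periodicn (@sinD2pi R)).
Qed.

Lemma ei_shift (x : R) (k : int) : ei (x + k%:~R * (2 * pi)) = ei x.
Proof.
case: k => k; first exact: ei_shift_nat.
by rewrite NegzE mulrNz -[LHS](ei_shift_nat _ k.+1) mulNr subrK.
Qed.

Lemma pi2_gt0 : 0 < 2 * pi :> R. Proof. by rewrite mulr_gt0// pi_gt0. Qed.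

Lemma ei_eqP (x y : R) : ei x = ei y -> exists k : int, x = y + k%:~R * (2 * pi).
Proof.
move=> exy; pose k := Num.floor ((x - y) / (2 * pi)); exists k.
have p0 := pi2_gt0.
have := floor_le ((x - y) / (2 * pi)); have := floorD1_gt ((x - y) / (2 * pi)).
rewrite ltr_pdivrMr// ler_pdivlMr// -/k intrD mulrDl mul1r => h1 h2.
pose r := x - (y + k%:~R * (2 * pi)).
have r0 : 0 <= r by rewrite /r; lra.
have r2 : r < 2 * pi by rewrite /r; lra.
apply/eqP; rewrite -subr_eq0 -/r.
have c1 : cos r = 1 by apply: ei_eq_cos; rewrite ei_shift.
apply: contraT => rn0; have {rn0}r0 : 0 < r by rewrite lt_neqAle eq_sym rn0.
have [rp|rp] := leP r pi; first by have := cos_lt1_pi r0 rp; rewrite c1 ltxx.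
have : cos (2 * pi - r) < 1 by apply: cos_lt1_pi; lra.
by rewrite mulr_natl cosB cos2pi sin2pi mul0r addr0 mul1r c1 ltxx.
Qed.

Lemma ei_ex p : p.1 ^+ 2 + p.2 ^+ 2 = 1 -> exists x, p = ei x.
Proof.
case: p => p q /= pq.
have p1 : -1 <= p <= 1.
  rewrite -ler_norml -(ler_pXn2r (n := 2))// ?nnegrE// expr1n real_normK ?num_real//.
  by rewrite -pq lerDl sqr_ge0.
have q2 : 1 - p ^+ 2 = q ^+ 2 by rewrite -pq addrAC subrr add0r.
have [q0|q0] := leP 0 q.
  exists (acos p); rewrite /ei acosK ?in_itv//= sin_acos// q2 sqrtr_sqr ger0_norm//.
exists (- acos p); rewrite /ei cosN sinN acosK ?in_itv//= sin_acos// q2 sqrtr_sqr.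
by rewrite ltr0_norm// opprK.
Qed.

Definition cross p q := p.1 * q.2 - p.2 * q.1.

(** The points are close enough for their inner product to be positive, so the angle from [ei x] to
    [q] lies in ]-pi/2, pi/2[ and is the arcsine of their cross product. *)
Lemma ei_rotate (x : R) q : q.1 ^+ 2 + q.2 ^+ 2 = 1 -> `|q - ei x| < 1 / 2 ->
  -1 < cross (ei x) q < 1 /\ ei (x + asin (cross (ei x) q)) = q.
Proof.
case: q => q1 q2 /= q1q; rewrite norm_pair/= gt_max => /andP[h1 h2].
set c := cos x in h1 h2 *; set s := sin x in h1 h2 *.
have cs : c ^+ 2 + s ^+ 2 = 1 by exact: cos2Dsin2.
have k1 : (q1 - c) ^+ 2 < (1 / 2) ^+ 2.
  by rewrite -(real_normK (num_real (q1 - c))) ltr_pXn2r// nnegrE.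
have k2 : (q2 - s) ^+ 2 < (1 / 2) ^+ 2.
  by rewrite -(real_normK (num_real (q2 - s))) ltr_pXn2r// nnegrE.
pose dot := c * q1 + s * q2.
have dot0 : 1 / 2 < dot by rewrite /dot; nra.
rewrite /cross/= -/c -/s; set cr := c * q2 - s * q1.
have dc : dot ^+ 2 + cr ^+ 2 = 1.
  have -> : dot ^+ 2 + cr ^+ 2 = (c ^+ 2 + s ^+ 2) * (q1 ^+ 2 + q2 ^+ 2) by rewrite /dot /cr; ring.
  by rewrite cs q1q mulr1.
have cr1 : -1 < cr < 1 by rewrite -ltr_norml -(ltr_pXn2r (n := 2))// ?nnegrE// expr1n real_normK ?num_real//; nra.
have cr2 : -1 <= cr <= 1 by case/andP: cr1 => /ltW -> /ltW ->.
split => //; rewrite /ei cosD sinD asinK ?in_itv//= cos_asin// -/c -/s.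
have -> : 1 - cr ^+ 2 = dot ^+ 2 by rewrite -dc addrK.
rewrite sqrtr_sqr ger0_norm; last by lra.
rewrite /dot /cr; congr (_, _).
  by rewrite [LHS](_ : _ = (c ^+ 2 + s ^+ 2) * q1); [rewrite cs mul1r|ring].
by rewrite [LHS](_ : _ = (c ^+ 2 + s ^+ 2) * q2); [rewrite cs mul1r|ring].
Qed.

Definition square : set (R * R) := `[0, 1]%classic `*` `[0, 1]%classic.

Lemma compact_square : compact square.
Proof. by apply: compact_setX; exact: segment_compact. Qed.

Lemma econt_sum {U : normedModType R} (A : set U) m (g : nat -> U -> R) :
  (forall k, (k < m)%N -> econt A (g k)) -> econt A (fun x => \sum_(k < m) g k x).
Proof.
elim: m => [|m IH] h.
  rewrite (_ : (fun _ => _) = fun=> 0); last by apply/funext => x; rewrite big_ord0.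
  exact: econt_cst.
rewrite (_ : (fun _ => _) = fun x => 1 * (\sum_(k < m) g k x) + g m x); last first.
  by apply/funext => x; rewrite big_ord_recr/= mul1r.
by apply: econt_scale_add; [apply: IH => k km; apply: h; exact: ltnW|exact: h].
Qed.

(** The angle at [x] is accumulated along the segment from the origin to [x]. In each of [N] equal
    steps [z] moves by less than 1/2, so every increment is an arcsine depending continuously on
    [x], and no local lifts have to be glued. *)
Lemma lift_square (z : R * R -> R * R) : econt square z ->
  (forall x, square x -> (z x).1 ^+ 2 + (z x).2 ^+ 2 = 1) ->
  exists2 v : R * R -> R, econt square v & forall x, square x -> z x = ei (v x).
Proof.
move=> cz z1; have h2 : 0 < 1 / 2 :> R by [].
have [d d0 hd] := econt_unif compact_square cz h2.
pose N := (Num.bound d^-1).+1.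
have Nd : N%:R^-1 < d.
  rewrite invf_plt ?posrE//; have := archi_boundP (ltW (_ : 0 < d^-1)); rewrite invr_gt0 => /(_ d0).
  by move=> /lt_le_trans; apply; rewrite ler_nat.
have N0 : 0 < N%:R :> R by rewrite ltr0n.
pose pt k (x : R * R) : R * R := (k%:R / N%:R) *: x.
have ptQ k x : (k <= N)%N -> square x -> square (pt k x).
  move=> kN [/=]; rewrite !in_itv/= => /andP[a1 a2] /andP[b1 b2].
  have c0 : 0 <= k%:R / N%:R :> R by rewrite divr_ge0.
  have c1 : k%:R / N%:R <= 1 :> R by rewrite ler_pdivrMr// mul1r ler_nat.
  by split; rewrite /= in_itv/=; apply/andP; split; rewrite ?mulr_ge0// mulr_ile1.
have ptstep k x : (k < N)%N -> square x -> `|z (pt k.+1 x) - z (pt k x)| < 1 / 2.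
  move=> kN Qx; apply: hd; [exact: ptQ (ltnW kN) Qx|exact: ptQ|].
  rewrite /pt -scalerBl -mulrBl -natrB// subSnn mul1r normrZ ger0_norm ?invr_ge0//.
  apply: le_lt_trans Nd; rewrite ler_piMr ?invr_ge0// norm_pair ge_max.
  by move: Qx => [/=]; rewrite !in_itv/= => /andP[a1 a2] /andP[b1 b2]; rewrite !ger0_norm// a2.
have [th0 th0E] : exists t, z (0, 0) = ei t.
  by apply: ei_ex; apply: z1; split; rewrite /= in_itv/= lexx ler01.
pose v m x := th0 + \sum_(k < m) asin (cross (z (pt k x)) (z (pt k.+1 x))).
have vE m x : (m <= N)%N -> square x -> ei (v m x) = z (pt m x).
  move=> + Qx; elim: m => [|m IH] mN.
    by rewrite /v big_ord0 addr0 -th0E /pt mul0r scale0r.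
  have IHm := IH (ltnW mN).
  rewrite /v big_ord_recr/= addrA -/(v m x) -IHm.
  apply: (@ei_rotate _ _ _ _).2; first by apply: z1; exact: ptQ.
  by rewrite IHm; exact: ptstep.
exists (v N).
  rewrite (_ : v N = fun x => 1 * (\sum_(k < N) asin (cross (z (pt k x)) (z (pt k.+1 x)))) + th0).
    apply: econt_scale_add; last exact: econt_cst.
    apply: (@econt_sum _ _ _ (fun k x => asin (cross (z (pt k x)) (z (pt k.+1 x))))) => k kN.
    have cpt j : (j <= N)%N -> econt square (fun x => z (pt j x)).
      move=> jN; apply: (@econt_comp _ _ _ _ square square (pt j) z) => //.
        by move=> x; exact: ptQ.
      by apply: continuous_econt; exact: scaler_continuous.
    apply: (@econt_comp _ _ _ _ square [set y : R | -1 < y < 1]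
        (fun x => cross (z (pt k x)) (z (pt k.+1 x))) asin).
    - move=> x Qx /=; rewrite -(vE k)//; last exact: ltnW.
      apply: (@ei_rotate _ _ _ _).1; first by apply: z1; exact: ptQ.
      by rewrite vE//; [exact: ptstep|exact: ltnW].
    - have cp := cpt k (ltnW kN); have cq := cpt k.+1 kN.
      rewrite (_ : (fun _ => _) = fun x => -1 * ((z (pt k x)).2 * (z (pt k.+1 x)).1)
        + (z (pt k x)).1 * (z (pt k.+1 x)).2); last first.
        by apply/funext => x; rewrite /cross mulN1r addrC.
      by apply: econt_scale_add; apply: econtM; try exact: fst_econt; exact: snd_econt.
    - move=> y /= y1 e e0; have /cvgrPdist_lt/(_ _ e0) := continuous_asin y1.
      move=> /nbhs_ballP[c /= c0 hc]; exists c => // y' _ yy'.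
      by rewrite distrC; apply: hc; rewrite -ball_normE/= distrC.
  by apply/funext => x; rewrite /v mul1r addrC.
by move=> x Qx; rewrite vE// /pt divff ?gt_eqF// scale1r.
Qed.

(** The path is read as a map of the square that depends on the first coordinate only. *)
Lemma lift_itv (s : R -> R * R) (a b : R) : a < b -> econt `[a, b] s ->
  (forall t, t \in `[a, b] -> (s t).1 ^+ 2 + (s t).2 ^+ 2 = 1) ->
  exists2 v : R -> R, econt `[a, b] v & forall t, t \in `[a, b] -> s t = ei (v t).
Proof.
move=> ab cs s1; have ba0 : 0 < b - a by rewrite subr_gt0.
pose q (x : R * R) := a + (b - a) * x.1.
have qab (x : R * R) : square x -> q x \in `[a, b].
  move=> [/= + _]; rewrite !in_itv/= /q => /andP[h1 h2]; apply/andP; split; nra.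
have cq : econt square q.
  rewrite (_ : q = fun x => (b - a) * x.1 + a); last by apply/funext => x; rewrite /q addrC.
  apply: econt_scale_add; last exact: econt_cst.
  by apply: continuous_econt => x; exact: cvg_fst.
have [|x Qx|v cv vE] := @lift_square (s \o q).
- by apply: (econt_comp (B := `[a, b]%classic)).
- by apply: s1; exact: qab.
pose p t : R * R := ((t - a) / (b - a), 0).
have pQ t : t \in `[a, b] -> square (p t).
  rewrite in_itv/= => /andP[h1 h2]; split; rewrite /= in_itv/= ?lexx ?ler01//.
  by rewrite divr_ge0 ?ler_pdivrMr ?mul1r ?lerD2r//= subr_ge0// ltW.
exists (v \o p).
  apply: (econt_comp (B := square)) => //.
  apply: pair_econt; last exact: econt_cst.
  rewrite (_ : (fun _ => _) = fun t => (b - a)^-1 * t + (- a / (b - a))); last first.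
    by apply/funext => t; field; rewrite subr_eq0 gt_eqF.
  by apply: econt_scale_add; [apply: continuous_econt => x; exact: cvg_id|exact: econt_cst].
move=> t tab; rewrite /= -vE; last exact: pQ.
by rewrite /= /q/= mulrC divfK ?gt_eqF// addrC subrK.
Qed.

Lemma ei_sub (x y : R) : ei x = ei y -> ei (x - y) = ei 0.
Proof.
move=> [cxy sxy]; rewrite /ei cosB sinB cos0 sin0 cxy sxy -!expr2 cos2Dsin2.
by rewrite mulrC subrr.
Qed.

(** The difference of two lifts takes values in the multiples of 2 pi and moves locally by less than
    pi, so it is locally constant. *)
Lemma lift_uniq (v w : R -> R) (a b : R) : a <= b -> econt `[a, b] v -> econt `[a, b] w ->
  (forall t, t \in `[a, b] -> ei (v t) = ei (w t)) -> v b - v a = w b - w a.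
Proof.
move=> ab cv cw vw.
have cD : econt `[a, b] (fun t => -1 * w t + v t) by exact: econt_scale_add.
have := @local_lipschitz_increment _ (fun t => -1 * w t + v t) a b 0 ab.
rewrite mul0r normr_le0 => H; have {}H : -1 * w b + v b - (-1 * w a + v a) == 0.
  apply: H => t tab; have [d d0 hd] := cD t tab pi (pi_gt0 R).
  exists d => // t' t'ab tt'; rewrite mul0r normr_le0 subr_eq0; apply/eqP.
  apply: ei_eq_small; last exact: hd.
  by rewrite !mulN1r ![- w _ + _]addrC !ei_sub ?vw.
by move/eqP: H; lra.
Qed.

End circle.

(** * Loops in triangulated curves *)

Section matrix_norm.
Context {R : realType} {n : nat}.
Local Notation V := 'rV[R]_n.

Lemma normr_coord (x : V) j : `|x 0 j| <= `|x|.
Proof. by rewrite /Num.norm/= mx_normrE; apply: (@le_bigmax _ _ _ 0 (fun i => `|x i.1 i.2|) (0, j)). Qed.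

Lemma normr_rV_le (x : V) c : 0 <= c -> (forall j, `|x 0 j| <= c) -> `|x| <= c.
Proof.
move=> c0 xc; rewrite /Num.norm/= mx_normrE; apply/bigmax_leP; split => // -[i j] _ /=.
by rewrite (ord1 i).
Qed.

Lemma coord_klip (c : R -> V) a b K j : klip K c a b -> klip K (fun t => c t 0 j) a b.
Proof.
move=> cK x y xab yab; apply: le_trans (cK x y xab yab).
by have := normr_coord (c x - c y) j; rewrite !mxE.
Qed.

Lemma coord_econt {U : normedModType R} (A : set U) (c : U -> V) j :
  econt A c -> econt A (fun t => c t 0 j).
Proof.
move=> cc x Ax e e0; have [d d0 h] := cc x Ax e e0; exists d => // y Ay yx.
by apply: le_lt_trans (h y Ay yx); have := normr_coord (c y - c x) j; rewrite !mxE.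
Qed.

End matrix_norm.

Section gluing.
Context {R : realType}.

Lemma ex_pos_lower_bound (I : finType) (d : I -> R) : (forall i, 0 < d i) ->
  exists2 e, 0 < e & forall i, e <= d i.
Proof.
move=> d0; exists (\big[Num.min/1]_i d i).
  by apply/bigmin_gtP; split.
by move=> i; exact: bigmin_le.
Qed.

Lemma econt_bigcup {U V : normedModType R} (I : finType) (A : I -> set U) (g : U -> V) :
  (forall i, closed (A i)) -> (forall i, econt (A i) g) -> econt (\bigcup_i A i) g.
Proof.
move=> clA cA x [i0 _ Ai0x] e e0.
have /choice[d dP] : forall i, exists d, 0 < d /\ forall y, A i y -> `|y - x| < d -> `|g y - g x| < e.
  move=> i; have [Aix|nAix] := pselect (A i x).
    by have [d d0 h] := cA i x Aix e e0; exists d.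
  have /nbhs_ballP[d /= d0 dA] : nbhs x (~` A i).
    by apply: open_nbhs_nbhs; split => //; exact: closed_openC.
  exists d; split => // y Aiy yx; exfalso; apply: (dA y) => //.
  by rewrite -ball_normE/= distrC.
have [r r0 rd] := ex_pos_lower_bound (fun i => (dP i).1).
exists r => // y [i _ Aiy] yr; apply: (dP i).2 => //.
exact: lt_le_trans (rd i).
Qed.

End gluing.

Section triangulated.
Context {R : realType} {n k : nat}.
Local Notation V := 'rV[R]_n.
Variables (h : 'I_k.+1 -> R -> V) (X : set V).
Hypothesis triX : triangulation h X.

Local Notation arc i := (h i @` `[0, 1]).

Lemma arc_klip i : exists2 K, 0 < K & klip K (h i) 0 1.
Proof. by have [/(_ i)[/lipschitz_klip]] := triX. Qed.

Lemma arc_inj i : {in `[0, 1] &, injective (h i)}.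
Proof.
have [/(_ i)[_ [g [gh _]]] _ _] := triX.
by move=> s t s01 t01 st; rewrite -(gh s)// st gh.
Qed.

Lemma arc_econt (i : 'I_k.+1) : econt (`[0, 1]%classic : set R) (h i).
Proof. by have [K K0 /klip_econt] := arc_klip i; apply. Qed.

Lemma arc_compact i : compact (arc i).
Proof.
apply: continuous_compact; last exact: segment_compact.
by apply/econtP; exact: arc_econt.
Qed.

Lemma arc_closed i : closed (arc i).
Proof. by apply: compact_closed; [exact: norm_hausdorff|exact: arc_compact]. Qed.

Lemma in_arc p : X p -> exists i t, t \in `[0, 1] /\ p = h i t.
Proof. by have [_ <- _] := triX; move=> [i _ [t t01 <-]]; exists i, t. Qed.

Definition open_arc i p := exists2 t, 0 < t < 1 & p = h i t.

Lemma in01 (t : R) : 0 < t < 1 -> t \in `[0, 1].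
Proof. by rewrite in_itv/= => /andP[/ltW -> /ltW ->]. Qed.

Lemma arc_cases (t : R) : t \in `[0, 1] -> [\/ t = 0, t = 1 | 0 < t < 1].
Proof.
rewrite in_itv/= => /andP[t0 t1].
have [->|t0'] := eqVneq t 0; first by constructor 1.
have [->|t1'] := eqVneq t 1; first by constructor 2.
by constructor 3; rewrite !lt_neqAle t0 t1 t1' eq_sym t0'.
Qed.

Lemma open_arc_disjoint i j p : i != j -> open_arc i p -> (arc j) p -> False.
Proof.
move=> ij [t t01 pE] jp.
have ip : arc i p by exists t; rewrite ?pE//; exact: in01.
have [_ _ /(_ _ _ ij)[H|[q [qi _] H]]] := triX.
  by have : (arc i `&` arc j) p by []; rewrite H.
have : (arc i `&` arc j) p by []; rewrite H => /= pq.
case: qi; rewrite -pq pE => e.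
  have := arc_inj (in01 t01) _ e; rewrite in_itv/= lexx ler01 => /(_ isT) t0.
  by rewrite t0 ltxx in t01.
have := arc_inj (in01 t01) _ e; rewrite in_itv/= lexx ler01 => /(_ isT) t0.
by rewrite t0 ltxx andbF in t01.
Qed.

Definition arc_param i p : R := xget 0 [set t | t \in `[0, 1] /\ h i t = p].

(** The quotient map that winds the i-th arc once around the circle and sends everything else to the
    base point. The turns of its composition with a loop count the net passages along that arc. *)
Definition collapse i p : R * R :=
  if `[< arc i p >] then ei (2 * pi * arc_param i p) else ei 0.

Lemma collapse_norm i p : (collapse i p).1 ^+ 2 + (collapse i p).2 ^+ 2 = 1.
Proof. by rewrite /collapse; case: ifP => _; exact: ei_norm. Qed.

Lemma collapse_arc i t : t \in `[0, 1] -> collapse i (h i t) = ei (2 * pi * t).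
Proof.
move=> t01; rewrite /collapse ifT; last by apply/asboolP; exists t.
congr (ei (_ * _)); rewrite /arc_param; case: xgetP => [s _ [s01]|/(_ t)]; last by case.
exact: arc_inj.
Qed.

Lemma ei2pi : ei (2 * pi) = ei 0 :> R * R.
Proof. by have := ei_shift_nat (0 : R) 1; rewrite add0r mul1r. Qed.

Lemma collapse_other i p : ~ open_arc i p -> collapse i p = ei 0.
Proof.
move=> np; have [[t t01 pE]|] := pselect (arc i p); last first.
  by rewrite /collapse; case: ifP => // /asboolP.
rewrite -pE collapse_arc//; have [->|->|t0] := arc_cases t01.
- by rewrite mulr0.
- by rewrite mulr1 ei2pi.
- by exfalso; apply: np; exists t.
Qed.

(** Both ends of the i-th arc and all other arcs go to [ei 0], so the map is continuous on each of
    finitely many closed arcs. *)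
Lemma collapse_econt i : econt X (collapse i).
Proof.
have [_ <- _] := triX; apply: econt_bigcup => j; first exact: arc_closed.
have [->|ji] := eqVneq j i.
  apply: (econt_quotient (f := fun t => ei (2 * pi * t)) (@segment_compact _ _ _) (arc_econt i)).
    by apply: ei_econt; apply: continuous_econt; exact: mulrl_continuous.
  by move=> t t01; rewrite collapse_arc.
move=> p jp e e0; exists 1 => // q jq _.
rewrite !collapse_other ?subrr ?normr0// => /(open_arc_disjoint _).
  by move/(_ j); rewrite eq_sym => /(_ ji); apply.
by move/(_ j); rewrite eq_sym => /(_ ji); apply.
Qed.

End triangulated.

Section extension.
Context {R : realType}.

Lemma eq_int_lt1 (k l : int) : `|(k%:~R : R) - l%:~R| < 1 -> k = l.
Proof.
rewrite -intrB -intr_norm -[1]/(1%:~R) ltr_int; lia.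
Qed.

(* Extends P from [0, 1] to the line with increment P 1 - P 0 over each period. *)
Definition quasi_periodic (P : R -> R) (y : R) : R :=
  P (y - (Num.floor y)%:~R) + (Num.floor y)%:~R * (P 1 - P 0).

Lemma quasi_periodicE P (m : int) t : t \in `[0, 1] ->
  quasi_periodic P (m%:~R + t) = P t + m%:~R * (P 1 - P 0).
Proof.
rewrite in_itv/= => /andP[t0]; rewrite le_eqVlt => /predU1P[->|t1].
  have E : Num.floor (m%:~R + 1 : R) = m + 1 by apply: floor_def; rewrite !intrD lexx/= ltrDl.
  by rewrite /quasi_periodic E intrD subrr; ring.
have E : Num.floor (m%:~R + t) = m by apply: floor_def; rewrite lerDl t0 intrD ltrD2l.
by rewrite /quasi_periodic E addrAC subrr add0r.
Qed.

End extension.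

(** * The integral over a loop as a sum over the arcs *)

Section loop_formula.
Context {R : realType} {n k : nat}.
Local Notation V := 'rV[R]_n.
Variables (h : 'I_k.+1 -> R -> V) (X : set V).
Hypothesis triX : triangulation h X.
Variables (c : R -> V) (a b K : R) (v : 'I_k.+1 -> R -> R).
Hypotheses (ab : a < b) (K0 : 0 < K) (cK : klip K c a b).
Hypothesis cX : forall t, t \in `[a, b] -> X (c t).
Hypothesis cv : forall i, econt (`[a, b]%classic : set R) (v i).
Hypothesis vE : forall i t, t \in `[a, b] -> collapse h i (c t) = ei (v i t).

Local Notation u i t := (v i t / (2 * pi)).
Local Notation pi20 := (@pi2_gt0 R).

Let pi2n0 : 2 * pi != 0 :> R. Proof. exact: lt0r_neq0 pi20. Qed.

(** [u i t] is the lifted angle in turns. Off the open arc [i] the collapsed point is [ei 0], which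
    makes it an integer. *)
Lemma turn_int i t : t \in `[a, b] -> ~ open_arc h i (c t) -> exists m : int, u i t = m%:~R.
Proof.
move=> tab nt; have := vE i tab; rewrite (collapse_other triX nt) => /esym/ei_eqP[m ->].
by exists m; rewrite add0r mulfK.
Qed.

Lemma turn_arc i t tau : t \in `[a, b] -> tau \in `[0, 1] -> c t = h i tau ->
  exists m : int, u i t = m%:~R + tau.
Proof.
move=> tab t01 ct; have := vE i tab; rewrite ct (collapse_arc triX)// => /esym/ei_eqP[m ->].
by exists m; rewrite mulrDl mulfK// addrC mulrAC divff ?mul1r.
Qed.

Lemma turn_unif t e : t \in `[a, b] -> 0 < e -> exists2 d, 0 < d &
  forall t', t' \in `[a, b] -> `|t' - t| < d -> forall i, `|u i t' - u i t| < e.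
Proof.
move=> tab e0.
have /choice[d dP] : forall i, exists d, 0 < d /\ forall t', t' \in `[a, b] -> `|t' - t| < d ->
    `|v i t' - v i t| < e * (2 * pi).
  by move=> i; have [d d0 hd] := cv i tab (mulr_gt0 e0 pi20); exists d.
have [r r0 rd] := ex_pos_lower_bound (fun i => (dP i).1).
have V0 : 0 < (2 * pi)^-1 :> R by rewrite invr_gt0 pi20.
exists r => // t' t'ab tr i; rewrite -mulrBl normrM (gtr0_norm V0) ltr_pdivrMr ?pi20//.
by have [_ H] := dP i; apply: H => //; exact: lt_le_trans (rd i).
Qed.

(** From [t] to [t'] the curve moves along arc [i] only. The same integer [m] occurs at both times,
    so the lifted angle changes exactly as the arc parameter does, even when an end of the arc is
    reached. *)
Definition step_on_arc t t' i tau tau' := [/\ tau \in `[0, 1], tau' \in `[0, 1],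
  c t = h i tau, c t' = h i tau' &
  (exists m : int, u i t = m%:~R + tau /\ u i t' = m%:~R + tau') /\
  forall j, j != i -> u j t' = u j t].

(** If [c t] is inside an arc, the curve stays there for a while, since leaving would make the
    lifted angle of that arc an integer. If [c t] is an arc end, a nearby point is either an arc
    end, hence [c t] itself, or lies inside an arc that has [c t] as an end. *)
Lemma local_step t d0 : t \in `[a, b] -> 0 < d0 -> exists2 d, 0 < d &
  forall t', t' \in `[a, b] -> `|t' - t| < d ->
    (c t' = c t /\ forall i, u i t' = u i t) \/
    exists i tau tau', step_on_arc t t' i tau tau' /\ `|tau' - tau| < d0.
Proof.
move=> tab d00.
have int_eq i t' : t' \in `[a, b] -> ~ open_arc h i (c t) -> ~ open_arc h i (c t') ->
    `|u i t' - u i t| < 1 -> u i t' = u i t.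
  move=> t'ab n1 n2; have [m1 ->] := turn_int tab n1; have [m2 ->] := turn_int t'ab n2.
  by move/eq_int_lt1 => ->.
have [[i [tau t01 ct]]|nop] := pselect (exists i, open_arc h i (c t)).
  have tau01 := in01 t01.
  have [m um] := turn_arc tab tau01 ct.
  (* With a smaller change of angle the parameter stays in ]0, 1[ and within [d0] of [tau]. *)
  pose e1 := Num.min (Num.min tau (1 - tau)) d0.
  have e10 : 0 < e1 by case/andP: t01 => h1 h2; rewrite !lt_min h1 d00 subr_gt0 h2.
  have [d dd0 hd] := turn_unif tab e10.
  exists d => // t' t'ab tt'; right.
  have hu := hd t' t'ab tt'.
  have := hu i; rewrite !lt_min -andbA => /and3P[k1 k2 k3].
  pose tau' := u i t' - m%:~R.
  have ut' : u i t' = m%:~R + tau' by rewrite /tau' addrC subrK.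
  have tt : u i t' - u i t = tau' - tau by rewrite ut' um; ring.
  rewrite tt in k1 k2 k3.
  have {k1} k1 : 0 < tau' by have := ler_norm (- (tau' - tau)); rewrite normrN; lra.
  have {k2} k2 : tau' < 1 by have := ler_norm (tau' - tau); lra.
  have [sig s01 ct'] : open_arc h i (c t').
    apply: contrapT => nt'; have [l ul] := turn_int t'ab nt'.
    have e : tau' = l%:~R - m%:~R by rewrite /tau' ul.
    have lm : l = m by apply: (@eq_int_lt1 R); rewrite -e ger0_norm// ltW.
    by move: k1; rewrite e lm subrr ltxx.
  have [l ul] := turn_arc t'ab (in01 s01) ct'.
  have lm : l = m.
    apply: (@eq_int_lt1 R); case/andP: s01 => s0 s1.
    have -> : l%:~R - m%:~R = tau' - sig by rewrite /tau' ul; ring.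
    by rewrite ltr_norml; apply/andP; split; lra.
  have st : sig = tau' by rewrite /tau' ul lm; ring.
  exists i, tau, tau'; split => //; split => //; rewrite -?st ?(in01 s01)//.
  split; first by exists m; rewrite st.
  move=> j ji; apply: int_eq => //.
  - move=> oj; apply: (open_arc_disjoint triX ji oj).
    by exists tau; rewrite ?ct.
  - move=> oj; apply: (open_arc_disjoint triX ji oj).
    by exists sig; [exact: in01|rewrite ct'].
  - have := hu j; rewrite !lt_min -andbA => /and3P[j1 j2 _].
    by case/andP: t01 => h1 h2; lra.
have np i : ~ open_arc h i (c t) by move=> oi; apply: nop; exists i.
have e00 : (0:R) \in `[0, 1] by rewrite in_itv/= lexx ler01.
have e11 : (1:R) \in `[0, 1] by rewrite in_itv/= lexx ler01.
(* There are finitely many arc ends, so those different from [c t] keep a positive distance from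
   it. *)
have [r r0 rP] : exists2 r, 0 < r & forall i s, s = 0 \/ s = 1 ->
    `|h i s - c t| < r -> h i s = c t.
  pose vd (x : 'I_k.+1 * bool) := if h x.1 (x.2%:R) == c t then 1 else `|h x.1 x.2%:R - c t|.
  have [|r r0 rP] := @ex_pos_lower_bound _ _ vd.
    by move=> x; rewrite /vd; case: ifPn => // xc; rewrite normr_gt0 subr_eq0.
  exists r => // i s s01 lr.
  have [x sE] : exists x : bool, s = x%:R by case: s01 => ->; [exists false|exists true].
  have := rP (i, x); rewrite /vd/= -sE; case: eqP => // _ rle.
  by have := lt_le_trans lr rle; rewrite ltxx.
have r20 : 0 < r / 2 by rewrite divr_gt0.
have /choice[hd hdP] : forall x : 'I_k.+1 * bool, exists d, 0 < d /\ forall s, s \in `[0, 1] ->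
    `|s - x.2%:R| < d -> `|h x.1 s - h x.1 x.2%:R| < r / 2.
  move=> [i x]; have x01 : (x%:R : R) \in `[0, 1] by case: x.
  by have [d dd0 H] := arc_econt triX i x01 r20; exists d.
have [hr hr0 hrd] := ex_pos_lower_bound (fun x => (hdP x).1).
pose e1 := Num.min (Num.min hr d0) (1 / 2).
have e10 : 0 < e1 by rewrite !lt_min hr0 d00 divr_gt0.
have [d1 d10 hd1] := turn_unif tab e10.
have [d2 d20 hd2] := klip_econt K0 cK tab r20.
exists (Num.min d1 d2); first by rewrite lt_min d10.
move=> t' t'ab; rewrite lt_min => /andP[/(hd1 _ t'ab) hu /(hd2 _ t'ab) hc].
have hu1 j : [/\ `|u j t' - u j t| < hr, `|u j t' - u j t| < d0 & `|u j t' - u j t| < 1 / 2].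
  by have := hu j; rewrite !lt_min -andbA => /and3P.
have [[i [sig s01 ct']]|nop'] := pselect (exists i, open_arc h i (c t')); last first.
  have np' i : ~ open_arc h i (c t') by move=> oi; apply: nop'; exists i.
  left; split; last by move=> i; apply: int_eq => //; have [_ _] := hu1 i; lra.
  have [i [s [s01 cs]]] := in_arc triX (cX t'ab).
  rewrite cs; apply: rP; last by rewrite -cs; lra.
  have [->|->|s0] := arc_cases s01; [by left|by right|].
  by exfalso; apply: (np' i); exists s.
right; have [l ul] := turn_arc t'ab (in01 s01) ct'.
have [m um] := turn_int tab (np i).
have [u1 u2 u3] := hu1 i.
have other j : j != i -> u j t' = u j t.
  move=> ji; apply: int_eq => //; last by have [_ _] := hu1 j; lra.
  move=> oj; apply: (open_arc_disjoint triX ji oj).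
  by exists sig; [exact: in01|rewrite ct'].
(* The arc is entered from its start, the angle growing from [m], or from its finish, the angle
   decreasing from [m]; in the second case the integer part drops by one. *)
have lm : l = m \/ l = m - 1.
  rewrite ul um in u3; case/andP: s01 => s0 s1; move: u3; rewrite ltr_norml => /andP[h1 h2].
  have h3 : (l%:~R : R) < (m + 1)%:~R by rewrite intrD -[1%:~R]/(1:R); lra.
  have h4 : (m - 2)%:~R < (l%:~R : R) by rewrite intrB -[2%:~R]/(2:R); lra.
  move: h3 h4; rewrite 2!(@ltr_int R); clear; lia.
have finish (x : bool) : `|sig - x%:R| < hr -> c t = h i x%:R.
  move=> sx; apply/esym/rP; first by case: (x); [right|left].
  have := (hdP (i, x)).2 sig (in01 s01) (lt_le_trans sx (hrd (i, x))) => /= k1.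
  have := ler_distD (h i sig) (h i x%:R) (c t); rewrite (distrC (h i x%:R) (h i sig)).
  move: hc; rewrite ct'; lra.
case: lm => lm.
  have E : u i t' - u i t = sig by rewrite ul um lm; ring.
  rewrite E in u1 u2.
  exists i, 0, sig; split; last by rewrite subr0.
  split => //; [exact: in01|by rewrite (finish false)// subr0|].
  by split => //; exists m; rewrite um addr0 ul lm.
have E : u i t' - u i t = sig - 1 by rewrite ul um lm intrB -[1%:~R]/(1:R); ring.
rewrite E in u1 u2.
exists i, 1, sig; split => //.
split => //; [exact: in01|by rewrite (finish true)|].
by split => //; exists l; rewrite um ul lm intrB -[1%:~R]/(1:R) subrK.
Qed.

(** An approximate primitive along each arc is extended quasi-periodically and evaluated at the
    lifted angle of that arc. By [local_step] only one angle moves at a time, so the sum over the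
    arcs is an approximate primitive of psi(c) dc_s. Over the loop the i-th angle gains [M i] full
    turns, and the i-th term gains [M i] times the increment of its primitive. *)
Lemma loop_formula (psi : V -> R) (s : 'I_n) : continuous psi -> c a = c b ->
  dint (fun t => c t 0 s) (psi \o c) a b =
  \sum_i (v i b - v i a) / (2 * pi) * dint (fun t => h i t 0 s) (psi \o h i) 0 1.
Proof.
move=> cpsi cab.
have aab : a \in `[a, b] by rewrite itvP1 lexx ltW.
have bab : b \in `[a, b] by rewrite itvP1 lexx ltW.
have /choice[M MP] : forall i, exists m : int, v i b = v i a + m%:~R * (2 * pi).
  by move=> i; apply: ei_eqP; rewrite -!vE// cab.
have /choice[Kh KhP] : forall i, exists K, 0 < K /\ klip K (h i) 0 1.
  by move=> i; have [Ki Ki0 hK] := arc_klip triX i; exists Ki.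
have cpsic : econt (`[a, b]%classic : set R) (psi \o c).
  by apply: (econt_comp (B := setT)) => //; [exact: klip_econt cK|exact: continuous_econt].
have cpsih i : econt (`[0, 1]%classic : set R) (psi \o h i).
  by apply: (econt_comp (B := setT)) => //; [exact: (arc_econt triX i)|exact: continuous_econt].
have -> : \sum_i (v i b - v i a) / (2 * pi) * dint (fun t => h i t 0 s) (psi \o h i) 0 1 =
    \sum_i (M i)%:~R * dint (fun t => h i t 0 s) (psi \o h i) 0 1.
  by apply: eq_bigr => i _; rewrite MP addrAC subrr add0r mulfK.
apply/eqP; rewrite -subr_eq0; apply/eqP.
apply: (@eq0_le_eps_mul _ _ (K * (b - a) + \sum_i `|(M i)%:~R| * Kh i)) => e e0.
have /choice[P PP] : forall i, exists P,
    step_primitive P (fun t => h i t 0 s) (psi \o h i) e 0 1.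
  by move=> i; exact: step_primitive_ex ler01 e0 (cpsih i).
pose B t := \sum_i quasi_periodic (P i) (u i t).
have B_ab : B b - B a = \sum_i (M i)%:~R * (P i 1 - P i 0).
  rewrite /B -sumrB; apply: eq_bigr => i _.
  have [m ua] : exists m : int, exists2 tau, tau \in `[0, 1] & u i a = m%:~R + tau.
    exists (Num.floor (u i a)), (u i a - (Num.floor (u i a))%:~R); last by rewrite addrC subrK.
    have /andP[h1 h2] := floor_itv (u i a).
    by rewrite in_itv/= subr_ge0 h1 lerBlDl ltW// -[1]/(1%:~R) -intrD.
  case: ua => tau t01 ua.
  have ub : u i b = (m + M i)%:~R + tau.
    by rewrite MP mulrDl mulfK// ua intrD addrAC.
  by rewrite ua ub !quasi_periodicE// intrD; ring.
have step1 : `|dint (fun t => c t 0 s) (psi \o c) a b - (B b - B a)| <= e * K * (b - a).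
  apply: (dint_approx ab K0 (coord_klip s cK) cpsic) => t tab.
  have /choice[dP dPP] : forall i, exists d, 0 < d /\ forall tau, tau \in `[0, 1] -> c t = h i tau ->
      forall tau', tau' \in `[0, 1] -> `|tau' - tau| < d ->
      `|P i tau' - P i tau - psi (c t) * (h i tau' 0 s - h i tau 0 s)|
        <= e * `|h i tau' 0 s - h i tau 0 s|.
    move=> i; have [[tau [t01 ct]]|no] := pselect (exists tau, tau \in `[0, 1] /\ c t = h i tau).
      have [d d0 hd] := PP i tau t01; exists d; split => // tau2 t201 ct2.
      have -> : tau2 = tau by apply: (arc_inj triX (i := i) t201 t01); rewrite -ct2 -ct.
      by move=> tau' t'01 tt'; rewrite ct; exact: hd.
    by exists 1; split => // tau t01 ct; exfalso; apply: no; exists tau.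
  have [d0 d00 d0P] := ex_pos_lower_bound (fun i => (dPP i).1).
  have [d dd0 hd] := local_step tab d00.
  exists d => // t' t'ab tt'.
  have [[ct' ut']|[i [tau [tau' [[t01 t'01 ct ct' [[m [um um']] ot]] td]]]]] := hd t' t'ab tt'.
    have -> : B t' = B t by apply: eq_bigr => i _; rewrite ut'.
    by rewrite ct' !subrr mulr0 subrr normr0 !mulr_ge0 ?(ltW K0)// ltW.
  have -> : B t' - B t = P i tau' - P i tau.
    rewrite /B (bigD1 i)//= [X in _ - X](bigD1 i)//= um um' !quasi_periodicE//.
    rewrite (eq_bigr (fun j => quasi_periodic (P j) (u j t))); last by move=> j ji; rewrite ot.
    by ring.
  have [_ /(_ tau t01 ct tau' t'01 (lt_le_trans td (d0P i)))] := dPP i.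
  rewrite -ct -ct' => H; apply: le_trans H _.
  by rewrite -mulrA; apply: ler_wpM2l; [exact: ltW|exact: (coord_klip s cK)].
have step2 i : `|dint (fun t => h i t 0 s) (psi \o h i) 0 1 - (P i 1 - P i 0)| <= e * Kh i.
  have [Kh0 hK] := KhP i.
  have := dint_approx (@ltr01 R) Kh0 (coord_klip s hK) (cpsih i) (B := P i) (kap := e * Kh i).
  rewrite subr0 mulr1; apply => y y01; have [d d0 hd] := PP i y y01.
  exists d => // y' y'01 yy'; apply: le_trans (hd y' y'01 yy') _.
  by rewrite -mulrA; apply: ler_wpM2l; [exact: ltW|exact: (coord_klip s hK)].
set D := dint _ _ a b; set S := \sum_i _ * dint _ _ _ _.
rewrite mulrDr mulrA mulr_sumr.
apply: le_trans (ler_distD (B b - B a) _ _) _; apply: lerD => //.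
rewrite B_ab /S -sumrB; apply: le_trans (ler_norm_sum _ _ _) _.
apply: ler_sum => i _; rewrite -mulrBr normrM distrC mulrCA ler_wpM2l//.
Qed.

End loop_formula.

(** * Homology and integrals *)

Section turns.
Context {R : realType} {n : nat}.
Local Notation V := 'rV[R]_n.
Implicit Types (X : set V) (E : V -> R * R) (sg : R -> V).

Definition is_lift E sg (th : R -> R) :=
  econt (`[0, 1]%classic : set R) th /\ forall t, t \in `[0, 1] -> E (sg t) = ei (th t).

(** Measured in radians. By [turnsE] every lift gives this value; the default 0 stands for a path
    without a lift. *)
Definition turns E sg : R := xget 0 [set r | exists2 th, is_lift E sg th & r = th 1 - th 0].

Lemma turnsE E sg th : is_lift E sg th -> turns E sg = th 1 - th 0.
Proof.
move=> [cth thE]; rewrite /turns; case: xgetP => [r _ [th' [cth' th'E] ->]|/(_ (th 1 - th 0))].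
  by apply: (lift_uniq ler01) => // t t01; rewrite -th'E// thE.
by move=> h; exfalso; apply: h; exists th.
Qed.

Lemma turns_ext E sg tau : (forall t, t \in `[0, 1] -> tau t = sg t) -> turns E tau = turns E sg.
Proof.
move=> st; rewrite /turns; congr xget; apply/seteqP; split => r /= [th [cth thE] ->];
  by exists th => //; split => // t t01; rewrite -thE// st.
Qed.

Definition circle_valued X E := econt X E /\ forall p, X p -> (E p).1 ^+ 2 + (E p).2 ^+ 2 = 1.

Lemma turns_cst E sg (x : V) : (E x).1 ^+ 2 + (E x).2 ^+ 2 = 1 ->
  (forall t, t \in `[0, 1] -> sg t = x) -> turns E sg = 0.
Proof.
move=> /ei_ex[r rE] sgx; rewrite (@turnsE _ _ (fun=> r)) ?subrr//.
by split=> [|t t01]; [exact: econt_cst|rewrite sgx].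
Qed.

Lemma square_path_lift E (T : R * R -> V) (v : R * R -> R) (p : R -> R * R) :
  econt (@square R) v -> (forall x, square x -> E (T x) = ei (v x)) ->
  econt (`[0, 1]%classic : set R) p -> (forall t, t \in `[0, 1] -> square (p t)) ->
  turns E (T \o p) = v (p 1) - v (p 0).
Proof.
move=> cv vE cp pQ; rewrite (@turnsE _ _ (v \o p))//; split.
  by apply: (econt_comp (B := @square R)).
by move=> t t01 /=; rewrite vE//; exact: pQ.
Qed.

Lemma econt_id01 : econt (`[0, 1]%classic : set R) (fun t : R => t).
Proof. by apply: continuous_econt => t; exact: cvg_id. Qed.

(** Pulled back to a square, the map to the circle lifts, and the total change of the lift around
    the boundary of the square is zero. *)
Lemma turns_triangle X E T : circle_valued X E -> simplex2 X T ->
  turns E (fun t => T (1 - t, t)) - turns E (fun t => T (0, t)) + turns E (fun t => T (t, 0)) = 0.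
Proof.
move=> [cE E1] [/econtP cT TX].
(* The side x_1 = 0 is crushed to the vertex (0, 0), while the other three sides parametrise the
   three edges. *)
pose q (x : R * R) : R * R := (x.1 * (1 - x.2), x.1 * x.2).
have qT x : square x -> triangle (q x).
  move=> [/=]; rewrite !in_itv/= /triangle/= => /andP[h1 h2] /andP[h3 h4].
  by split; rewrite ?mulr_ge0 ?subr_ge0// -mulrDr subrK mulr1.
have cq : econt (@square R) q.
  apply: pair_econt; apply: econtM.
  - by apply: continuous_econt => x; exact: cvg_fst.
  - rewrite (_ : (fun _ => _) = fun x : R * R => -1 * x.2 + 1); last first.
      by apply/funext => x; rewrite mulN1r addrC.
    by apply: econt_scale_add; [apply: continuous_econt => x; exact: cvg_snd|exact: econt_cst].
  - by apply: continuous_econt => x; exact: cvg_fst.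
  - by apply: continuous_econt => x; exact: cvg_snd.
have TqX x : square x -> X (T (q x)) by move=> /qT qx; apply: TX; exists (q x).
have [||v cv vE] := @lift_square _ (E \o (T \o q)).
- apply: (econt_comp (B := X)) => //; exact: (econt_comp (B := @triangle R)).
- by move=> x /TqX; exact: E1.
have lift p : econt (`[0, 1]%classic : set R) p -> (forall t, t \in `[0, 1] -> square (p t)) ->
  turns E ((T \o q) \o p) = v (p 1) - v (p 0) by exact: square_path_lift.
have sq (t u : R) : t \in `[0, 1] -> u \in `[0, 1] -> square (t, u) by move=> h1 h2; split.
have e0 : (0 : R) \in `[0, 1] by rewrite in_itv/= lexx ler01.
have e1 : (1 : R) \in `[0, 1] by rewrite in_itv/= lexx ler01.
have c01 := econt_id01.
have cc (x : R) : econt (`[0, 1]%classic : set R) (fun _ : R => x) by exact: econt_cst.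
have -> : (fun t => T (1 - t, t)) = (T \o q) \o (fun t => (1, t)).
  by apply/funext => t; rewrite /= /q/= !mul1r.
have -> : (fun t => T (0, t)) = (T \o q) \o (fun t => (t, 1)).
  by apply/funext => t; rewrite /= /q/= subrr mulr0 mulr1.
have -> : (fun t => T (t, 0)) = (T \o q) \o (fun t => (t, 0)).
  by apply/funext => t; rewrite /= /q/= subr0 mulr0 mulr1.
rewrite (lift (fun t => (1, t)) (pair_econt (cc 1) c01) (fun t t01 => sq _ _ e1 t01)).
rewrite (lift (fun t => (t, 1)) (pair_econt c01 (cc 1)) (fun t t01 => sq _ _ t01 e1)).
rewrite (lift (fun t => (t, 0)) (pair_econt c01 (cc 0)) (fun t t01 => sq _ _ t01 e0)).
have z0 : v (0, 0) = v (0, 1).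
  have := lift (fun t => (0, t)) (pair_econt (cc 0) c01) (fun t t01 => sq _ _ e0 t01).
  rewrite (@turns_cst _ _ (T (0, 0))).
  - by move/esym/eqP; rewrite subr_eq0 => /eqP.
  - by apply: E1; have := TqX _ (sq _ _ e0 e0); rewrite /q/= !mul0r.
  - by move=> t t01 /=; rewrite /q/= !mul0r.
by rewrite z0; ring.
Qed.

(** The homotopy lifts to the line; it is constant on three sides of the square, so the lift does
    not change along the fourth either. *)
Lemma turns_null_homotopic X E x0 p : circle_valued X E -> X x0 ->
  loop_homotopic X x0 p (cst x0) -> turns E p = 0.
Proof.
move=> [cE E1] Xx0 [H [/econtP cH HX Hp]].
have HX' x : square x -> X (H x) by move=> Qx; apply: HX; exists x.
have [||v cv vE] := @lift_square _ (E \o H).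
- exact: (econt_comp (B := X)).
- by move=> x /HX'; exact: E1.
have sq (t u : R) : t \in `[0, 1] -> u \in `[0, 1] -> square (t, u) by move=> h1 h2; split.
have e0 : (0 : R) \in `[0, 1] by rewrite in_itv/= lexx ler01.
have e1 : (1 : R) \in `[0, 1] by rewrite in_itv/= lexx ler01.
have c01 := econt_id01.
have cc (x : R) : econt (`[0, 1]%classic : set R) (fun _ : R => x) by exact: econt_cst.
have lift q : econt (`[0, 1]%classic : set R) q -> (forall t, t \in `[0, 1] -> square (q t)) ->
  turns E (H \o q) = v (q 1) - v (q 0) by exact: square_path_lift.
have l1 := lift (fun t => (0, t)) (pair_econt (cc 0) c01) (fun t t01 => sq _ _ e0 t01).
have l2 := lift (fun t => (1, t)) (pair_econt (cc 1) c01) (fun t t01 => sq _ _ e1 t01).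
have l3 := lift (fun t => (t, 0)) (pair_econt c01 (cc 0)) (fun t t01 => sq _ _ t01 e0).
have l4 := lift (fun t => (t, 1)) (pair_econt c01 (cc 1)) (fun t t01 => sq _ _ t01 e1).
have z := E1 _ Xx0.
have -> : turns E p = turns E (H \o (fun t => (0, t))).
  by apply: turns_ext => t t01 /=; have [-> _ _ _] := Hp t t01.
rewrite (turns_cst z) in l2; last by move=> t t01 /=; have [_ -> _ _] := Hp t t01.
rewrite (turns_cst z) in l3; last by move=> t t01 /=; have [_ _ -> _] := Hp t t01.
rewrite (turns_cst z) in l4; last by move=> t t01 /=; have [_ _ _ ->] := Hp t t01.
by rewrite l1; move: l2 l3 l4 => /=; lra.
Qed.

(** A canonical representative: paths that agree on [0, 1] become equal functions, so simplices can
    be compared by equality. *)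
Definition restrict01 sg : R -> V := fun t => if t \in `[0, 1] then sg t else 0.

Lemma chain1_restrict01 sg tau : chain1 sg (restrict01 tau) = (restrict01 sg == restrict01 tau)%:R.
Proof.
rewrite /chain1; congr ((nat_of_bool _)%:R); apply/asboolP/eqP => [h|h t t01].
  by apply/funext => t; rewrite /restrict01; case: ifPn => // t01; rewrite -h// /restrict01 t01.
by have := congr1 (fun g => g t) h; rewrite /restrict01 t01.
Qed.

Lemma mulrz_fct (T : Type) (f : T -> int) (z : int) x : (f *~ z) x = f x *~ z.
Proof.
have nat_case m : (f *+ m) x = f x *+ m.
  by elim: m => [|m IH]; rewrite ?mulr0n// !mulrS -IH.
by case: z => m; rewrite /intmul ?nat_case// -nat_case.
Qed.

(* So functionals of paths on [0, 1] extend linearly to singular chains. *)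
Lemma chain1_free (D : (R -> V) -> R) (s : seq (int * (R -> V))) :
  (forall sg tau, (forall t, t \in `[0, 1] -> tau t = sg t) -> D tau = D sg) ->
  \sum_(p <- s) chain1 p.2 *~ p.1 = 0 -> \sum_(p <- s) p.1%:~R * D p.2 = 0.
Proof.
move=> Dext s0.
have Dr sg : D (restrict01 sg) = D sg by apply: Dext => t t01; rewrite /restrict01 t01.
pose U := undup [seq restrict01 p.2 | p <- s].
(* Evaluating the chain at a representative shows that the coefficients of the simplices in its
   class sum to zero. *)
have ev f : f \in U -> \sum_(p <- s) (restrict01 p.2 == f)%:R * p.1 = 0.
  rewrite mem_undup => /mapP[q _ ->].
  have := congr1 (fun g => g (restrict01 q.2)) s0; rewrite fct_sumE => e.
  rewrite -[RHS]e; apply: eq_bigr => p _; rewrite mulrz_fct chain1_restrict01.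
  by rewrite -mulrzl mulrC intz.
transitivity (\sum_(p <- s) \sum_(f <- U) ((restrict01 p.2 == f)%:R * p.1)%:~R * D f).
  rewrite !big_seq; apply: eq_bigr => p ps.
  have pU : restrict01 p.2 \in U by rewrite mem_undup; apply/mapP; exists p.
  rewrite (bigD1_seq (restrict01 p.2))//= ?undup_uniq// eqxx mul1r Dr big1 ?addr0// => f.
  by rewrite eq_sym => /negPf ->; rewrite mul0r mul0r.
rewrite exchange_big/= big_seq big1// => f fU.
by rewrite -mulr_suml -(raddf_sum (intmul 1)) ev// mul0r.
Qed.

(** The identity of chains that expresses [p] by the generators passes to [turns E] by linearity,
    and boundaries of 2-simplices contribute zero. The coefficients [y] come from homology alone, so
    they serve every [E] at once. *)
Lemma turns_homologous X m (c : 'I_m -> R -> V) p : generate_H1 X c ->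
  simplex1 X p -> p 0 = p 1 -> exists y : 'I_m -> int,
  forall E, circle_valued X E -> turns E p = \sum_j (y j)%:~R * turns E (c j).
Proof.
move=> gen sp p01.
have [|| y [M [u [T [sT eqn]]]]] := gen 1%N (fun=> 1) (fun=> p).
- by [].
- by rewrite big_ord1 /boundary1 p01 subrr mul0rz.
exists y => E cE; rewrite big_ord1 mulr1z in eqn.
(* The homology relation with all terms on one side; the edges of the 2-simplices carry the signs of
   the negated boundary. *)
pose s : seq (int * (R -> V)) := (1, p) :: [seq (- y j, c j) | j <- index_enum 'I_m]
  ++ flatten [seq [:: (- u l, fun t => T l (1 - t, t)); (u l, fun t => T l (0, t));
                      (- u l, fun t => T l (t, 0))] | l <- index_enum 'I_M].
have s0 : \sum_(q <- s) chain1 q.2 *~ q.1 = 0.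
  rewrite big_cons big_cat big_map big_flatten big_map/= mulr1z addrA.
  under eq_bigr do rewrite mulrNz.
  rewrite sumrN eqn -big_split/= big1// => l _.
  rewrite !big_cons big_nil/= addr0 /boundary2 !mulrzDl !mulrNz ?mulNrz.
  set A := chain1 _ *~ _; set B := chain1 _ *~ _; set C := chain1 _ *~ _.
  by rewrite addrCA; apply/eqP; rewrite !addrA; apply/eqP; ring.
have := chain1_free (turns_ext E) s0.
rewrite big_cons big_cat big_map big_flatten big_map/= mul1r addrA.
rewrite [X in _ + X = 0]big1 ?addr0; last first.
  move=> l _; rewrite !big_cons big_nil/= addr0 !intrN.
  have := turns_triangle cE (sT l) => t0.
  rewrite [LHS](_ : _ = - (u l)%:~R * (turns E (fun t => T l (1 - t, t)) -
    turns E (fun t => T l (0, t)) + turns E (fun t => T l (t, 0)))); last by ring.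
  by rewrite t0 mulr0.
under eq_bigr do rewrite intrN mulNr.
by rewrite sumrN => /eqP; rewrite subr_eq0 => /eqP.
Qed.

End turns.

Section invariance.
Context {R : realType} {n : nat}.
Local Notation V := 'rV[R]_n.

Lemma collapse_circle_valued k (h : 'I_k.+1 -> R -> V) X i : triangulation h X ->
  circle_valued X (collapse h i).
Proof.
move=> tri; split; first exact: collapse_econt tri i.
by move=> p _; exact: collapse_norm.
Qed.

Lemma loop_formula_turns k (h : 'I_k.+1 -> R -> V) X (c : R -> V) a b K
    (psi : V -> R) (s : 'I_n) : triangulation h X -> a < b -> 0 < K -> klip K c a b ->
  (forall t, t \in `[a, b] -> X (c t)) -> continuous psi -> c a = c b ->
  dint (fun t => c t 0 s) (psi \o c) a b =
  \sum_i turns (collapse h i) (fun t => c (a + (b - a) * t)) / (2 * pi)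
    * dint (fun t => h i t 0 s) (psi \o h i) 0 1.
Proof.
move=> tri ab K0 cK cX cpsi cab.
have ccont : econt (`[a, b]%classic : set R) c by exact: klip_econt cK.
have /choice[v vP] : forall i, exists v, econt (`[a, b]%classic : set R) v /\
    forall t, t \in `[a, b] -> collapse h i (c t) = ei (v t).
  move=> i; have [cE E1] := collapse_circle_valued i tri.
  have [|t tab|v cv vE] := @lift_itv _ (collapse h i \o c) a b ab.
  - exact: (econt_comp (B := X)).
  - exact/E1/cX.
  - by exists v.
rewrite (loop_formula tri ab K0 cK cX (fun i => (vP i).1) (fun i => (vP i).2) s cpsi cab).
apply: eq_bigr => i _; congr (_ / _ * _).
have ba0 : 0 <= b - a by rewrite subr_ge0 ltW.
have in_ab t : t \in `[0, 1] -> a + (b - a) * t \in `[a, b].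
  by rewrite !in_itv/= => /andP[h1 h2]; apply/andP; split; nra.
rewrite (@turnsE _ _ _ _ (fun t => v i (a + (b - a) * t))).
  by rewrite mulr0 addr0 mulr1 (addrC a) subrK.
split; last by move=> t t01; apply: (vP i).2; exact: in_ab.
apply: (econt_comp (B := `[a, b]%classic) (g := v i)) (vP i).1 => //.
rewrite (_ : (fun _ => _) = fun t => (b - a) * t + a); last by apply/funext => t; rewrite addrC.
by apply: econt_scale_add; [exact: econt_id01|exact: econt_cst].
Qed.

End invariance.

(** * Integrals along the path and along the generators *)

Section curve_integrals.
Context {R : realType} {n : nat}.
Local Notation V := 'rV[R]_n.
Variables (a b K : R) (F : R -> V) (G : set V) (k : nat) (g : 'I_k.+1 -> R -> V).
Hypotheses (ab : a < b) (K0 : 0 < K) (FK : klip K F a b) (Fab : F a = F b).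
Hypothesis FG : forall t, t \in `[a, b] -> G (F t).
Hypothesis triG : triangulation g G.

Let F01 t := F (a + (b - a) * t).

Let in_ab t : t \in `[0, 1] -> a + (b - a) * t \in `[a, b].
Proof.
have ba0 : 0 <= b - a by rewrite subr_ge0 ltW.
by rewrite !in_itv/= => /andP[h1 h2]; apply/andP; split; nra.
Qed.

Let F01_cont : econt (`[0, 1]%classic : set R) F01.
Proof.
have ccont : econt (`[a, b]%classic : set R) F by exact: klip_econt FK.
apply: (econt_comp (B := `[a, b]%classic) (g := F)) ccont => [t t01|]; first exact: in_ab.
rewrite (_ : (fun _ => _) = fun t => (b - a) * t + a); last by apply/funext => t; rewrite addrC.
by apply: econt_scale_add; [exact: econt_id01|exact: econt_cst].
Qed.

Let F01_G : F01 @` `[0, 1] `<=` G.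
Proof. by move=> _ [t t01 <-]; apply: FG; exact: in_ab. Qed.

Let F0 : F01 0 = F a. Proof. by rewrite /F01 mulr0 addr0. Qed.
Let F1 : F01 1 = F b. Proof. by rewrite /F01 mulr1 addrC subrK. Qed.

(** The loop formula in [G] writes the integral through turns of the path, which are combinations of
    turns of the generators. Read backwards it gives a combination of integrals over the generators,
    and the loop formula for the triangulation [h] rewrites these through its own arcs. Neither the
    integers [y] nor the turns involve [psi] or [s]. *)
Lemma homologous_integral m (c : 'I_m -> R -> V) l (h : 'I_l.+1 -> R -> V) :
  generate_H1 G c -> (forall j, simple_closed_lipschitz (c j)) ->
  (forall j, c j @` `[0, 1] `<=` G) -> triangulation h (\bigcup_j (c j @` `[0, 1])) ->
  exists M : 'I_l.+1 -> R, forall (psi : V -> R) s, continuous psi ->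
    dint (fun t => F t 0 s) (psi \o F) a b =
    \sum_i M i * dint (fun t => h i t 0 s) (psi \o h i) 0 1.
Proof.
move=> gen csl cG trih.
have [||y yP] := turns_homologous gen (p := F01).
- by split; [exact/econtP|].
- by rewrite F0 F1.
exists (fun i => \sum_j (y j)%:~R * (turns (collapse h i) (c j) / (2 * pi))) => psi s cpsi.
rewrite (loop_formula_turns s triG ab K0 FK FG cpsi Fab).
under eq_bigr do rewrite (yP _ (collapse_circle_valued _ triG)).
have cjE k' (h' : 'I_k'.+1 -> R -> V) X j : triangulation h' X ->
    (forall t, t \in `[0, 1] -> X (c j t)) ->
    dint (fun t => c j t 0 s) (psi \o c j) 0 1 = \sum_i turns (collapse h' i) (c j) / (2 * pi)
      * dint (fun t => h' i t 0 s) (psi \o h' i) 0 1.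
  move=> tri cX; have [/lipschitz_klip[Kc Kc0 cK] c01 _] := csl j.
  rewrite (loop_formula_turns s tri (@ltr01 R) Kc0 cK cX cpsi c01).
  apply: eq_bigr => i _; congr (_ / _ * _); apply: turns_ext => t _.
  by rewrite subr0 mul1r add0r.
transitivity (\sum_j (y j)%:~R * dint (fun t => c j t 0 s) (psi \o c j) 0 1).
  under [RHS]eq_bigr => j _.
    rewrite (cjE _ g G j triG) ?mulr_sumr; last by move=> t t01; apply: (cG j); exists t.
    over.
  rewrite exchange_big/=; apply: eq_bigr => i _.
  by rewrite !mulr_suml; apply: eq_bigr => j _; rewrite !mulrA.
under eq_bigr => j _.
  rewrite (cjE _ h _ j trih) ?mulr_sumr; last by move=> t t01; exists j => //; exists t.
  over.
rewrite exchange_big/=; apply: eq_bigr => i _.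
by rewrite !mulr_suml; apply: eq_bigr => j _; rewrite !mulrA.
Qed.

(** The path contracts in [G], so all its turns in the loop formula are zero. *)
Lemma simply_connected_integral (psi : V -> R) s : pi1_trivial G -> continuous psi ->
  dint (fun t => F t 0 s) (psi \o F) a b = 0.
Proof.
move=> G1 cpsi; rewrite (loop_formula_turns s triG ab K0 FK FG cpsi Fab).
have aab : a \in `[a, b] by rewrite in_itv/= lexx ltW.
rewrite big1// => i _.
have loop : loop_at G (F a) F01 by split; [exact/econtP| |exact: F0|rewrite F1 Fab].
rewrite (turns_null_homotopic (collapse_circle_valued i triG) (FG aab) (G1 _ _ (FG aab) loop)).
by rewrite !mul0r.
Qed.

End curve_integrals.

(** * Paths covering Eulerian trails *)

Section trail.
Context {R : realType} {n : nat}.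
Local Notation V := 'rV[R]_n.

Lemma absz_shift (k : int) (N : nat) : `|k| < N%:Z ->
  (absz (k + N%:Z)%R < N.*2.+1)%N /\ (absz (k + N%:Z)%R)%:Z = k + N%:Z.
Proof. lia. Qed.

Lemma dist_nat_ge1 (i j : nat) : i != j -> 1 <= `|i%:Z - j%:Z|.
Proof. lia. Qed.

Lemma avoid_seq (s : seq R) (lo hi : R) : lo < hi -> exists al be,
  [/\ lo < al, al < be, be < hi & forall x, x \in s -> ~~ (al <= x <= be)].
Proof.
move=> lh; elim: s => [|x s [al [be [h1 h2 h3 hs]]]].
  exists (lo + (hi - lo) / 3), (lo + (hi - lo) / 2); split => //; lra.
have [xm|mx] := ltP x ((al + be) / 2).
  exists ((al + be) / 2), be; split => //; try lra.
  move=> y; rewrite inE => /predU1P[->|/hs]; first by rewrite leNgt xm.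
  by apply: contra => /andP[k1 k2]; rewrite k2 andbT; lra.
exists al, ((3 * al + be) / 4); split => //; try lra.
move=> y; rewrite inE => /predU1P[->|/hs].
  by apply/negP => /andP[_ k]; lra.
by apply: contra => /andP[k1 k2]; rewrite k1/=; lra.
Qed.

Lemma ei_inj_itv (x y lo : R) : ei x = ei y -> lo < x < lo + 2 * pi ->
  lo < y < lo + 2 * pi -> x = y.
Proof.
move=> /ei_eqP[k ->] /andP[h1 h2] /andP[h3 h4].
suff -> : k = 0 by rewrite mul0r addr0.
apply: (@eq_int_lt1 R); rewrite subr0 ltr_norml.
have p0 := @pi2_gt0 R; apply/andP; split; rewrite -(ltr_pM2r p0); lra.
Qed.

(** An open interval of length at most 2 pi contains at most one angle of each point, so only
    finitely many angles have to be avoided. *)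
Lemma avoid_points (ps : seq (R * R)) (lo hi : R) : lo < hi -> hi <= lo + 2 * pi ->
  exists al be, [/\ lo < al, al < be, be < hi &
    forall y, al <= y <= be -> ei y \notin ps].
Proof.
move=> lh hl.
pose sel p := xget 0 [set y | lo < y < hi /\ ei y = p].
have [al [be [h1 h2 h3 hs]]] := avoid_seq [seq sel p | p <- ps] lh.
exists al, be; split => // y yab; apply/negP => yps.
have := hs (sel (ei y)) (map_f _ yps); apply/negP; rewrite negbK.
suff -> : sel (ei y) = y by [].
have yl : lo < y < hi by case/andP: yab => k1 k2; apply/andP; split; lra.
rewrite /sel; case: xgetP => [z _ [zl ezy]|/(_ y)]; last by case.
by apply: (ei_inj_itv (lo := lo) ezy);
  [case/andP: zl => k1 k2|case/andP: yl => k1 k2]; apply/andP; split; lra.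
Qed.

Lemma clampL (al be y : R) : al <= be -> y <= al -> clamp al be y = al.
Proof.
by move=> h1 h2; rewrite /clamp (min_idPr (le_trans h2 h1)) (max_idPl h2).
Qed.

Lemma clampR (al be y : R) : al <= be -> be <= y -> clamp al be y = be.
Proof. by move=> h1 h2; rewrite /clamp (min_idPl h2) (max_idPr h1). Qed.

(** A primitive of (y - y1)(y2 - y). Its increment from [y1] to [y2] is (y2 - y1)^3 / 6, which is
    nonzero as soon as y1 and y2 differ. *)
Definition cubic (y1 y2 y : R) : R :=
  - (y ^+ 3 / 3) + (y1 + y2) * y ^+ 2 / 2 - y1 * y2 * y.

Lemma cubic_primitive (y1 y2 x : R) e : 0 < e -> exists2 d, 0 < d & forall x',
  `|x' - x| < d -> `|cubic y1 y2 x' - cubic y1 y2 x - (x - y1) * (y2 - x) * (x' - x)|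
    <= e * `|x' - x|.
Proof.
move=> e0; pose c := `|x| + 1 + `|y1 + y2|.
have c0 : 0 < c by rewrite /c -addrA ltr_wpDl// ltr_pwDl.
exists (Num.min 1 (e / c)); first by rewrite lt_min ltr01 divr_gt0.
move=> x'; rewrite lt_min => /andP[d1 d2].
have -> : cubic y1 y2 x' - cubic y1 y2 x - (x - y1) * (y2 - x) * (x' - x) =
    (x' - x) * (- x - (x' - x) / 3 + (y1 + y2) / 2) * (x' - x) by rewrite /cubic; field.
rewrite normrM ler_wpM2r// normrM.
rewrite ltr_pdivlMr// in d2; apply: le_trans (ltW d2); rewrite ler_wpM2l//.
apply: le_trans (ler_normD _ _) _; apply: lerD; last first.
  by rewrite normrM [X in _ * X]ger0_norm ?invr_ge0// ler_piMr// invf_le1 ?ler1n.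
apply: le_trans (ler_normB _ _) _; rewrite normrN lerD2l normrM.
by rewrite [X in _ * X]ger0_norm ?invr_ge0//; lra.
Qed.

Lemma tietze_compact (A : set V) (f : V -> R) : compact A -> econt A f ->
  exists2 psi : V -> R, continuous psi & forall p, A p -> psi p = f p.
Proof.
move=> cA /econtP cf.
have [M M0 Mf] : exists2 M, 0 < M & forall p, A p -> `|f p| <= M.
  have := compact_bounded (continuous_compact cf cA).
  rewrite /bounded_set /bounded_near => bd.
  have [M [h1 h2]] := @filter_ex _ _ (proper_pinfty_nbhs) _
    (filterI bd (nbhs_pinfty_gt (num_real (0:R)))).
  by exists M => // p Ap; apply: h1; exists p.
have clA : closed A by apply: compact_closed => //; exact: norm_hausdorff.
have [psi [h1 h2 _]] := continuous_bounded_extension (@pseudometric_normal R V) clA M0 cf Mf.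
by exists psi => // p Ap; rewrite h1// inE.
Qed.

Section trail_closed.
Variables (a b K : R) (F : R -> V) (th : R -> R) (I : set (R * R)) (gam : R * R -> V)
  (Es : seq (R * R)).
Hypotheses (ab : a < b) (K0 : 0 < K) (FK : klip K F a b).
Hypothesis cth : econt (`[a, b]%classic : set R) th.
Hypothesis thI : forall t, t \in `[a, b] -> I (ei (th t)).
Hypothesis FE : forall t, t \in `[a, b] -> F t = gam (ei (th t)).
Hypothesis cgam : econt I gam.
Hypothesis gam_inj : forall x y, I x -> I y -> x \notin Es -> y \notin Es ->
  gam x = gam y -> x = y.
Hypothesis zero : forall (psi : V -> R) s, continuous psi ->
  dint (fun t => F t 0 s) (psi \o F) a b = 0.

(** Otherwise [th] crosses a short interval [al, be] on which [gam] is injective even against the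
    rest of [I]. Let [y1] and [y2] be the values of a coordinate x_s at the ends of the
    corresponding piece. The form (x_s - y1)(y2 - x_s) dx_s on that piece, zero elsewhere, is
    continuous on the image of [F] because it vanishes at both ends. Its integral is, up to sign,
    (y2 - y1)^3 / 6 times the number of translates of [al, be] between [th a] and [th b], all
    crossed in the same direction. *)
Lemma trail_closed : th a = th b.
Proof.
have aab : a \in `[a, b] by rewrite in_itv/= lexx ltW.
have bab : b \in `[a, b] by rewrite in_itv/= lexx ltW.
have p0 := @pi2_gt0 R.
apply: contrapT => /eqP nab.
pose lo := Num.min (th a) (th b). pose hi := Num.max (th a) (th b).
have lh : lo < hi by rewrite /lo /hi lt_max !gt_min !ltxx/= orbF orbC -neq_lt.
(* For an exceptional point, the point outside [Es] with the same image, if any; injectivity makes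
   it unique. Avoiding it keeps the piece away from the images of [Es]. *)
pose sel e := xget (0, 0) [set x | I x /\ x \notin Es /\ gam x = gam e].
(* Including [ei hi] ensures that [hi] lies in no translate of [al, be]. *)
pose ps := ei hi :: Es ++ [seq sel e | e <- Es].
have lh' : lo < Num.min hi (lo + 2 * pi) by rewrite lt_min lh ltrDl.
have lh2 : Num.min hi (lo + 2 * pi) <= lo + 2 * pi by rewrite ge_min lexx orbT.
have [al [be [lal albe behi' hps]]] := avoid_points ps lh' lh2.
have [behi bel] : be < hi /\ be < lo + 2 * pi by move: behi'; rewrite lt_min => /andP[].
have thval y : lo <= y <= hi -> exists2 t, t \in `[a, b] & th t = y.
  move=> ylh; have [tab|tba] := leP (th a) (th b).
    have [|c [cab <- _]] := @ivt_between _ th a b a b y cth aab bab; last by exists c.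
    by move: ylh; rewrite /lo /hi (min_idPl tab) (max_idPr tab).
  have [|c [cab <- _]] := @ivt_between _ th a b b a y cth bab aab; last by exists c.
  by move: ylh; rewrite /lo /hi (min_idPr (ltW tba)) (max_idPl (ltW tba)).
have yI y : al <= y <= be -> I (ei y).
  move=> /andP[h1 h2]; have [|t tab <-] := thval y; last exact: thI.
  by apply/andP; split; lra.
have inj' x y : al <= y <= be -> I x -> gam x = gam (ei y) -> x = ei y.
  move=> yab Ix gxy; have := hps y yab; rewrite !inE !mem_cat !negb_or => /and3P[_ yE ysel].
  have [xE|xE] := boolP (x \in Es); last exact: gam_inj (yI y yab) xE yE gxy.
  exfalso; move/negP: ysel; apply; apply/mapP; exists x => //.
  rewrite /sel; case: xgetP => [z _ [Iz [zE zx]]|/(_ (ei y))].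
    by apply: gam_inj (yI y yab) Iz yE zE _; rewrite zx gxy.
  by case; split; [exact: yI|].
have alab : al <= al <= be by rewrite lexx ltW.
have beab : al <= be <= be by rewrite lexx ltW.
(* Equality in all coordinates would contradict injectivity, because [al] and [be] are less than 2
   pi apart. *)
have [s hs] : exists s, gam (ei al) 0 s != gam (ei be) 0 s.
  apply: contrapT => no; have e : gam (ei al) = gam (ei be).
    by apply/rowP => s; apply/eqP/negPn/negP => h; apply: no; exists s.
  have := inj' _ _ beab (yI _ alab) e.
  move/(ei_inj_itv (lo := lo)) => H; suff : al = be by move: albe => /[swap] ->; rewrite ltxx.
  by apply: H; apply/andP; split; lra.
set y1 := gam (ei al) 0 s in hs; set y2 := gam (ei be) 0 s in hs.
pose Gs y := gam (ei (clamp al be y)) 0 s.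
have GsL y : y <= al -> Gs y = y1 by move=> h; rewrite /Gs clampL// ltW.
have GsR y : be <= y -> Gs y = y2 by move=> h; rewrite /Gs clampR// ltW.
have Gs_mid y : al <= y <= be -> Gs y = gam (ei y) 0 s.
  by move=> h; rewrite /Gs clamp_id// in_itv.
pose w y := (Gs y - y1) * (y2 - Gs y).
have wL y : y <= al -> w y = 0 by move=> /GsL e; rewrite /w e subrr mul0r.
have wR y : be <= y -> w y = 0 by move=> /GsR e; rewrite /w e subrr mulr0.
have wout y : ~~ (al <= y <= be) -> w y = 0.
  by rewrite negb_and -!ltNge => /orP[/ltW/wL|/ltW/wR].
have cGs : econt setT Gs.
  apply: coord_econt; apply: (econt_comp (B := I) (g := gam)) => //.
    by move=> y _; apply: yI; have := clamp_itv y (ltW albe); rewrite in_itv.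
  apply: ei_econt; apply: continuous_econt; apply: (@klip_continuous _ _ 1) => // x y.
  by rewrite mul1r; apply: clamp_lip; exact: ltW.
have [lo' _ hlo'] := EVT_min (ltW ab) ((econtP _ _).2 cth).
have [hi' _ hhi'] := EVT_max (ltW ab) ((econtP _ _).2 cth).
pose M := `|th lo'| + `|th hi'| + `|al| + `|be|.
pose N := Num.bound M.
have MN : M < N%:R by apply: archi_boundP; rewrite /M !addr_ge0.
(* A shift by j - N full turns, so that the index [N] means no shift. By the choice of [N] the
   indices cover all translates of [al, be] that [th] can meet. *)
pose kap (j : nat) : R := (j%:R - N%:R) * (2 * pi).
have kapP t y (k : int) : t \in `[a, b] -> al <= y <= be -> th t = y + k%:~R * (2 * pi) ->
    exists2 j : 'I_(N.*2.+1), true & kap j = k%:~R * (2 * pi).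
  move=> tab /andP[h1 h2] tk.
  have kM : `|k%:~R| < (N%:R : R).
    apply: le_lt_trans MN.
    have : `|k%:~R * (2 * pi)| <= M.
      have := hlo' t tab; have := hhi' t tab; have := ler_norm (th hi').
      have := ler_norm (- th lo'); have := ler_norm be; have := ler_norm (- al).
      rewrite !normrN /M ler_norml.
      have := normr_ge0 (th hi'); have := normr_ge0 (th lo').
      have := normr_ge0 al; have := normr_ge0 be; rewrite tk; lra.
    apply: le_trans; rewrite normrM ler_peMr// ger0_norm ?ltW//.
    by have := @pi_ge2 R; lra.
  have {}kM : `|k| < N%:Z by rewrite -(@ltr_int R) intr_norm.
  have [kj kE] := absz_shift kM.
  exists (Ordinal kj) => //; rewrite /kap/=; congr (_ * _).
  have -> : (absz (k + N%:Z))%:R = (k + N%:Z)%:~R :> R.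
    by rewrite -kE.
  by rewrite intrD addrK.
have kap_far (i j : nat) : i != j -> 2 * pi <= `|kap i - kap j|.
  move=> ij; rewrite /kap -mulrBl opprB addrA subrK normrM (gtr0_norm p0).
  apply: ler_peMl; first exact: ltW.
  have -> : (i%:R - j%:R : R) = (i%:Z - j%:Z)%:~R by rewrite intrB.
  by rewrite -intr_norm; have := dist_nat_ge1 ij; rewrite -(ler_int R).
have kap_uniq y (i j : nat) : i != j -> al <= y - kap i <= be -> ~~ (al <= y - kap j <= be).
  move=> /kap_far ij /andP[h1 h2]; apply/negP => /andP[h3 h4].
  have : `|kap i - kap j| <= be - al by rewrite ler_norml; apply/andP; split; lra.
  lra.
pose g t := \sum_(j < N.*2.+1) w (th t - kap j).
have cw : econt setT w.
  have -> : w = fun y => (1 * Gs y + - y1) * (-1 * Gs y + y2).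
    by apply/funext => y; rewrite /w; ring.
  by apply: econtM; apply: econt_scale_add => //; exact: econt_cst.
have cg : econt (`[a, b]%classic : set R) g.
  apply: (@econt_sum _ _ _ _ (fun j t => w (th t - kap j))) => j _.
  apply: (econt_comp (B := setT) (g := w)) => //.
  have -> : (fun t => th t - kap j) = fun t => 1 * th t + - kap j.
    by apply/funext => t; rewrite mul1r.
  by apply: econt_scale_add => //; exact: econt_cst.
(* The coefficient of the test form as a function on the curve; on the image of [F] it is the
   quotient of the continuous function [g], hence continuous. *)
pose psi0 (p : V) := if `[< exists2 y, al <= y <= be & p = gam (ei y) >]
  then (p 0 s - y1) * (y2 - p 0 s) else 0.
have gE t : t \in `[a, b] -> g t = psi0 (F t).
  move=> tab; rewrite /psi0; case: ifPn => /asboolP h.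
    have [y yab Fy] := h.
    have /ei_eqP[k tk] : ei (th t) = ei y by apply: inj' => //; [exact: thI|rewrite -FE].
    have [j _ jk] := kapP t y k tab yab tk.
    have ty : th t - kap j = y by rewrite jk tk addrK.
    rewrite /g (bigD1 j)//= big1 ?addr0 => [|i ij]; last first.
      by apply: wout; apply: (@kap_uniq _ j); rewrite ?ty// eq_sym.
    by rewrite ty /w Gs_mid// Fy.
  rewrite /g big1// => j _; apply: wout; apply/negP => yab; apply: h.
  exists (th t - kap j) => //; rewrite FE//; congr gam.
  have -> : th t - kap j = th t + (N%:Z - j%:Z)%:~R * (2 * pi).
    by rewrite /kap intrB; ring.
  by rewrite ei_shift.
have [||psi cpsi psiE] := @tietze_compact (F @` `[a, b]) psi0.
- apply: continuous_compact; last exact: segment_compact.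
  by apply/econtP; exact: klip_econt FK.
- apply: (econt_quotient (@segment_compact _ _ _) (klip_econt K0 FK) cg) => t tab.
  exact: gE.
have g0 : dint (fun t => F t 0 s) g a b = 0.
  rewrite -(zero s cpsi); apply: dint_ext => t tab /=.
  by rewrite psiE ?gE//; exists t.
(* A primitive of [g] with respect to the coordinate [s] of [F]; the clamp in [Gs] freezes each term
   outside its translate. *)
pose Y t := \sum_(j < N.*2.+1) cubic y1 y2 (Gs (th t - kap j)).
have FGs (j : nat) t : t \in `[a, b] -> al <= th t - kap j <= be -> Gs (th t - kap j) = F t 0 s.
  move=> tab yab; rewrite Gs_mid// FE//; congr (gam _ 0 s).
  have -> : th t - kap j = th t + (N%:Z - j%:Z)%:~R * (2 * pi).
    by rewrite /kap intrB; ring.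
  by rewrite ei_shift.
have Yloc (j : nat) t e : t \in `[a, b] -> 0 < e -> exists d, 0 < d /\
    forall t', t' \in `[a, b] -> `|t' - t| < d ->
    `|cubic y1 y2 (Gs (th t' - kap j)) - cubic y1 y2 (Gs (th t - kap j))
      - w (th t - kap j) * (F t' 0 s - F t 0 s)| <= e * `|t' - t|.
  move=> tab e0; set y := th t - kap j.
  (* The distance from [y] to the ends of [al, be] other than [y] itself: closer than that, the
     interval can be entered or left only at [y], where [w] vanishes. *)
  pose r := Num.min (if al < y then y - al else if y < al then al - y else 1)
                    (if y < be then be - y else if be < y then y - be else 1).
  have r0 : 0 < r.
    rewrite lt_min; apply/andP; split.
      by case: ifPn => [|_]; [rewrite subr_gt0|case: ifPn => //; rewrite subr_gt0].
    by case: ifPn => [|_]; [rewrite subr_gt0|case: ifPn => //; rewrite subr_gt0].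
  have [d1 d10 h1] := cth tab r0.
  have eK : 0 < e / K by rewrite divr_gt0.
  have [d2 d20 h2] := cubic_primitive y1 y2 (F t 0 s) eK.
  exists (Num.min d1 (d2 / K)); split; first by rewrite lt_min d10 divr_gt0.
  move=> t' t'ab; rewrite lt_min ltr_pdivlMr// => /andP[/(h1 _ t'ab) k1 k2].
  have FK' : `|F t' 0 s - F t 0 s| <= K * `|t' - t| by exact: (coord_klip s FK).
  have still : Gs (th t' - kap j) = Gs y -> w y = 0 -> `|cubic y1 y2 (Gs (th t' - kap j))
      - cubic y1 y2 (Gs y) - w y * (F t' 0 s - F t 0 s)| <= e * `|t' - t|.
    by move=> -> ->; rewrite mul0r !subrr normr0 mulr_ge0// ltW.
  have k3 : `|(th t' - kap j) - y| < r by rewrite /y opprB addrA subrK.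
  move: k3; rewrite /r lt_min ltr_norml => /andP[/andP[m1 m2]].
  rewrite ltr_norml => /andP[m3 m4].
  have [yab|] := boolP (al <= y <= be); last first.
    rewrite negb_and -!ltNge => /orP[yl|yr]; apply: still.
    - by move: m2; rewrite (ltNge al y) (ltW yl)/= yl => m2; rewrite !GsL ?(ltW yl)// -(lerD2r (- y)) ltW.
    - by rewrite wL// ltW.
    - by move: m3; rewrite (ltNge y be) (ltW yr)/= yr => m3; rewrite !GsR ?(ltW yr)// -(lerD2r (- y)) ltW// -opprB.
    - by rewrite wR// ltW.
  have [y'ab|] := boolP (al <= th t' - kap j <= be).
    rewrite /w !FGs//.
    apply: le_trans (h2 _ _) _; first by apply: le_lt_trans FK' _; rewrite mulrC.
    by rewrite mulrAC ler_pdivrMr// -mulrA ler_wpM2l ?(ltW e0)// mulrC.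
  case/andP: yab => yal ybe; rewrite negb_and -!ltNge => /orP[yl|yr]; apply: still.
  - have -> : y = al; last by rewrite !GsL// ltW.
    apply/eqP; rewrite eq_le yal andbT leNgt; apply/negP => aly.
    by move: m1; rewrite aly opprB ltrD2r ltNge (ltW yl).
  - apply: wL; rewrite leNgt; apply/negP => aly.
    by move: m1; rewrite aly opprB ltrD2r ltNge (ltW yl).
  - have -> : y = be; last by rewrite !GsR// ltW.
    apply/eqP; rewrite eq_le ybe/= leNgt; apply/negP => aly.
    by move: m4; rewrite aly ltrD2r ltNge (ltW yr).
  - apply: wR; rewrite leNgt; apply/negP => aly.
    by move: m4; rewrite aly ltrD2r ltNge (ltW yr).
have Yab : Y b - Y a = 0.
  apply: (@eq0_le_eps_mul _ _ (b - a)) => e e0.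
  rewrite -normrN -[X in `|X|]add0r -{1}g0.
  apply: (dint_approx ab K0 (coord_klip s FK) cg) => t tab.
  have e1 : 0 < e / N.*2.+1%:R by rewrite divr_gt0.
  have /choice[d dP] := fun j : 'I_(N.*2.+1) => Yloc j t _ tab e1.
  have [r r0 rd] := ex_pos_lower_bound (fun j => (dP j).1).
  exists r => // t' t'ab tt'.
  rewrite /Y /g mulr_suml -!sumrB; apply: le_trans (ler_norm_sum _ _ _) _.
  have -> : e * `|t' - t| = \sum_(j < N.*2.+1) e / N.*2.+1%:R * `|t' - t|.
    rewrite sumr_const card_ord -[RHS]mulr_natr; set c := N.*2.+1%:R.
    have c0 : c != 0 by rewrite pnatr_eq0.
    by field.
  by apply: ler_sum => j _; have [_ H] := dP j; apply: H => //; exact: lt_le_trans (rd j).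
have hiout (j : nat) : ~~ (al <= hi - kap j <= be).
  apply/negP => /hps; rewrite inE negb_or => /andP[/eqP h _]; apply: h.
  have -> : hi - kap j = hi + (N%:Z - j%:Z)%:~R * (2 * pi) by rewrite /kap intrB; ring.
  by rewrite ei_shift.
have loout (j : nat) : ~~ (al <= lo - kap j <= be).
  apply/negP => /andP[h1 h2].
  have k0 : kap j < 0 by lra.
  have jN : (j < N)%N.
    by move: k0; rewrite /kap pmulr_llt0// subr_lt0 ltr_nat.
  have : kap j <= - (2 * pi).
    rewrite /kap -[leRHS]mulN1r ler_wpM2r ?(ltW p0)// lerBlDr addrC lerBrDr.
    by rewrite natr1 ler_nat.
  lra.
pose Ylo := \sum_(j < N.*2.+1) cubic y1 y2 (Gs (lo - kap j)).
pose Yhi := \sum_(j < N.*2.+1) cubic y1 y2 (Gs (hi - kap j)).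
have Ylh : Yhi - Ylo = 0.
  move: Yab; rewrite /Y /Yhi /Ylo /lo /hi; case: (leP (th a) (th b)) => _ //.
  by move/eqP; rewrite subr_eq0 => /eqP ->; rewrite subrr.
pose D := cubic y1 y2 y2 - cubic y1 y2 y1.
have D0 : D != 0.
  have -> : D = (y2 - y1) ^+ 3 / 6 by rewrite /D /cubic; field.
  by rewrite mulf_neq0 ?invr_eq0 ?pnatr_eq0// expf_neq0// subr_eq0 eq_sym.
(* Whether the j-th translate lies between [lo] and [hi]. *)
pose nu (j : nat) : nat := (lo - kap j < al) && (be < hi - kap j).
have nuE (j : nat) : cubic y1 y2 (Gs (hi - kap j)) - cubic y1 y2 (Gs (lo - kap j)) = (nu j)%:R * D.
  have := hiout j; have := loout j; rewrite !negb_and -!ltNge /nu.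
  move=> /orP[l1|l2] /orP[g1|g2].
  - by rewrite (GsL (lo - _)) ?(GsL (hi - _)) ?ltW// l1/= ltNge (ltW (lt_trans g1 albe))/= mul0r subrr.
  - by rewrite (GsL (lo - _)) ?(GsR (hi - _)) ?ltW// l1 g2/= mul1r.
  - by exfalso; lra.
  - by rewrite (GsR (lo - _)) ?(GsR (hi - _)) ?ltW// ltNge (ltW (lt_trans albe l2))/= mul0r subrr.
have sumE : Yhi - Ylo = (\sum_(j < N.*2.+1) nu j)%:R * D.
  by rewrite /Yhi /Ylo -sumrB natr_sum mulr_suml; apply: eq_bigr => j _; exact: nuE.
(* All crossings count with the same sign and the unshifted interval is among them, so the total
   cannot be zero. *)
move: Ylh; rewrite sumE => /eqP; rewrite mulf_eq0 (negPf D0) orbF pnatr_eq0 sum_nat_eq0.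
have NN : (N < N.*2.+1)%N by rewrite ltnS -addnn leq_addr.
move=> /forallP/(_ (Ordinal NN))/=.
by rewrite /nu /kap subrr mul0r !subr0 lal behi.
Qed.

End trail_closed.

End trail.

(** * Polynomial approximation *)

Section jackson_univariate.
Context {R : realType}.
Implicit Types (t th x : R).

Lemma cos_norm_int (m : int) t : cos (m%:~R * t) = cos ((absz m)%:R * t).
Proof.
by case: m => k //; rewrite NegzE mulrNz mulNr cosN abszN.
Qed.

Lemma sin_le_id x : 0 <= x -> sin x <= x.
Proof.
rewrite le_eqVlt => /predU1P[<-|x0]; first by rewrite sin0.
have [c _] : exists2 c, c \in `]0, x[ & sin x - sin 0 = cos c * (x - 0).
  by apply: MVT => //; apply: continuous_subspaceT; exact: continuous_sin.
by rewrite sin0 !subr0 => ->; rewrite ler_piMl ?cos_le1// ltW.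
Qed.

Lemma cos_quadratic x : 2 - 2 * cos x <= x ^+ 2.
Proof.
rewrite -cos_norm -[x ^+ 2]real_normK ?num_real//; move: `|x| (normr_ge0 x) => y y0.
have -> : cos y = cos ((y / 2) *+ 2) by congr cos; rewrite -mulr_natl; field.
rewrite cos_mulr2n.
have h : sin (y / 2) ^+ 2 <= (y / 2) ^+ 2.
  have y20 : 0 <= y / 2 by lra.
  rewrite -[X in X <= _]real_normK ?num_real// ler_pXn2r ?nnegrE//.
  have [yp|yp] := leP (y / 2) pi.
    by rewrite ger0_norm ?sin_le_id// sin_ge0_pi// y20.
  by apply: le_trans (sin_max _) _; have := @pi_ge2 R; lra.
move: h; rewrite sin2cos2 mulr2n (_ : (y / 2) ^+ 2 = y ^+ 2 / 4); last by field.
set C := cos (y / 2) ^+ 2; set D := y ^+ 2 => h; lra.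
Qed.

Variable d : nat.
Local Notation N := d.+2.
Local Notation al := (pi / N%:R : R).
Local Notation s j := (sin ((j%:R : R) * al)).
Local Notation node k := (2 * al * (k%:R : R)).

Lemma al_gt0 : 0 < al. Proof. by rewrite divr_gt0 ?pi_gt0. Qed.
Lemma alN : N%:R * al = pi. Proof. by rewrite mulrC divfK ?pnatr_eq0. Qed.

Lemma sin_al_gt0 j : (0 < j < N)%N -> 0 < s j.
Proof.
move=> /andP[j0 jN]; apply: sin_gt0_pi.
by rewrite mulr_gt0 ?al_gt0 ?ltr0n//= -[X in _ < X]alN ltr_pM2r ?al_gt0// ltr_nat.
Qed.

(** Multiplied by 2 sin(m pi / (d + 2)), which is nonzero, the sum telescopes, and the arguments at
    its two ends differ by [m] full turns. *)
Lemma sum_cos_nodes (m : nat) (ph : R) : (0 < m < N)%N ->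
  \sum_(k < N) cos (ph - m%:R * node k) = 0.
Proof.
move=> mN; have s0 := sin_al_gt0 mN.
apply: (mulfI (lt0r_neq0 s0)); apply: (mulfI (_ : 2 != 0 :> R)); first by rewrite pnatr_eq0.
rewrite !mulr0 !mulr_sumr.
pose g k := sin (ph - m%:R * al * (2 * k%:R - 1)).
rewrite (eq_bigr (fun k : 'I_N => - (g k.+1 - g k))) => [|k _].
  rewrite sumrN -(big_mkord xpredT (fun k => g k.+1 - g k)) telescope_sumr// /g mulr0 sub0r.
  rewrite (_ : ph - m%:R * al * (2 * N%:R - 1) = ph - m%:R * al * -1 - m%:R * (2 * pi)).
    have := ei_shift_nat (ph - m%:R * al * -1 - m%:R * (2 * pi)) m.
    by rewrite subrK => -[_ ->]; rewrite subrr oppr0.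
  by have := alN; set A := al => <-; ring.
have k1 : k.+1%:R = k%:R + 1 :> R by rewrite natr1.
rewrite /g k1.
rewrite (_ : ph - m%:R * al * (2 * (k%:R + 1) - 1) = (ph - m%:R * node k) - m%:R * al); last by ring.
rewrite (_ : ph - m%:R * al * (2 * k%:R - 1) = (ph - m%:R * node k) + m%:R * al); last by ring.
move: (ph - _) => A; rewrite sinB sinD; ring.
Qed.

Local Notation cosd j l t := (cos ((j%:Z - l%:Z)%:~R * t)).

(* The Fejer-Korovkin kernel, up to a constant factor. *)
Definition fk_kernel t : R :=
  \sum_(j < d.+1) \sum_(l < d.+1) s j.+1 * s l.+1 * cosd j l t.

Definition fk_mass : R := \sum_(j < d.+1) s j.+1 ^+ 2.

(** The kernel is the squared modulus of the trigonometric polynomial with coefficients [s j.+1]. *)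
Lemma fk_kernel_ge0 t : 0 <= fk_kernel t.
Proof.
suff -> : fk_kernel t = (\sum_(j < d.+1) s j.+1 * cos (j%:R * t)) ^+ 2
    + (\sum_(j < d.+1) s j.+1 * sin (j%:R * t)) ^+ 2 by rewrite addr_ge0// sqr_ge0.
rewrite !expr2 !big_distrlr/= -big_split/=; apply: eq_bigr => j _.
rewrite -big_split/=; apply: eq_bigr => l _.
have -> : (j%:Z - l%:Z)%:~R * t = j%:R * t - l%:R * t by rewrite intrB mulrBl.
by rewrite cosB; ring.
Qed.

Lemma fk_kernelN t : fk_kernel (- t) = fk_kernel t.
Proof. by apply: eq_bigr => j _; apply: eq_bigr => l _; rewrite mulrN cosN. Qed.

Lemma fk_mass_gt0 : 0 < fk_mass.
Proof.
rewrite /fk_mass big_ord_recl/=; apply: ltr_pwDl; first by rewrite exprn_gt0// sin_al_gt0.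
by apply: sumr_ge0 => j _; exact: sqr_ge0.
Qed.

Lemma sum_cos_nodes_int (m : int) th : (absz m < N)%N ->
  \sum_(k < N) cos (m%:~R * (th - node k)) = if m == 0 then N%:R else 0.
Proof.
move=> mN; case: eqVneq => [->|m0].
  rewrite (eq_bigr (fun=> 1)) => [|k _]; last by rewrite mul0r cos0.
  by rewrite sumr_const card_ord.
have mN' : (0 < absz m < N)%N by rewrite mN andbT absz_gt0.
rewrite -[RHS](sum_cos_nodes ((absz m)%:R * th) mN'); apply: eq_bigr => k _.
by rewrite cos_norm_int mulrBr.
Qed.

Lemma sum_fk_kernel th : \sum_(k < N) fk_kernel (th - node k) = N%:R * fk_mass.
Proof.
rewrite /fk_kernel exchange_big/= mulr_sumr; apply: eq_bigr => j _.
rewrite exchange_big/= (bigD1 j)//= [X in _ + X]big1 ?addr0 => [|l lj].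
  by rewrite -mulr_sumr sum_cos_nodes_int ?subrr//= mulrC expr2.
rewrite -mulr_sumr sum_cos_nodes_int; last by have := ltn_ord j; have := ltn_ord l; lia.
rewrite ifN ?mulr0//; apply: contra lj => /eqP e; apply/eqP/val_inj => /=; lia.
Qed.

(** The weights satisfy s_j + s_(j+2) = 2 cos(pi / (d + 2)) s_(j+1) and vanish at j = 0 and j = d +
    2. They form the top eigenvector of a path graph, which makes the first cosine moment of the
    kernel as large as possible. *)
Lemma sum_fk_shift : \sum_(j < d.+1) s j.+1 * s j.+2 = cos al * fk_mass.
Proof.
have e : \sum_(j < d.+1) s j.+1 * s j.+2 = \sum_(j < d.+1) s j.+1 * s j.
  rewrite big_ord_recr [RHS]big_ord_recl/= alN sinpi mulr0 addr0 mul0r sin0 mulr0 add0r.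
  by apply: eq_bigr => j _; rewrite mulrC.
apply: (mulfI (_ : 2 != 0 :> R)); first by rewrite pnatr_eq0.
rewrite mulr_natl mulr2n {2}e -big_split/= mulrA mulr_sumr; apply: eq_bigr => j _.
have n1 (i : nat) : i.+1%:R = i%:R + 1 :> R by rewrite natr1.
have -> : s j.+2 = sin (j.+1%:R * al + al) by congr sin; rewrite (n1 j.+1); ring.
have -> : s j = sin (j.+1%:R * al - al) by congr sin; rewrite (n1 j); ring.
by rewrite sinB sinD; ring.
Qed.

(** The factor cos raises the degree to at most d + 1, still below the number d + 2 of nodes, so
    discrete orthogonality applies; only neighbouring pairs of indices survive, and [sum_fk_shift]
    adds them up. *)
Lemma sum_fk_kernel_cos th :
  \sum_(k < N) fk_kernel (th - node k) * cos (th - node k) = N%:R * (cos al * fk_mass).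
Proof.
have pm (m : int) t : cos (m%:~R * t) * cos t =
    2^-1 * (cos ((m + 1)%:~R * t) + cos ((m - 1)%:~R * t)).
  have -> : (m + 1)%:~R * t = m%:~R * t + t by rewrite intrD; ring.
  have -> : (m - 1)%:~R * t = m%:~R * t - t by rewrite intrB; ring.
  by rewrite cosB cosD; move: (cos _) (sin _) => A B; field.
have key (j l : 'I_d.+1) : \sum_(k < N) s j.+1 * s l.+1 * cosd j l (th - node k) * cos (th - node k)
    = 2^-1 * N%:R * (s j.+1 * s l.+1) * ((l == j.+1 :> nat)%:R + (j == l.+1 :> nat)%:R).
  rewrite (eq_bigr (fun k : 'I_N => 2^-1 * (s j.+1 * s l.+1) * (cos ((j%:Z - l%:Z + 1)%:~R * (th - node k))
     + cos ((j%:Z - l%:Z - 1)%:~R * (th - node k))))); last first.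
    by move=> k _; rewrite -mulrA pm mulrCA mulrA.
  have jd := ltn_ord j; have ld := ltn_ord l.
  rewrite -mulr_sumr big_split/= !sum_cos_nodes_int; [|lia|lia].
  have -> : (j%:Z - l%:Z + 1 == 0) = (l == j.+1 :> nat) by lia.
  have -> : (j%:Z - l%:Z - 1 == 0) = (j == l.+1 :> nat) by lia.
  by case: ifP => _; case: ifP => _ /=; ring.
transitivity (\sum_(j < d.+1) \sum_(l < d.+1) 2^-1 * N%:R * (s j.+1 * s l.+1)
    * ((l == j.+1 :> nat)%:R + (j == l.+1 :> nat)%:R)).
  rewrite (eq_bigr (fun k : 'I_N => \sum_(j < d.+1) \sum_(l < d.+1)
      s j.+1 * s l.+1 * cosd j l (th - node k) * cos (th - node k))); last first.
    by move=> k _; rewrite /fk_kernel mulr_suml; apply: eq_bigr => j _; rewrite mulr_suml.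
  rewrite exchange_big/=; apply: eq_bigr => j _.
  by rewrite exchange_big/=; apply: eq_bigr => l _; rewrite key.
have half : \sum_(j < d.+1) \sum_(l < d.+1) s j.+1 * s l.+1 * (l == j.+1 :> nat)%:R
    = cos al * fk_mass.
  rewrite -sum_fk_shift; apply: eq_bigr => j _.
  have [jd|jd] := ltnP j.+1 d.+1.
    rewrite (bigD1 (Ordinal jd))//= eqxx mulr1 big1 ?addr0// => l lj.
    rewrite (_ : (l == j.+1 :> nat) = false) ?mulr0//.
    by apply: contraNF lj => /eqP e; apply/eqP/val_inj.
  have -> : s j.+2 = 0.
    have -> : j.+2 = N by have := ltn_ord j; lia.
    by rewrite alN sinpi.
  rewrite mulr0 big1// => l _; rewrite (_ : (l == j.+1 :> nat) = false) ?mulr0//.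
  by have := ltn_ord l; lia.
have half' : \sum_(j < d.+1) \sum_(l < d.+1) s j.+1 * s l.+1 * (j == l.+1 :> nat)%:R
    = cos al * fk_mass.
  rewrite -half exchange_big/=; apply: eq_bigr => j _; apply: eq_bigr => l _.
  by rewrite [s j.+1 * _]mulrC.
transitivity (2^-1 * N%:R * (cos al * fk_mass + cos al * fk_mass)); last by field.
rewrite -{1}half -half' -big_split mulr_sumr/=; apply: eq_bigr => j _.
by rewrite -big_split mulr_sumr/=; apply: eq_bigr => l _; ring.
Qed.

(** Chebyshev polynomials; two consecutive ones are carried along for the three-term recurrence. *)
Lemma chebyshev_ex m : exists p : {poly R}, (size p <= m.+1)%N /\
  forall th, p.[cos th] = cos (m%:R * th).
Proof.
suff [p [q [[h1 h2] [h3 h4]]]] : exists p q : {poly R},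
    ((size p <= m.+1)%N /\ forall th, p.[cos th] = cos (m%:R * th)) /\
    ((size q <= m.+2)%N /\ forall th, q.[cos th] = cos (m.+1%:R * th)) by exists p.
elim: m => [|m [p [q [[h1 h2] [h3 h4]]]]].
  exists 1, 'X; rewrite size_poly1 size_polyX; split; split => // th.
    by rewrite hornerC mul0r cos0.
  by rewrite hornerX mul1r.
exists q, (2%:P * ('X * q) - p); split => //; split.
  apply: leq_trans (size_polyD _ _) _; rewrite size_polyN geq_max; apply/andP; split.
    apply: leq_trans (size_polyMleq _ _) _.
    apply: (@leq_trans (1 + size ('X * q)).-1); first by rewrite -!subn1 leq_sub2r// leq_add2r size_polyC_leq1.
    rewrite add1n/= mulrC; apply: leq_trans (size_polyMleq _ _) _.
    by rewrite size_polyX addn2/= ltnS.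
  by apply: leq_trans h1 _; rewrite ltnW.
move=> th; rewrite !hornerE h2 h4 /=.
have n1 (i : nat) : i.+1%:R = i%:R + 1 :> R by rewrite natr1.
have -> : m.+2%:R * th = m.+1%:R * th + th by rewrite (n1 m.+1); ring.
have -> : m%:R * th = m.+1%:R * th - th by rewrite (n1 m); ring.
by rewrite cosB cosD; ring.
Qed.

(** For each [x] the weights are a probability on the nodes, given by the normalised kernel. Its
    second moment about [x] is at most 2 - 2 cos(pi / (d + 2)), hence at most (pi / (d + 2))^2, so
    the mean distance is at most pi / (d + 2). This is the pi of the final bound. *)
Lemma jackson_weights : exists (xi : 'I_N -> R) (w : 'I_N -> {poly R}),
  [/\ forall k, (size (w k) <= d.+1)%N, forall k, -1 <= xi k <= 1 &
    forall x, -1 <= x <= 1 -> [/\ forall k, 0 <= (w k).[x], \sum_k (w k).[x] = 1 &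
      \sum_k (w k).[x] * `|x - xi k| <= al]].
Proof.
have /choice[T TP] := chebyshev_ex.
have c0 : 0 < N%:R * fk_mass by rewrite mulr_gt0 ?fk_mass_gt0.
pose c := (N%:R * fk_mass)^-1.
(* At cos th this polynomial is the normalised kernel centred at the node, averaged over th and - th
   by the product formula for cosines. *)
pose w (k : 'I_N) := c *: \sum_(j < d.+1) \sum_(l < d.+1)
  (s j.+1 * s l.+1 * cosd j l (node k)) *: T (absz (j%:Z - l%:Z)).
exists (fun k => cos (node k)), w; split.
- move=> k; apply: leq_trans (size_scale_leq _ _) _.
  apply: leq_trans (size_sum _ _ _) _; apply/bigmax_leqP => j _.
  apply: leq_trans (size_sum _ _ _) _; apply/bigmax_leqP => l _.
  apply: leq_trans (size_scale_leq _ _) _; apply: leq_trans (TP _).1 _.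
  by have := ltn_ord j; have := ltn_ord l; lia.
- by move=> k; rewrite cos_geN1 cos_le1.
move=> x x1; pose th := acos x.
have xE : x = cos th by rewrite acosK// in_itv.
have wE k : (w k).[x] = c * 2^-1 * (fk_kernel (th - node k) + fk_kernel (- th - node k)).
  rewrite /w hornerZ -[RHS]mulrA; congr (_ * _); rewrite horner_sum.
  have -> : fk_kernel (- th - node k) = fk_kernel (th + node k) by rewrite -fk_kernelN opprB opprK addrC.
  rewrite /fk_kernel -big_split mulr_sumr/=; apply: eq_bigr => j _.
  rewrite horner_sum -big_split mulr_sumr/=; apply: eq_bigr => l _.
  have tr (m p q : R) : cos (m * p) * cos (m * q)
      = 2^-1 * (cos (m * (p - q)) + cos (m * (p + q))).
    by rewrite mulrBr (mulrDr m) cosB cosD; field.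
  by rewrite hornerZ xE (TP _).2 -cos_norm_int -[LHS]mulrA [cos _ * cos _]mulrC tr; ring.
have s1 : \sum_k (w k).[x] = 1.
  under eq_bigr do rewrite wE.
  rewrite -mulr_sumr big_split/= !sum_fk_kernel -mulrA -[RHS](mulVf (lt0r_neq0 c0)) -/c.
  by congr (_ * _); move: (_ * fk_mass) => u; field.
have cc : 0 <= c * 2^-1 by rewrite mulr_ge0// invr_ge0 ltW.
have w0 k : 0 <= (w k).[x] by rewrite wE mulr_ge0// addr_ge0// fk_kernel_ge0.
split => //.
(* The distance of two points of the circle is at least that of their projections to the axis; the
   bound is wanted for both angles over [x]. *)
have sq t k : (x - cos (node k)) ^+ 2 <= 2 - 2 * cos (t - node k) \/ cos t != x.
  have [tx|] := eqVneq (cos t) x; [left|by right].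
  rewrite cosB -tx; have := cos2Dsin2 t; have := cos2Dsin2 (node k).
  have := sqr_ge0 (sin t - sin (node k)); nra.
have s2 : \sum_k (w k).[x] * (x - cos (node k)) ^+ 2 <= 2 - 2 * cos al.
  have -> : 2 - 2 * cos al = c * 2^-1 *
     (\sum_(k < N) fk_kernel (th - node k) * (2 - 2 * cos (th - node k)) +
      \sum_(k < N) fk_kernel (- th - node k) * (2 - 2 * cos (- th - node k))).
    have E t : \sum_(k < N) fk_kernel (t - node k) * (2 - 2 * cos (t - node k)) =
        2 * (N%:R * fk_mass) - 2 * (N%:R * (cos al * fk_mass)).
      rewrite -(sum_fk_kernel t) -(sum_fk_kernel_cos t) !mulr_sumr -sumrB.
      by apply: eq_bigr => k _; ring.
    transitivity ((2 - 2 * cos al) * (c * (N%:R * fk_mass))).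
      by rewrite mulVf ?mulr1// lt0r_neq0.
    rewrite !E; move: fk_mass (N%:R : R) => u v.
    by field.
  rewrite -big_split mulr_sumr/=; apply: ler_sum => k _.
  rewrite wE -(mulrA (c * 2^-1)) ler_wpM2l// mulrDl; apply: lerD; apply: ler_wpM2l; rewrite ?fk_kernel_ge0//.
    by have [//|] := sq th k; rewrite -xE eqxx.
  by have [//|] := sq (- th) k; rewrite cosN -xE eqxx.
have al0 := al_gt0.
(* Passes from the second moment to the first; the parameter [al] balances the two terms. *)
have jen k : `|x - cos (node k)| <= (x - cos (node k)) ^+ 2 / (2 * al) + al / 2.
  rewrite -(real_normK (num_real (x - cos (node k)))); move: `|_| => u.
  have -> : u ^+ 2 / (2 * al) + al / 2 = u + (u - al) ^+ 2 / (2 * al).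
    by move: al (lt0r_neq0 al_gt0) => A A0; field.
  by rewrite lerDl divr_ge0 ?sqr_ge0// mulr_ge0// ltW.
apply: (@le_trans _ _ (\sum_k (w k).[x] * ((x - cos (node k)) ^+ 2 / (2 * al) + al / 2))).
  by apply: ler_sum => k _; rewrite ler_wpM2l.
under eq_bigr do rewrite mulrDr [X in X + _]mulrA.
rewrite big_split/= -!mulr_suml s1 mul1r.
have : \sum_k (w k).[x] * (x - cos (node k)) ^+ 2 <= al ^+ 2 := le_trans s2 (cos_quadratic al).
set S := \sum_k _; move=> s3.
have : S / (2 * al) <= al / 2; last by move: (S / _) => u; move: al => v; lra.
rewrite ler_pdivrMr ?mulr_gt0 ?pi_gt0//; move: s3; move: al => v; rewrite expr2; lra.
Qed.

End jackson_univariate.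

(** * Jackson estimate in several variables *)

Section jackson_multivariate.
Context {R : realType}.

Lemma sum_prod_ffun n m (F : 'I_n -> 'I_m -> R) :
  \sum_(k : {ffun 'I_n -> 'I_m}) \prod_j F j (k j) = \prod_j \sum_k F j k.
Proof. by rewrite bigA_distr_bigA. Qed.

Lemma prod_horner_expand n d (p : 'I_n -> {poly R}) (x : 'rV[R]_n) :
  (forall j, (size (p j) <= d.+1)%N) ->
  \prod_j (p j).[x 0 j] =
  \sum_(e : {ffun 'I_n -> 'I_d.+1}) (\prod_j (p j)`_(e j)) * \prod_j x 0 j ^+ e j.
Proof.
move=> sp; under eq_bigr do rewrite (horner_coef_wide _ (sp _)).
by rewrite -sum_prod_ffun; apply: eq_bigr => e _; rewrite big_split.
Qed.

(** Products of the one-variable weights are, for each [x] in the cube, a probability on a grid of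
    nodes with the one-variable marginals. The approximant is the mean of [psi] over the nodes.
    Bounding the sup norm distance by the sum over the coordinates gives the factor [n]. *)
Lemma jackson_multivariate n d (psi : 'rV[R]_n -> R) c (rho Lam : R) : 0 < rho -> 0 <= Lam ->
  (forall x y, `|psi x - psi y| <= Lam * `|x - y|) ->
  exists C : {ffun 'I_n -> 'I_d.+1} -> R, forall x, closed_cube c rho x ->
    `|psi x - \sum_e C e * \prod_j x 0 j ^+ e j| <= n%:R * Lam * rho * (pi / d.+2%:R).
Proof.
move=> r0 L0 psiL; have [xi [w [ws _ wP]]] := @jackson_weights R d.
pose node (k : {ffun 'I_n -> 'I_d.+2}) : 'rV[R]_n := \row_j (c 0 j + rho * xi (k j)).
pose p k j := w k \Po (rho^-1 *: ('X - (c 0 j)%:P)).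
have ps k j : (size (p k j) <= d.+1)%N.
  apply: leq_trans (size_comp_poly_leq _ _) _; rewrite ltnS.
  rewrite -[leqRHS]muln1; apply: leq_mul; rewrite -subn1 leq_subLR add1n//.
  by apply: leq_trans (size_scale_leq _ _) _; rewrite size_XsubC.
exists (fun e : {ffun 'I_n -> 'I_d.+1} => \sum_k psi (node k) * \prod_j (p (k j) j)`_(e j)) => x cx.
pose y j := rho^-1 * (x 0 j - c 0 j).
have pE k j : (p k j).[x 0 j] = (w k).[y j] by rewrite horner_comp !hornerE.
have y1 j : -1 <= y j <= 1.
  by rewrite -ler_norml normrM gtr0_norm ?invr_gt0// mulrC ler_pdivrMr// mul1r cx.
pose W (k : {ffun 'I_n -> 'I_d.+2}) := \prod_j (w (k j)).[y j].
have -> : \sum_(e : {ffun 'I_n -> 'I_d.+1}) (\sum_k psi (node k) * \prod_j (p (k j) j)`_(e j)) * \prod_j x 0 j ^+ e j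
    = \sum_k psi (node k) * W k.
  under eq_bigr do rewrite mulr_suml.
  rewrite exchange_big/=; apply: eq_bigr => k _.
  under eq_bigr do rewrite -mulrA.
  rewrite -mulr_sumr -(@prod_horner_expand _ _ (fun j => p (k j) j)) => [|j]; last exact: ps.
  by congr (_ * _); apply: eq_bigr => j _.
have W0 k : 0 <= W k by apply: prodr_ge0 => j _; have [+ _ _] := wP _ (y1 j); exact.
have W1 : \sum_k W k = 1.
  rewrite (sum_prod_ffun (fun j k => (w k).[y j])) big1// => j _.
  by have [_ + _] := wP _ (y1 j).
have Wj j : \sum_k W k * `|y j - xi (k j)| <= pi / d.+2%:R.
  (* The distance in coordinate [j] is absorbed into the j-th factor; every other factor sums to
     1. *)
  pose G i k := (w k).[y i] * (if i == j then `|y i - xi k| else 1).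
  rewrite (eq_bigr (fun k : {ffun _} => \prod_i G i (k i))) => [|k _].
    rewrite sum_prod_ffun (bigD1 j)//= [X in _ * X]big1 ?mulr1 => [|i ij].
      rewrite /G eqxx; by have [_ _ +] := wP _ (y1 j).
    rewrite /G (negbTE ij) -[RHS](let: And3 _ h _ := wP _ (y1 i) in h).
    by apply: eq_bigr => k _; rewrite mulr1.
  rewrite /G big_split/=; congr (_ * _).
  rewrite (bigD1 j)//= eqxx big1 ?mulr1// => i ij; by rewrite (negbTE ij).
have -> : psi x - \sum_k psi (node k) * W k = \sum_k (psi x - psi (node k)) * W k.
  rewrite -[X in X - _]mulr1 -W1 mulr_sumr -sumrB; apply: eq_bigr => k _; by rewrite mulrBl.
apply: le_trans (ler_norm_sum _ _ _) _.
apply: (@le_trans _ _ (\sum_k \sum_j Lam * rho * (W k * `|y j - xi (k j)|))).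
  apply: ler_sum => k _; rewrite normrM (ger0_norm (W0 k)).
  have -> : \sum_j Lam * rho * (W k * `|y j - xi (k j)|)
      = Lam * (\sum_j rho * `|y j - xi (k j)|) * W k.
    by rewrite mulr_sumr mulr_suml; apply: eq_bigr => j _; ring.
  apply: ler_wpM2r => //; apply: le_trans (psiL _ _) _; apply: ler_wpM2l => //.
  have s0 : 0 <= \sum_j rho * `|y j - xi (k j)|.
    by apply: sumr_ge0 => j _; rewrite mulr_ge0// ltW.
  apply: normr_rV_le => // j.
  have -> : (x - node k) 0 j = rho * (y j - xi (k j)).
    by rewrite !mxE /y mulrBr mulrA divff ?lt0r_neq0// mul1r; ring.
  rewrite normrM gtr0_norm// (bigD1 j)//= lerDl; apply: sumr_ge0 => i _.
  by rewrite mulr_ge0// ltW.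
rewrite exchange_big/= -!mulrA mulr_natl -[n in leRHS](card_ord n) -sumr_const.
apply: ler_sum => j _; rewrite -mulr_sumr -mulrA.
by apply: ler_wpM2l => //; apply: ler_wpM2l (Wj j); exact: ltW.
Qed.
End jackson_multivariate.

(** * Arcs crossing cubes *)

Section trace.
Context {R : realType}.
Local Notation mu := (@lebesgue_measure R).

(** Equal to 1 up to r / 2 and to 0 from [r] on: the plateau matches the half cube, and the slope
    between is 2 / r in absolute value. *)
Definition bump (r y : R) : R := Num.max 0 (Num.min 1 (2 / r * (r - y))).

Lemma bump_ge0 r y : 0 <= bump r y. Proof. by rewrite /bump le_max lexx. Qed.

Lemma bump_out r y : 0 < r -> r <= y -> bump r y = 0.
Proof.
move=> r0 ry; apply/max_idPl; rewrite ge_min; apply/orP; right.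
by rewrite mulr_ge0_le0 ?subr_le0// divr_ge0// ltW.
Qed.

Lemma bump_in r y : 0 < r -> y <= r / 2 -> bump r y = 1.
Proof.
move=> r0 ry; rewrite /bump.
have -> : Num.min 1 (2 / r * (r - y)) = 1.
  by apply/min_idPl; rewrite mulrAC ler_pdivlMr//; lra.
by apply/max_idPr.
Qed.

Lemma bump_lip r x y : 0 < r -> `|bump r x - bump r y| <= 2 / r * `|x - y|.
Proof.
move=> r0; rewrite /bump; have := @clamp_lip R 0 1 (2 / r * (r - x)) (2 / r * (r - y)) ler01.
move=> h; apply: le_trans h _; rewrite (_ : _ - _ = 2 / r * (y - x)); last by ring.
by rewrite normrM distrC gtr0_norm// divr_gt0.
Qed.

Lemma clamp_continuous (lo hi : R) : lo <= hi -> continuous (clamp lo hi).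
Proof. by move=> lh; apply: (@klip_continuous R _ 1) => // x y; rewrite mul1r clamp_lip. Qed.

Lemma sublevel_measurable (lo hi c : R) (g : R -> R) : lo <= hi -> econt `[lo, hi] g ->
  measurable (`[lo, hi]%classic `&` [set y | g y < c]).
Proof.
move=> lh cg.
have cgc : continuous (g \o clamp lo hi).
  apply/continuous_subspace_setT/econtP; apply: econt_comp cg.
    by move=> x _; exact: clamp_itv.
  by apply: continuous_econt; exact: clamp_continuous.
have -> : `[lo, hi]%classic `&` [set y | g y < c]
    = `[lo, hi]%classic `&` (g \o clamp lo hi) @^-1` [set y | y < c].
  by apply/seteqP; split=> y /= [yI h]; split => //; move: h; rewrite clamp_id.
apply: measurableI; first exact: measurable_itv.
by apply: open_measurable; move/continuousP: cgc; apply; exact: open_lt.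
Qed.

Lemma sublevel_measure_gt0 (lo hi c y0 : R) (g : R -> R) : lo < hi -> econt `[lo, hi] g ->
  y0 \in `[lo, hi] -> g y0 < c ->
  0 < fine (mu (`[lo, hi]%classic `&` [set y | g y < c])).
Proof.
move=> lh cg y0I gy0; have mA := sublevel_measurable c (ltW lh) cg.
have e0 : 0 < c - g y0 by rewrite subr_gt0.
have [de de0 gde] := cg _ y0I _ e0.
have near y : y \in `[lo, hi] -> `|y - y0| < de -> g y < c.
  by move=> yI /(gde _ yI); rewrite ltr_norml => /andP[_]; rewrite ltrBlDr subrK.
move: (y0I); rewrite itvP1 => /andP[h1 h2].
have [p [q [pq lp qh sub]]] : exists p q, [/\ p < q, lo <= p, q <= hi &
    forall y, p <= y <= q -> `|y - y0| < de].
  have [y0h|y0h] := ltP y0 hi.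
    exists y0, (Num.min hi (y0 + de / 2)); split => //.
    - by rewrite lt_min y0h ltrDl divr_gt0.
    - by rewrite ge_min lexx.
    move=> y /andP[y1]; rewrite le_min => /andP[_ y2].
    rewrite ger0_norm ?subr_ge0//; lra.
  exists (Num.max lo (hi - de / 2)), hi; split => //.
  - by rewrite gt_max lh gtrDl oppr_lt0 divr_gt0.
  - by rewrite le_max lexx.
  move=> y /andP[]; rewrite ge_max => /andP[_ y1 y2].
  by rewrite ler0_norm ?subr_le0; lra.
apply: (@lt_le_trans _ _ (fine (mu `[p, q]%classic))).
  by rewrite fine_itv_measure ?subr_gt0// ltW.
apply: fine_le.
- by rewrite ge0_fin_numE// bounded_itv_lty.
- rewrite ge0_fin_numE//; apply: le_lt_trans (bounded_itv_lty true false lo hi).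
  by apply: le_measure; rewrite ?inE.
apply: le_measure; rewrite ?inE//.
move=> y /=; rewrite in_itv/= => ypq; have yI : y \in `[lo, hi].
  by rewrite itvP1; move/andP: ypq => [? ?]; apply/andP; split; lra.
by split => //; apply: near => //; exact: sub.
Qed.

Lemma sublevel_le_dint_id (lo hi c : R) (g Phi : R -> R) : lo < hi -> econt `[lo, hi] g ->
  econt `[lo, hi] Phi -> (forall y, 0 <= Phi y) -> (forall y, g y < c -> 1 <= Phi y) ->
  fine (mu (`[lo, hi]%classic `&` [set y | g y < c])) <= dint id Phi lo hi.
Proof.
move=> lh cg cP P0 P1; have mA := sublevel_measurable c (ltW lh) cg.
set A := _ `&` _ in mA *.
have finA : (mu A < +oo)%E.
  apply: le_lt_trans (bounded_itv_lty true false lo hi).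
  by apply: le_measure; rewrite ?inE//; apply: subIsetl.
have -> : dint id Phi lo hi = \int[mu]_(x in `[lo, hi]) Phi x.
  by apply: eq_Rintegral => x _; rewrite derive1_id mul1r.
have -> : fine (mu A) = \int[mu]_(x in `[lo, hi]) (\1_A x : R).
  by rewrite /Rintegral integral_indic// setIidl//; apply: subIsetl.
apply: le_Rintegral => //.
- apply/integrableP; split; first exact/measurable_EFinP/measurable_indic.
  have -> : (\int[mu]_(x in `[lo, hi]) `|(EFin \o \1_A) x|)%E = mu A; last by [].
    transitivity (\int[mu]_(x in `[lo, hi]) (\1_A x)%:E)%E.
      by apply: eq_integral => x _ /=; rewrite ger0_norm.
    by rewrite integral_indic// setIidl//; apply: subIsetl.
- exact: (econt_integrable (lexx lo) (lexx hi) cP).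
move=> x _; rewrite indicE; case: (boolP (x \in A)) => [|_]; last exact: P0.
by rewrite inE => -[_ /= /P1].
Qed.

(** On [t0, t1] the injective [u] serves as a new variable, and outside of it the bump vanishes. In
    the new variable the integrand is nonnegative and equals 1 where [D] is below r / 2; this set
    contains an interval near [u tc]. *)
Lemma trace_le_dint (u D : R -> R) (K t0 t1 r tc : R) : 0 < K -> klip K u 0 1 ->
  0 < r -> 0 <= t0 -> t0 < t1 -> t1 <= 1 -> {in `[t0, t1] &, injective u} ->
  econt (`[0, 1]%classic : set R) D -> (0 < t0 -> forall t, 0 <= t <= t0 -> r <= D t) ->
  (t1 < 1 -> forall t, t1 <= t <= 1 -> r <= D t) ->
  tc \in `[t0, t1] -> D tc < r / 2 ->
  0 < fine (mu (u @` [set t | t \in `[0, 1] /\ D t < r / 2])) <= `|dint u (fun t => bump r (D t)) 0 1|.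
Proof.
move=> K0 uK r0 t00 t01 t11 uinj cD Dl Dr tcI Dc.
set m := fine _.
have sub01 t : t \in `[t0, t1] -> t \in `[0, 1].
  by rewrite !itvP1 => /andP[? ?]; apply/andP; split; lra.
have cu01 := klip_econt K0 uK.
have cu : econt `[t0, t1] u by apply: econtS cu01 => x; exact: sub01.
pose lo := Num.min (u t0) (u t1); pose hi := Num.max (u t0) (u t1).
have t0I : t0 \in `[t0, t1] by rewrite itvP1 lexx ltW.
have t1I : t1 \in `[t0, t1] by rewrite itvP1 lexx ltW.
have une : u t0 != u t1.
  by apply/eqP => /(uinj _ _ t0I t1I) e; move: t01; rewrite e ltxx.
have lh : lo < hi by rewrite /lo /hi; case: (ltgtP (u t0) (u t1)) une.
have img : u @` `[t0, t1]%classic = `[lo, hi]%classic.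
  by apply: continuous_inj_image_segment; [exact: ltW|exact/econtP|exact: uinj].
pose inv y := xget t0 [set t | t \in `[t0, t1] /\ u t = y].
have invK t : t \in `[t0, t1] -> inv (u t) = t.
  move=> tI; rewrite /inv; case: xgetP => [s _ [sI /(uinj _ _ sI tI)]//|/(_ t)[]].
  by split.
pose g := D \o inv.
have cD' : econt `[t0, t1] D by apply: econtS cD => x; exact: sub01.
have cg : econt `[lo, hi] g.
  rewrite -img; apply: (econt_quotient (segment_compact (a := t0) (b := t1)) cu cD').
  by move=> t tI; rewrite /g /= invK.
have bumpc : econt setT (bump r).
  apply: continuous_econt; apply: (@klip_continuous R _ (2 / r)); first by rewrite divr_gt0.
  by move=> x y; exact: bump_lip.
pose Phi y := bump r (g y).
have cPhi : econt `[lo, hi] Phi by apply: econt_comp cg bumpc.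
have mE : m = fine (mu (`[lo, hi]%classic `&` [set y | g y < r / 2])).
  rewrite /m; congr (fine (mu _)); apply/seteqP; split => [y [t [tI Dt] <-]|y [yI gy]].
    have tJ : t \in `[t0, t1].
      move: tI; rewrite !itvP1 => /andP[tl tr]; apply/andP; split.
        rewrite leNgt; apply/negP => h; have := Dl (le_lt_trans tl h) t.
        by rewrite tl ltW// => /(_ isT); lra.
      rewrite leNgt; apply/negP => h; have := Dr (lt_le_trans h tr) t.
      by rewrite tr ltW// => /(_ isT); lra.
    by split; [rewrite -img; exists t|rewrite /g /= invK].
  move: yI; rewrite -img => -[t tI ty]; exists t => //; split; first exact: sub01.
  by move: gy; rewrite /g /= -ty invK.
have cb : econt (`[0, 1]%classic : set R) (fun t => bump r (D t)) by apply: econt_comp cD bumpc.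
have ab := @ltr01 R.
have idk : klip 1 (@id R) lo hi by move=> x y _ _; rewrite mul1r.
(* Change of variable by local comparison: the primitive of [Phi], composed with [u], has the right
   differential at every point. *)
have mid : dint u (fun t => bump r (D t)) t0 t1 = dint id Phi lo (u t1) - dint id Phi lo (u t0).
  apply/eqP; rewrite -subr_eq0; apply/eqP; apply: (@eq0_le_eps_mul _ _ (t1 - t0)) => e e0.
  apply: (dint_approx (B := fun t => dint id Phi lo (u t)) t01 K0 (klipS t00 t11 uK)).
    by apply: econtS cb => x; exact: sub01.
  move=> t tI; have uI s : s \in `[t0, t1] -> u s \in `[lo, hi].
    by move=> sI; have : (u @` `[t0, t1]%classic) (u s) by [exists s]; rewrite img.
  have [d d0 dP] := dint_local lh ltr01 idk cPhi (uI _ tI) (divr_gt0 e0 K0).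
  have [d' d'0 d'P] := cu _ tI _ d0.
  exists d' => // t' t'I t't.
  have := dP _ (uI _ t'I) (d'P _ t'I t't); rewrite /Phi /g /= invK// => h.
  apply: le_trans h _; rewrite -mulrA ler_pM2l// ler_pdivrMl//.
  by apply: uK; exact: sub01.
have zl : dint u (fun t => bump r (D t)) 0 t0 = 0.
  move: t00; rewrite le_eqVlt => /predU1P[<-|t0p].
    by rewrite (dint_id u cb).
  have := dint_le_l1 (E := 0) ab K0 uK cb (lexx 0) (le_trans (ltW t01) t11).
  rewrite mul0r normr_le0 => h; apply/eqP/h => t.
  by rewrite itvP1 => tt; rewrite bump_out ?normr0// Dl.
have zr : dint u (fun t => bump r (D t)) t1 1 = 0.
  move: t11; rewrite le_eqVlt => /predU1P[->|t1p].
    by rewrite (dint_id u cb).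
  have := dint_le_l1 (E := 0) ab K0 uK cb (le_trans t00 (ltW t01)) (lexx 1).
  rewrite mul0r normr_le0 => h; apply/eqP/h => t.
  by rewrite itvP1 => tt; rewrite bump_out ?normr0// Dr.
have t01' := ltW t01.
rewrite (dintD ab K0 uK cb (lexx 0) t00 (le_trans t01' t11) (lexx 1)).
rewrite (dintD ab K0 uK cb t00 t01' t11 (lexx 1)) zl zr add0r addr0 mid.
have hi1 : `|dint id Phi lo (u t1) - dint id Phi lo (u t0)| = dint id Phi lo hi.
  have z0 : dint id Phi lo lo = 0 by rewrite (dint_id id cPhi)// ltW.
  have p0 : 0 <= dint id Phi lo hi.
    apply: (@le_trans _ _ (fine (mu (`[lo, hi]%classic `&` [set y | Phi y < 0])))).
      by rewrite fine_ge0.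
    by apply: sublevel_le_dint_id => // y; rewrite /Phi ?bump_ge0// ltNge bump_ge0.
  move: z0 p0; rewrite /lo /hi; case: (ltP (u t0) (u t1)) => _ z0 p0.
    by rewrite z0 subr0 ger0_norm.
  by rewrite z0 sub0r normrN ger0_norm.
rewrite hi1 mE; apply/andP; split.
  apply: (@sublevel_measure_gt0 _ _ _ (u tc)) => //; last by rewrite /g /= invK.
  by have : (u @` `[t0, t1]%classic) (u tc) by [exists tc]; rewrite img.
apply: sublevel_le_dint_id => // y; first exact: bump_ge0.
by move=> gy; rewrite /Phi bump_in// ltW.
Qed.

End trace.

Section injectivity.
Context {R : realType}.

(** If [u] took the same value at [s] and [t] and another one at some [m] between, it would take the
    intermediate value on both sides of [m], at two distinct interior points. *)
Lemma econt_inj_closure (u : R -> R) (t0 t1 : R) : econt `[t0, t1] u ->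
  {in `]t0, t1[ &, injective u} -> {in `[t0, t1] &, injective u}.
Proof.
move=> cu uI.
have mid p q : p \in `[t0, t1] -> q \in `[t0, t1] -> p < q -> u p != u q ->
    exists2 x, p < x < q & u x = (u p + u q) / 2.
  move=> pI qI pq upq.
  have [x [xI ux /andP[x1 x2]]] : exists x, [/\ x \in `[t0, t1], u x = (u p + u q) / 2 & p <= x <= q].
    have [h|h] : u p <= u q \/ u q <= u p by case: (leP (u p) (u q)) => h; [left|right; exact: ltW].
      have [|x [x1 x2]] := ivt_between (y := (u p + u q) / 2) cu pI qI; first by apply/andP; split; lra.
      by rewrite min_l ?max_r ?(ltW pq)//; exists x.
    have [|x [x1 x2]] := ivt_between (y := (u p + u q) / 2) cu qI pI; first by apply/andP; split; lra.
    by rewrite min_r ?max_l ?(ltW pq)//; exists x.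
  have px : p != x by apply: contra upq => /eqP e; rewrite -e in ux; apply/eqP; lra.
  have xq : x != q by apply: contra upq => /eqP e; rewrite e in ux; apply/eqP; lra.
  by exists x; rewrite // !lt_neqAle x1 x2 px xq.
suff key s t : s \in `[t0, t1] -> t \in `[t0, t1] -> s < t -> u s != u t.
  move=> s t sI tI e; case: (ltgtP s t) => //.
    by move=> /(key _ _ sI tI); rewrite e eqxx.
  by move=> /(key _ _ tI sI); rewrite e eqxx.
move=> sI tI st; apply/eqP => e.
move: (sI) (tI); rewrite !itvP1 => /andP[s0 s1] /andP[t00 t11].
have inO x : s < x < t -> x \in `]t0, t1[.
  by move=> /andP[? ?]; rewrite in_itv/=; apply/andP; split; lra.
have inC x : s < x < t -> x \in `[t0, t1].
  by move=> /inO; exact: subset_itv_oo_cc.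
have [m mst um] : exists2 m, s < m < t & u m != u s.
  pose m1 := (2 * s + t) / 3; pose m2 := (s + 2 * t) / 3.
  have m1I : s < m1 < t by rewrite /m1; apply/andP; split; lra.
  have m2I : s < m2 < t by rewrite /m2; apply/andP; split; lra.
  have [e1|] := eqVneq (u m1) (u s); last by exists m1.
  exists m2 => //; apply/eqP => e2.
  have := uI _ _ (inO _ m1I) (inO _ m2I) (etrans e1 (esym e2)).
  by rewrite /m1 /m2; lra.
have /andP[sm mt] := mst.
have usm : u s != u m by rewrite eq_sym.
have umt : u m != u t by rewrite -e.
have [x /andP[x1 x2] ux] := mid s m sI (inC _ mst) sm usm.
have [y /andP[y1 y2] uy] := mid m t (inC _ mst) tI mt umt.
have xI : s < x < t by rewrite x1 (lt_trans x2).
have yI : s < y < t by rewrite y2 (lt_trans _ y1).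
have := uI _ _ (inO _ xI) (inO _ yI) _; rewrite ux uy -e addrC => /(_ erefl) xy.
by have := lt_trans x2 y1; rewrite xy ltxx.
Qed.

End injectivity.

Section arc_trace.
Context {R : realType} {n : nat}.
Local Notation V := 'rV[R]_n.

Lemma open_cubeP (c x : V) r : 0 < r -> open_cube c r x <-> `|x - c| < r.
Proof.
move=> r0; split=> [cx|xc j]; last first.
  by apply: le_lt_trans xc; have := normr_coord (x - c) j; rewrite !mxE.
rewrite /Num.norm/= mx_normrE; apply/bigmax_ltP; split => // -[i j] _ /=.
by rewrite (ord1 i) !mxE; exact: cx.
Qed.

Variables (h : R -> V) (K : R).
Hypotheses (K0 : 0 < K) (hK : klip K h 0 1) (h_inj : {in `[0, 1] &, injective h}).
Local Notation A := (h @` `[0, 1]).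

(** If the arc were outside [U] at [t2], its parts before and after [t2] would separate the trace,
    both being closed in it. So the parameters at which the arc lies in [U] form an interval. *)
Lemma connected_trace (U : set V) t1 t2 t3 : connected (U `&` A) -> U (h t1) -> U (h t3) ->
  0 <= t1 -> t1 < t2 -> t2 < t3 -> t3 <= 1 -> U (h t2).
Proof.
move=> cU U1 U3 t10 t12 t23 t31; apply: contrapT => U2.
have ch := klip_econt K0 hK.
have clo p q : 0 <= p -> q <= 1 -> closed (h @` `[p, q]).
  move=> p0 q1; apply: compact_closed; first exact: norm_hausdorff.
  apply: continuous_compact; last exact: segment_compact.
  apply/econtP; apply: econtS ch => x /=; rewrite !in_itv/= => /andP[? ?].
  by apply/andP; split; lra.
pose B := (U `&` A) `&` h @` `[0, t2].
have BE : B = (U `&` A) `&` ~` (h @` `[t2, 1]).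
  apply/seteqP; split=> x [[Ux [t]]]; rewrite /= in_itv/= => /andP[s0 s1] tx.
    move=> [s]; rewrite /= in_itv/= => /andP[h1 h2] sx; split; first by split => //; exists t => //; rewrite /= in_itv/= s0.
    move=> [v]; rewrite /= in_itv/= => /andP[h3 h4] vx.
    have e : s = v by apply: h_inj; rewrite ?sx ?vx// itvP1; apply/andP; split; lra.
    have e2 : s = t2 by lra.
    by apply: U2; rewrite -e2 sx.
  move=> nx; split; first by split => //; exists t => //; rewrite /= in_itv/= s0.
  exists t => //; rewrite /= in_itv/= s0/= leNgt; apply/negP => tt; apply: nx.
  by exists t => //; rewrite /= in_itv/= s1 ltW.
have : B = U `&` A.
  apply: cU.
  - exists (h t1); split; [split => //|]; exists t1 => //; rewrite /= in_itv/=; apply/andP; split; lra.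
  - by exists (~` (h @` `[t2, 1])) => //; apply: closed_openC; apply: clo => //; lra.
  - by exists (h @` `[0, t2]) => //; apply: clo => //; lra.
move=> e; have : B (h t3).
  by rewrite e; split => //; exists t3 => //; rewrite /= in_itv/=; apply/andP; split; lra.
move=> [_ [s]]; rewrite /= in_itv/= => /andP[s0 s2] st.
have : s = t3 by apply: h_inj => //; rewrite itvP1; apply/andP; split; lra.
lra.
Qed.

(** The coordinate is injective in the interior of the interval of parameters spent in the cube
    because the projection is, and then on its closure by continuity. At an end of this interval
    inside ]0, 1[ the arc has left the open cube, so the bump vanishes from there on. *)
Lemma arc_trace (c : V) r s : 0 < r -> A c -> connected (open_cube c r `&` A) ->
  set_inj (open_cube c r `&` A) (axis_proj s) ->
  0 < axis_measure s (axis_proj s @` (open_cube c (r / 2) `&` A))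
    <= `|dint (fun t => h t 0 s) (fun t => bump r `|h t - c|) 0 1|.
Proof.
move=> r0 [tc tcI' tcE] conn pinj; have tcI : tc \in `[0, 1] := tcI'; have r20 : 0 < r / 2 by rewrite divr_gt0.
pose u t := h t 0 s; pose D t := `|h t - c|.
have uK : klip K u 0 1 := coord_klip s hK.
have ch := klip_econt K0 hK.
have cD : econt (`[0, 1]%classic : set R) D.
  move=> x xI e e0; have [d d0 dP] := ch x xI e e0; exists d => // y yI /(dP _ yI).
  apply: le_lt_trans; apply: le_trans (ler_dist_dist _ _) _.
  by rewrite opprB addrA subrK.
have -> : axis_measure s (axis_proj s @` (open_cube c (r / 2) `&` A))
    = fine (lebesgue_measure (u @` [set t | t \in `[0, 1] /\ D t < r / 2])).
  congr (fine (_ _)); apply/seteqP; split=> x.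
    move=> [_ [y [/open_cubeP-/(_ r20) yc [t tI ty]] <-] <-]; rewrite -ty in yc *.
    by exists t; rewrite ?mxE ?eqxx//; split.
  move=> [t [tI Dt] <-]; exists (axis_proj s (h t)); last by rewrite mxE eqxx.
  by exists (h t) => //; split; [exact/open_cubeP|exists t].
pose J := [set t | t \in `[0, 1] /\ D t < r].
have tcJ : J tc by split; rewrite // /D tcE subrr normr0.
have convJ t1 t2 t3 : J t1 -> J t3 -> t1 < t2 -> t2 < t3 -> J t2.
  rewrite /J /= !itvP1 => -[/andP[h1 h2] h3] [/andP[h4 h5] h6] h7 h8.
  split; first by apply/andP; split; lra.
  by apply/open_cubeP => //; apply: (connected_trace conn _ _ h1 h7 h8 h5); exact/open_cubeP.
have hl : has_lbound J by exists 0 => t [+ _]; rewrite itvP1 => /andP[].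
have hu : has_ubound J by exists 1 => t [+ _]; rewrite itvP1 => /andP[].
have J0 : J !=set0 by exists tc.
have nearJ t : J t -> exists2 d, 0 < d & forall t', t' \in `[0, 1] -> `|t' - t| < d -> J t'.
  move=> [tI Dt]; have e0 : 0 < r - D t by rewrite subr_gt0.
  have [d d0 dP] := cD _ tI _ e0; exists d => // t' t'I t't; split => //.
  by have := dP _ t'I t't; rewrite ltr_norml => /andP[_]; rewrite ltrBlDr subrK.
pose t0 := inf J; pose t1 := sup J.
have J_le t : J t -> t0 <= t <= t1.
  by move=> Jt; rewrite ge_inf//= sup_upper_bound.
have t00 : 0 <= t0 by apply: lb_le_inf => // t [+ _]; rewrite itvP1 => /andP[].
have t11 : t1 <= 1 by apply: ge_sup => // t [+ _]; rewrite itvP1 => /andP[].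
have inJ t : t0 < t < t1 -> J t.
  move=> /andP[h1 h2].
  have [p Jp] := @inf_adherent _ J _ (eqbRL (subr_gt0 _ _) h1) (conj J0 hl).
  rewrite -/t0 addrC subrK => pt.
  have [q Jq] := @sup_adherent _ J _ (eqbRL (subr_gt0 _ _) h2) (conj J0 hu).
  rewrite -/t1 opprB addrC subrK => tq.
  exact: convJ Jp Jq pt tq.
(* The center may be an end of the arc, so a second parameter in the open cube is sought on a side
   of [tc] that stays in [0, 1]. *)
have t01 : t0 < t1.
  have [d d0 dP] := nearJ _ tcJ; move: (tcI); rewrite itvP1 => /andP[h1 h2].
  have [t' t'I [t't t'c]] : exists2 t', t' \in `[0, 1] & `|t' - tc| < d /\ t' != tc.
    have [hc|hc] := ltP tc 1.
      exists (Num.min 1 (tc + d / 2)).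
        rewrite itvP1; apply/andP; split; last by rewrite ge_min lexx.
        by rewrite le_min ler01/= addr_ge0// divr_ge0// ltW.
      have m1 : tc < Num.min 1 (tc + d / 2) by rewrite lt_min hc/= ltrDl divr_gt0.
      have m2 : Num.min 1 (tc + d / 2) <= tc + d / 2 by rewrite ge_min lexx orbT.
      split; last by rewrite gt_eqF.
      by rewrite ger0_norm ?subr_ge0 ?(ltW m1)//; lra.
    exists (Num.max 0 (tc - d / 2)).
      rewrite itvP1; apply/andP; split; first by rewrite le_max lexx.
      by rewrite ge_max ler01/=; lra.
    have m1 : Num.max 0 (tc - d / 2) < tc by rewrite gt_max; apply/andP; split; lra.
    have m2 : tc - d / 2 <= Num.max 0 (tc - d / 2) by rewrite le_max lexx orbT.
    split; last by rewrite lt_eqF.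
    by rewrite ler0_norm ?subr_le0 ?(ltW m1)//; lra.
  have /J_le/andP[h3 h4] := dP _ t'I t't; have /J_le/andP[h5 h6] := tcJ.
  by case: (ltgtP t' tc) t'c => // lt_t _; lra.
have Dl : 0 < t0 -> forall t, 0 <= t <= t0 -> r <= D t.
  move=> t0p t /andP[h1 h2]; rewrite leNgt; apply/negP => Dt.
  have Jt : J t by split => //; rewrite itvP1; apply/andP; split; lra.
  have [d d0 dP] := nearJ _ Jt; have /J_le/andP[h3 h4] := Jt.
  have tt : t = t0 by lra.
  pose t' := Num.max 0 (t - d / 2).
  have m1 : t' < t by rewrite gt_max; apply/andP; split; lra.
  have m2 : t - d / 2 <= t' by rewrite le_max lexx orbT.
  have m3 : 0 <= t' by rewrite le_max lexx.
  have : J t'.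
    apply: dP; first by rewrite itvP1; apply/andP; split; lra.
    by rewrite ler0_norm ?subr_le0 ?(ltW m1)//; lra.
  by move/J_le => /andP[]; lra.
have Dr : t1 < 1 -> forall t, t1 <= t <= 1 -> r <= D t.
  move=> t1p t /andP[h1 h2]; rewrite leNgt; apply/negP => Dt.
  have Jt : J t by split => //; rewrite itvP1; apply/andP; split; lra.
  have [d d0 dP] := nearJ _ Jt; have /J_le/andP[h3 h4] := Jt.
  have tt : t = t1 by lra.
  pose t' := Num.min 1 (t + d / 2).
  have m1 : t < t' by rewrite lt_min; apply/andP; split; lra.
  have m2 : t' <= t + d / 2 by rewrite ge_min lexx orbT.
  have m3 : t' <= 1 by rewrite ge_min lexx.
  have : J t'.
    apply: dP; first by rewrite itvP1; apply/andP; split; lra.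
    by rewrite ger0_norm ?subr_ge0 ?(ltW m1)//; lra.
  by move/J_le => /andP[]; lra.
have uI : {in `[t0, t1] &, injective u}.
  apply: econt_inj_closure.
    apply: econtS (klip_econt K0 uK) => x /=; rewrite !in_itv/= => /andP[? ?].
    by apply/andP; split; lra.
  move=> x y; rewrite !in_itv/= => /inJ[xI Dx] /inJ[yI Dy] uxy.
  apply: h_inj => //; apply: pinj.
  - by rewrite inE; split; [exact/open_cubeP|exists x].
  - by rewrite inE; split; [exact/open_cubeP|exists y].
  by apply/rowP => j; rewrite !mxE; case: eqP => // ->.
apply: (trace_le_dint (tc := tc) K0 uK r0 t00 t01 t11 uI cD Dl Dr).
  by rewrite itvP1; exact: J_le.
by rewrite /D tcE subrr normr0.
Qed.

End arc_trace.

(** * Vanishing of the coefficients *)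

Section bump_sums.
Context {R : realType} {n : nat}.
Local Notation V := 'rV[R]_n.

(** Otherwise the point dividing the segment between the centers in the ratio r1 : r2 would lie in
    both cubes. *)
Lemma disjoint_cubes_dist (c1 c2 : V) r1 r2 : 0 < r1 -> 0 < r2 ->
  open_cube c1 r1 `&` open_cube c2 r2 = set0 -> r1 + r2 <= `|c1 - c2|.
Proof.
move=> r10 r20 dis; rewrite leNgt; apply/negP => lt12.
have s0 : 0 < r1 + r2 by rewrite addr_gt0.
have : (open_cube c1 r1 `&` open_cube c2 r2) (c1 + (r1 / (r1 + r2)) *: (c2 - c1)).
  split; apply/open_cubeP => //.
    rewrite addrC addKr normrZ ger0_norm ?divr_ge0 ?ltW// distrC.
    by rewrite mulrAC ltr_pdivrMr// ltr_pM2l.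
  have -> : c1 + (r1 / (r1 + r2)) *: (c2 - c1) - c2 = (r2 / (r1 + r2)) *: (c1 - c2).
    have -> : r1 / (r1 + r2) = 1 - r2 / (r1 + r2) by field; rewrite gt_eqF.
    by rewrite scalerBl scale1r !scalerBr opprB; apply/rowP => j; rewrite !mxE; ring.
  by rewrite normrZ ger0_norm ?divr_ge0 ?ltW// mulrAC ltr_pdivrMr// ltr_pM2l.
by rewrite dis.
Qed.

Variables (k : nat) (c : 'I_k.+1 -> V) (rr : 'I_k.+1 -> R) (r : R).
Hypotheses (rr0 : forall i, 0 < rr i) (r0 : 0 < r) (r_le : forall i, r <= rr i).
Hypothesis dis : forall i j, i != j ->
  open_cube (c i) (rr i) `&` open_cube (c j) (rr j) = set0.

Definition cube_bump i x := bump (rr i) `|x - c i|.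

Lemma cube_bump_out i x : ~ open_cube (c i) (rr i) x -> cube_bump i x = 0.
Proof.
move=> nx; rewrite /cube_bump bump_out// leNgt; apply/negP => h.
by apply: nx; exact/open_cubeP.
Qed.

Lemma cube_bump_le i x : `|x - c i| <= rr i -> cube_bump i x <= 2 / r * (rr i - `|x - c i|).
Proof.
move=> xc; rewrite /cube_bump /bump ge_max; apply/andP; split.
  by rewrite mulr_ge0 ?subr_ge0// divr_ge0// ltW.
rewrite ge_min; apply/orP; right; apply: ler_wpM2r; first by rewrite subr_ge0.
by rewrite ler_pM2l// lef_pV2 ?posrE.
Qed.

Lemma cube_bump_lip i x y : `|cube_bump i x - cube_bump i y| <= 2 / r * `|x - y|.
Proof.
apply: le_trans (bump_lip _ _ (rr0 i)) _.
apply: ler_pM => //; first by rewrite divr_ge0// ltW.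
  by rewrite ler_pM2l// lef_pV2 ?posrE.
by apply: le_trans (ler_dist_dist _ _) _; rewrite opprB addrA subrK.
Qed.

(** A tent is at most 2 / r times the depth of the point in its cube, and the depths of two points
    in disjoint cubes add up to at most their distance. This is why signed sums of tents keep the
    Lipschitz constant 2 / r without doubling it. *)
Lemma cube_bump_far i j x y : i != j -> [\/ cube_bump i x = 0, cube_bump j y = 0 |
  cube_bump i x + cube_bump j y <= 2 / r * `|x - y|].
Proof.
move=> ij; have [xi|nxi] := pselect (open_cube (c i) (rr i) x); last first.
  by apply: Or31; exact: cube_bump_out.
have [yj|nyj] := pselect (open_cube (c j) (rr j) y); last first.
  by apply: Or32; exact: cube_bump_out.
apply: Or33; move/open_cubeP: xi => /(_ (rr0 i)) xi; move/open_cubeP: yj => /(_ (rr0 j)) yj.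
apply: le_trans (lerD (cube_bump_le (ltW xi)) (cube_bump_le (ltW yj))) _.
rewrite -mulrDr ler_pM2l ?divr_gt0//.
have := disjoint_cubes_dist (rr0 i) (rr0 j) (dis ij).
have h1 : `|c i - c j| <= `|x - c i| + `|x - y| + `|y - c j|.
  have -> : c i - c j = - (x - c i) + (x - y) + (y - c j).
    by rewrite opprB !addrA !subrK.
  by apply: le_trans (ler_normD _ _) _; rewrite lerD2r; apply: le_trans (ler_normD _ _) _; rewrite normrN.
by move: h1; lra.
Qed.

Lemma cube_bump_single x : exists i, forall j, j != i -> cube_bump j x = 0.
Proof.
have [[i xi]|nx] := pselect (exists i, cube_bump i x != 0); last first.
  by exists ord0 => j _; apply: contrapT => /eqP h; apply: nx; exists j.
exists i => j ji; have := cube_bump_far x x ji; rewrite subrr normr0 mulr0 => -[//|h|h].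
  by rewrite h eqxx in xi.
by have := bump_ge0 (rr i) `|x - c i|; have := bump_ge0 (rr j) `|x - c j|;
  move: h xi; rewrite /cube_bump; lra.
Qed.

Lemma bump_sum_lip (e : 'I_k.+1 -> R) x y : (forall i, `|e i| <= 1) ->
  `|\sum_i e i * cube_bump i x - \sum_i e i * cube_bump i y| <= 2 / r * `|x - y|.
Proof.
move=> e1.
have single z i : (forall j, j != i -> cube_bump j z = 0) ->
    \sum_j e j * cube_bump j z = e i * cube_bump i z.
  by move=> h; rewrite (bigD1 i)//= big1 ?addr0// => j /h ->; rewrite mulr0.
have le1 i (u v : R) : `|u| <= v -> `|e i * u| <= v.
  move=> uv; rewrite normrM; apply: le_trans uv.
  by apply: ler_piMl.
have b0 i z : `|cube_bump i z| = cube_bump i z by rewrite ger0_norm// bump_ge0.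
have [i xi] := cube_bump_single x; have [j yj] := cube_bump_single y.
rewrite (single _ _ xi) (single _ _ yj).
have [<-|ij] := eqVneq i j; first by rewrite -mulrBr; apply: le1; exact: cube_bump_lip.
have [h|h|h] := cube_bump_far x y ij.
- rewrite h mulr0 sub0r normrN; apply: le1; have := cube_bump_lip j x y.
  by rewrite (xi j) 1?eq_sym// sub0r normrN.
- rewrite h mulr0 subr0; apply: le1; have := cube_bump_lip i x y.
  by rewrite (yj i ij) subr0.
apply: le_trans (ler_normB _ _) _; apply: le_trans h; apply: lerD; apply: le1; by rewrite b0.
Qed.

End bump_sums.

(** * Continuity of sums, products and monomials *)

Section continuity.
Context {R : realType}.

Lemma econt_big_sum {U : normedModType R} (A : set U) (T : Type) (s : seq T) (g : T -> U -> R) :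
  (forall p, econt A (g p)) -> econt A (fun x => \sum_(p <- s) g p x).
Proof.
move=> cg; elim: s => [|p s IH].
  rewrite (_ : (fun _ => _) = cst 0); first exact: econt_cst.
  by apply/funext => x; rewrite big_nil.
rewrite (_ : (fun _ => _) = (fun x => 1 * g p x + \sum_(q <- s) g q x)).
  exact: econt_scale_add.
by apply/funext => x; rewrite big_cons mul1r.
Qed.

Lemma econt_big_prod {U : normedModType R} (A : set U) (T : Type) (s : seq T) (g : T -> U -> R) :
  (forall p, econt A (g p)) -> econt A (fun x => \prod_(p <- s) g p x).
Proof.
move=> cg; elim: s => [|p s IH].
  rewrite (_ : (fun _ => _) = cst 1); first exact: econt_cst.
  by apply/funext => x; rewrite big_nil.
rewrite (_ : (fun _ => _) = (fun x => g p x * \prod_(q <- s) g q x)).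
  exact: econtM.
by apply/funext => x; rewrite big_cons.
Qed.

Lemma econt_exp {U : normedModType R} (A : set U) (g : U -> R) m : econt A g ->
  econt A (fun x => g x ^+ m).
Proof.
move=> cg; rewrite (_ : (fun _ => _) = (fun x => \prod_(i <- iota 0 m) g x)).
  exact: econt_big_prod.
by apply/funext => x; rewrite big_const_seq count_predT size_iota -Monoid.iteropE.
Qed.

Lemma econt_monomial n {U : normedModType R} (A : set U) (c : U -> 'rV[R]_n) (e : 'I_n -> nat) :
  econt A c -> econt A (fun x => \prod_j c x 0 j ^+ e j).
Proof.
by move=> cc; apply: econt_big_prod => j; apply: econt_exp; exact: coord_econt.
Qed.

End continuity.

Lemma lipschitz_continuous {R : realType} {U : normedModType R} (f : U -> R) K : 0 < K ->
  (forall x y, `|f x - f y| <= K * `|x - y|) -> continuous f.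
Proof.
move=> K0 fK; apply/continuous_subspace_setT/econtP => x _ e e0.
exists (e / K); first by rewrite divr_gt0.
by move=> y _ yx; apply: le_lt_trans (fK y x) _; rewrite mulrC -ltr_pdivlMr.
Qed.

(** * Testing the coefficients with tents and polynomials *)

Section coefficients.
Context {R : realType} {n : nat}.
Local Notation V := 'rV[R]_n.
Variables (a b K : R) (F : R -> V).
Hypotheses (ab : a < b) (K0 : 0 < K) (FK : klip K F a b).
Variables (k : nat) (h : 'I_k.+1 -> R -> V) (X : set V) (M : 'I_k.+1 -> R).
Hypothesis triX : triangulation h X.
Hypothesis FM : forall (psi : V -> R) s, continuous psi ->
  dint (fun t => F t 0 s) (psi \o F) a b =
  \sum_i M i * dint (fun t => h i t 0 s) (psi \o h i) 0 1.
Variables (c : 'I_k.+1 -> V) (rr : 'I_k.+1 -> R) (dir : 'I_k.+1 -> 'I_n) (r l L rho : R)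
  (c0 : V) (d : nat).
Hypotheses (rr0 : forall i, 0 < rr i) (r0 : 0 < r) (r_le : forall i, r <= rr i).
Hypothesis dis : forall i j, i != j ->
  open_cube (c i) (rr i) `&` open_cube (c j) (rr j) = set0.
Hypothesis avoid : forall i j, j != i ->
  open_cube (c i) (rr i) `&` h j @` `[0, 1] = set0.
Hypothesis trace_ge : forall i,
  l <= `|dint (fun t => h i t 0 (dir i)) (cube_bump c rr i \o h i) 0 1|.
Hypothesis length_le : forall i, l1_length (h i) <= L.
Hypotheses (rho0 : 0 < rho) (X_cube : X `<=` closed_cube c0 rho).
Hypothesis small : n%:R * (2 / r) * rho * (pi / d.+2%:R) * L < l.
Hypothesis moments : forall (e : 'I_n -> nat) s, (forall j, (e j <= d)%N) ->
  dint (fun t => F t 0 s) (fun t => \prod_j F t 0 j ^+ e j) a b = 0.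

Lemma l1_lengthE i : l1_length (h i) =
  \sum_s \int[lebesgue_measure]_(t in `[0, 1]) `|derive1 (fun t => h i t 0 s) t|.
Proof.
have [Kh Kh0 hK] := arc_klip triX i.
by apply: (Rintegral_sum_abs_derive1 (K := fun=> Kh) ltr01) => // s; exact: coord_klip.
Qed.

Lemma dint_monomials (G : R -> V) (u v KG : R) (s : 'I_n)
    (C : {ffun 'I_n -> 'I_d.+1} -> R) : u < v -> 0 < KG -> klip KG G u v ->
  dint (fun t => G t 0 s) (fun t => \sum_e C e * \prod_j G t 0 j ^+ e j) u v =
  \sum_e C e * dint (fun t => G t 0 s) (fun t => \prod_j G t 0 j ^+ e j) u v.
Proof.
move=> uv KG0 GK.
have cG := klip_econt KG0 GK.
have := dint_sum (f := fun s t => G t 0 s) uv KG0 (fun s => coord_klip s GK) s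
  (index_enum _) C (G := fun e t => \prod_j G t 0 j ^+ e j) (lexx u) (lexx v).
by case=> // e; exact: econt_monomial.
Qed.

(** With the signs [eps] the tents contribute the sum of |M j| |tr j|, at least [l] times the sum of
    |M j|. Replacing each [psi s] by the polynomial [P s] costs at most [E * L] per arc, and the
    polynomials contribute nothing because the moments vanish. As [E * L < l], the sum of |M j| is
    zero. *)
Lemma coefficients_eq0 i : M i = 0.
Proof.
pose phi := cube_bump c rr.
pose tr i := dint (fun t => h i t 0 (dir i)) (phi i \o h i) 0 1.
pose eps s i : R := if dir i == s then Num.sg (M i * tr i) else 0.
have eps1 s j : `|eps s j| <= 1.
  by rewrite /eps; case: eqP => _; rewrite ?normr0// normr_sg; case: (_ != 0).
pose psi s x := \sum_j eps s j * phi j x.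
have psiL s x y : `|psi s x - psi s y| <= 2 / r * `|x - y|.
  exact: bump_sum_lip.
have r2 : 0 < 2 / r by rewrite divr_gt0.
have psic s : continuous (psi s).
  exact: lipschitz_continuous r2 (psiL s).
have /choice[C CP] : forall s, exists C : {ffun 'I_n -> 'I_d.+1} -> R, forall x,
    closed_cube c0 rho x -> `|psi s x - \sum_e C e * \prod_j x 0 j ^+ e j|
      <= n%:R * (2 / r) * rho * (pi / d.+2%:R).
  by move=> s; apply: jackson_multivariate => //; exact: ltW.
pose E : R := n%:R * (2 / r) * rho * (pi / d.+2%:R); have smallE : E * L < l := small.
pose P s (x : V) := \sum_e C s e * \prod_j x 0 j ^+ e j.
have Pe s : econt setT (P s).
  apply: econt_big_sum => e; apply: econtM; first exact: econt_cst.
  by apply: econt_monomial => x _ eta eta0; exists eta.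
have Pc s : continuous (P s) by apply/continuous_subspace_setT/econtP.
have FP s : dint (fun t => F t 0 s) (P s \o F) a b = 0.
  rewrite (_ : _ \o _ = fun t => \sum_e C s e * \prod_j F t 0 j ^+ e j)//.
  rewrite (dint_monomials s (C s) ab K0 FK) big1// => e _.
  by rewrite moments ?mulr0// => j; rewrite -ltnS.
have psiE s j t : t \in `[0, 1] -> psi s (h j t) = eps s j * phi j (h j t).
  move=> tI; rewrite /psi (bigD1 j)//= big1 ?addr0// => q qj.
  rewrite /phi cube_bump_out ?mulr0// => ct; rewrite eq_sym in qj.
  have : (open_cube (c q) (rr q) `&` h j @` `[0, 1]) (h j t) by split => //; exists t.
  by rewrite avoid.
have arcX j t : t \in `[0, 1] -> closed_cube c0 rho (h j t).
  move=> tI; apply: X_cube; have [_ <- _] := triX; exists j => //; by exists t.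
have ch j := arc_econt triX j.
have cpsi s j : econt (`[0, 1]%classic : set R) (psi s \o h j).
  by apply: econt_comp (ch j) (continuous_econt (A := setT) (psic s)).
have cP s j : econt (`[0, 1]%classic : set R) (P s \o h j).
  by apply: econt_comp (ch j) (Pe s).
(* Only the direction of the j-th cube contributes on the j-th arc: the tents of other arcs vanish
   there, and the j-th tent occurs in [psi s] for one [s] only. *)
have main j : \sum_s dint (fun t => h j t 0 s) (psi s \o h j) 0 1
    = Num.sg (M j * tr j) * tr j.
  have [Kh Kh0 hK] := arc_klip triX j.
  have pe s : dint (fun t => h j t 0 s) (psi s \o h j) 0 1
      = eps s j * dint (fun t => h j t 0 s) (phi j \o h j) 0 1.
    rewrite (@dint_ext _ _ _ (fun t => eps s j * (phi j \o h j) t + 0)); last first.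
      by move=> t tI /=; rewrite psiE// addr0.
    rewrite (dint_linear ltr01 Kh0 (coord_klip s hK))//.
    - rewrite (_ : dint _ (fun=> 0) _ _ = 0) ?addr0//.
      by rewrite /dint; under eq_Rintegral do rewrite mulr0; rewrite Rintegral_cst ?mul0r.
    - apply: econt_comp (ch j) (continuous_econt (A := setT) _) => //.
      by apply: lipschitz_continuous r2 _ => x y; exact: cube_bump_lip.
    - exact: econt_cst.
  rewrite (bigD1 (dir j))//= pe /eps eqxx big1 ?addr0// => s sj.
  by rewrite pe /eps eq_sym (negbTE sj) mul0r.
have diff j : `|\sum_s (dint (fun t => h j t 0 s) (psi s \o h j) 0 1
    - dint (fun t => h j t 0 s) (P s \o h j) 0 1)| <= E * L.
  have [Kh Kh0 hK] := arc_klip triX j.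
  have E0 : 0 <= E.
    apply: mulr_ge0; last by rewrite divr_ge0 ?pi_ge0.
    by apply: mulr_ge0 (ltW rho0); apply: mulr_ge0 (ltW r2).
  apply: le_trans (ler_norm_sum _ _ _) _.
  apply: le_trans _ (ler_wpM2l E0 (length_le j)); rewrite l1_lengthE mulr_sumr.
  apply: ler_sum => s _.
  have -> : dint (fun t => h j t 0 s) (psi s \o h j) 0 1
      - dint (fun t => h j t 0 s) (P s \o h j) 0 1
      = dint (fun t => h j t 0 s) (fun t => (-1) * (P s \o h j) t + (psi s \o h j) t) 0 1.
    by rewrite (dint_linear ltr01 Kh0 (coord_klip s hK))// mulN1r addrC.
  apply: (dint_le_l1 ltr01 Kh0 (coord_klip s hK)) => //; first exact: econt_scale_add.
  by move=> t tI; rewrite mulN1r addrC /=; apply: CP; exact: arcX.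
have absM j : M j * (Num.sg (M j * tr j) * tr j) = `|M j| * `|tr j|.
  by rewrite mulrCA mulrA -mulrA -normrM normrEsg.
have tot : \sum_j `|M j| * `|tr j| <= E * L * \sum_j `|M j|.
  have -> : \sum_j `|M j| * `|tr j| = \sum_j M j *
      \sum_s (dint (fun t => h j t 0 s) (psi s \o h j) 0 1
        - dint (fun t => h j t 0 s) (P s \o h j) 0 1).
    under [RHS]eq_bigr do rewrite sumrB main mulrBr absM.
    rewrite sumrB [X in _ - X](_ : _ = 0) ?subr0//.
    under eq_bigr do rewrite mulr_sumr.
    rewrite exchange_big big1//= => s _.
    by rewrite -(FM s (Pc s)) FP.
  rewrite mulr_sumr; apply: ler_sum => j _; rewrite mulrC.
  apply: le_trans (ler_norm _) _; rewrite normrM; apply: ler_wpM2r => //; exact: diff.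
have low : l * \sum_j `|M j| <= \sum_j `|M j| * `|tr j|.
  by rewrite mulr_sumr; apply: ler_sum => j _; rewrite mulrC ler_wpM2l// trace_ge.
have S0 : 0 <= \sum_j `|M j| by apply: sumr_ge0.
have : \sum_j `|M j| = 0.
  apply/eqP; rewrite eq_le S0 andbT leNgt; apply/negP => S1.
  by have := le_trans low tot; rewrite ler_pM2r// leNgt smallE.
move/eqP; rewrite psumr_eq0// => /allP/(_ i (mem_index_enum _))/=.
by rewrite normr_eq0 => /eqP.
Qed.

End coefficients.

(** * Universal centers *)

Local Arguments sd_gen {R n G} s _ _.
Local Arguments sd_h {R n G} s _ _.
Local Arguments sd_arc {R n G} s _ _.
Local Arguments sd_cube {R n G} s _ _.
Local Arguments sd_center {R n G} s _.
Local Arguments sd_radius {R n G} s _.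
Local Arguments sd_dir {R n G} s _.
Local Arguments sd_radius_gt0 {R n G} s _.
Local Arguments half_trace {R n G} T _.
Section star.
Context {R : realType} {n : nat}.
Local Notation V := 'rV[R]_n.
Variables (a b K : R) (F : R -> V) (G : set V) (d : nat).
Hypotheses (ab : a < b) (K0 : 0 < K) (FK : klip K F a b) (Fab : F a = F b).
Hypothesis FG : forall t, t \in `[a, b] -> G (F t).
Hypothesis moments : forall (e : 'I_n -> nat) s, (forall j, (e j <= d)%N) ->
  dint (fun t => F t 0 s) (fun t => \prod_j F t 0 j ^+ e j) a b = 0.

(** The bound on [NbarT T] says that [kap * dG < d], while the test of the coefficients asks for
    [kap * rho < d + 2] with [rho] the radius of some cube containing the generators. *)
Lemma star_datum_integral (psi : V -> R) s (T : star_datum G) : triangulable_curve G ->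
  NbarT T <= d%:Z -> continuous psi -> dint (fun t => F t 0 s) (psi \o F) a b = 0.
Proof.
move=> [_ _ [k [g triG]]] Nd cpsi.
have CE : sd_C T = \bigcup_j (sd_gen T j @` `[0, 1]) by case: T {Nd}.
have AE i : sd_arc T i = sd_h T i @` `[0, 1] by case: T {Nd CE} i.
have KE i : sd_cube T i = open_cube (sd_center T i) (sd_radius T i) by case: T {Nd CE AE} i.
have triC := sd_triang T; rewrite CE in triC.
have [M MP] := homologous_integral ab K0 FK Fab FG triG (@sd_gen_H1 _ _ _ T)
  (@sd_gen_simple _ _ _ T) (@sd_gen_sub _ _ _ T) triC.
suff M0 : forall i, M i = 0 by rewrite MP// big1// => i _; rewrite M0 mul0r.
pose r := \big[Num.min/sd_radius T ord0]_i sd_radius T i.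
pose l := \big[Num.min/half_trace T ord0]_i half_trace T i.
pose L := \big[Num.max/l1_length (sd_h T ord0)]_i l1_length (sd_h T i).
have rr0 i : 0 < sd_radius T i := sd_radius_gt0 T i.
have tr i : 0 < half_trace T i <= `|dint (fun t => sd_h T i t 0 (sd_dir T i))
    (cube_bump (sd_center T) (sd_radius T) i \o sd_h T i) 0 1|.
  have [Kh Kh0 hK] := arc_klip triC i.
  rewrite /half_trace AE; apply: (arc_trace Kh0 hK (arc_inj triC (i := i))) => //.
  - by rewrite -AE; exact: sd_center_in.
  - by rewrite -AE -KE; exact: sd_connected.
  - by rewrite -AE -KE; exact: sd_inj.
have min_gt0 m (x0 : R) (u : 'I_m -> R) : 0 < x0 -> (forall i, 0 < u i) ->
    0 < \big[Num.min/x0]_i u i.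
  by move=> x00 u0; elim/big_ind: _ => // x y x0' y0; rewrite lt_min x0'.
have r0 : 0 < r by apply: min_gt0.
have l0 : 0 < l by apply: min_gt0 => [|j]; [have /andP[] := tr ord0|have /andP[] := tr j].
have L0 : 0 <= L.
  apply: (@le_trans _ _ (l1_length (sd_h T ord0))); last exact: le_bigmax.
  by apply: Rintegral_ge0 => t _; apply: sumr_ge0.
pose dG := min_cube_radius (sd_C T).
pose S := [set rho | 0 <= rho /\ exists c : V, sd_C T `<=` closed_cube c rho].
(* The arcs are bounded, so some cube contains them and the infimum is a genuine one. *)
have S0 : S !=set0.
  have /choice[B BP] : forall i, exists B, 0 < B /\ forall t, t \in `[0, 1] -> `|sd_h T i t| <= B.
    move=> i'; have [Kh Kh0 hK] := arc_klip triC i'.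
    exists (Kh + `|sd_h T i' 0|); split; first by rewrite ltr_pwDl.
    move=> t tI; have z0 : 0 \in `[0, 1 : R] by rewrite itvP1 lexx ler01.
    rewrite -[sd_h T i' t](subrK (sd_h T i' 0)); apply: le_trans (ler_normD _ _) _.
    rewrite lerD2r; apply: le_trans (hK _ _ tI z0) _.
    move: tI; rewrite itvP1 subr0 => /andP[t0 t1]; rewrite ger0_norm//; apply: ler_piMr => //.
    exact: ltW.
  exists (\sum_i B i); split; first by apply: sumr_ge0 => j _; apply: ltW; have [] := BP j.
  exists 0 => x; rewrite CE; have [_ <- _] := triC; move=> [j _ [t tI <-]] q.
  rewrite mxE subr0; apply: le_trans (normr_coord _ _) _.
  apply: (@le_trans _ _ (B j)); first by have [_] := BP j; apply.
  by rewrite (bigD1 j)//= lerDl; apply: sumr_ge0 => j' _; apply: ltW; have [] := BP j'.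
have lbS : lbound S 0 by move=> rho [].
have dG0 : 0 <= dG by apply: lb_le_inf.
pose kap := 2 * pi * n%:R * L / (r * l).
have kap0 : 0 <= kap.
  by rewrite /kap divr_ge0 ?(mulr_ge0 (ltW r0) (ltW l0))// !mulr_ge0 ?pi_ge0.
(* [NbarT T] is a floor plus one, so being at most [d] means that the real quotient is strictly
   below [d]. *)
have X : kap * dG < d%:R.
  move: Nd; rewrite /NbarT -/r -/l -/L -/dG lezD1 floor_lt_int.
  by rewrite /kap mulrAC.
have de0 : 0 < (kap + 1)^-1 by rewrite invr_gt0 ltr_wpDl.
(* A radius strictly above the infimum is positive and admits a cube; the slack is such that [kap]
   times it is at most 1. *)
pose rho := dG + (kap + 1)^-1.
have [rho' [rho'0 [c0 c0P]] rho'rho] := inf_adherent de0 (conj S0 (ex_intro _ 0 lbS)).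
have rho0 : 0 < rho by rewrite ltr_wpDl.
have c0P' : \bigcup_j (sd_gen T j @` `[0, 1]) `<=` closed_cube c0 rho.
  by rewrite -CE => x /c0P cx j; apply: le_trans (cx j) _; exact: ltW.
apply: (coefficients_eq0 (X := \bigcup_j (sd_gen T j @` `[0, 1])) (c := sd_center T)
  (rr := sd_radius T) (dir := sd_dir T) (l := l) (L := L) ab K0 FK triC MP rr0 r0 _ _ _ _ _ rho0 c0P' _ moments).
- by move=> j; exact: bigmin_le.
- by move=> i' j ij; rewrite -!KE; exact: sd_disjoint.
- by move=> i' j ij; rewrite -KE -AE; exact: sd_avoid.
- by move=> j; apply: (@le_trans _ _ (half_trace T j)); [exact: bigmin_le|have /andP[] := tr j].
- by move=> j; exact: le_bigmax.
have -> : n%:R * (2 / r) * rho * (pi / d.+2%:R) * L = kap * rho * l / d.+2%:R.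
  by rewrite /kap; move: (d.+2%:R : R) (pnatr_eq0 R d.+2) => D /negbT D0; field; rewrite D0 !gt_eqF.
rewrite ltr_pdivrMr// [ltRHS]mulrC ltr_pM2r//.
have -> : kap * rho = kap * dG + kap / (kap + 1) by rewrite mulrDr.
have k1 : kap / (kap + 1) <= 1 by rewrite ler_pdivrMr ?mul1r ?lerDl// ltr_wpDl.
apply: lt_le_trans (ltr_leD X k1) _.
by rewrite natr1 ler_nat.
Qed.

End star.

Theorem theorem4p6 (R : realType) (n d : nat) (a b : R) (f : 'I_n -> R -> R)
    (hn : (0 < n)%N) (hab : a < b)
    (hlip : forall j, [lipschitz f j t | t in `[a, b]])
    (hnc : forall j, exists s t,
      [/\ s \in `[a, b], t \in `[a, b] & f j s != f j t])
    (ha : path_of f a = 0) (hb : path_of f b = 0)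
    (htriang : triangulable_curve (path_of f @` `[a, b]))
    (hP : class_Pstar a b d (path_of f)) :
  universal_center a b f <->
  (forall (e : 'I_n -> nat) (i : 'I_n),
     (\max_(j < n) e j <= d)%N -> moment a b f e i = 0).
Proof.
have [G [[triG _] [N isN Nd]] [Flip FG Fab [X [I [gam [_ _ [_ [W [k [e0 [_ _ trail]]]]]
  [q qc qP]]]]]]] := hP.
have [[al [be [_ IE]]] gamc gamI [E finE gamE] _] := trail.
have [K K0 FK] := lipschitz_klip Flip.
have coordE j : (fun t => path_of f t 0 j) = f j by apply/funext => t; rewrite mxE.
have fK j : klip K (f j) a b by rewrite -coordE; exact: coord_klip.
have fb j : f j b = 0 by rewrite -coordE hb mxE.
split=> [uc e i _|moments]; first exact: (universal_center_moment hab K0 fK).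
have dmoments (e : 'I_n -> nat) s : (forall j, (e j <= d)%N) ->
    dint (fun t => path_of f t 0 s) (fun t => \prod_j path_of f t 0 j ^+ e j) a b = 0.
  move=> ed; rewrite -[RHS](moments e s); last by apply/bigmax_leqP => j _.
  rewrite /dint /moment coordE; apply: eq_Rintegral => t _; rewrite mulrC; congr (_ * _).
  by apply: eq_bigr => j _; rewrite mxE.
have FG' t : t \in `[a, b] -> G (path_of f t) by move=> tI; apply: FG; exists t.
have zero (psi : 'rV[R]_n -> R) s : continuous psi ->
    dint (fun t => path_of f t 0 s) (psi \o path_of f) a b = 0.
  move=> cpsi; have [_ _ [m [g triGg]]] := triG.
  case: isN => [[G1 _]|[_ [T TN] _]].
    exact: (simply_connected_integral hab K0 FK Fab FG' triGg).
  by apply: (star_datum_integral hab K0 FK Fab FG' dmoments s (T := T)) => //; rewrite TN.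
have [Es EsE] : exists Es : seq (R * R), E = [set` Es] by apply/finite_seqP.
(* The reparametrisation [q] runs in an arc of the unit circle, so it has an angular lift. *)
have [th cth qth] : exists2 th : R -> R, econt `[a, b] th &
    forall t, t \in `[a, b] -> q t = ei (th t).
  apply: lift_itv => //; first exact/econtP.
  move=> t /qP[]; rewrite IE => -[u _ <-] _ /=; exact: cos2Dsin2.
apply: (tree_like_center hab K0 fK cth) => [|j s t sI tI est]; last first.
  by rewrite -coordE (qP _ sI).2 (qP _ tI).2 (qth _ sI) (qth _ tI) est.
apply: (@trail_closed _ _ _ _ _ _ _ I gam Es hab K0 FK cth) => //.
- by move=> t tI; rewrite -qth//; have [] := qP _ tI.
- by move=> t tI; rewrite -qth//; have [] := qP _ tI.
- exact/econtP.
move=> x y Ix Iy xE yE; apply: gamE; rewrite inE EsE; split => //=; exact/negP.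
Qed.
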